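(* Let $G$ be a finitely generated non-amenable group acting geometrically on a proper geodesic metric space $(X,d)$ with base point $o\in X$, and let $\mu$ be an irreducible, finitely supported probability measure on $G$ with Green function $\mathcal G$. For any $\theta\in(0,1]$ and $L\gg D$, every $\theta$-proportionally $(D,L)$-contracting ray $\gamma$ in $X$ contains an unbounded sequence of good points $\tilde z_n$ so that for any points $xo,yo\in X$ (with $x,y\in G$) that are $k$-antipodal along $(\gamma,z_no)$, where $z_n\in G$ satisfies $d(z_no,\tilde z_n)\le\varepsilon$, $$C^{-1}\mathcal G(x,z_n)\mathcal G(z_n,y)\le\mathcal G(x,y)\le C\,\mathcal G(x,z_n)\mathcal G(z_n,y),$$ where $\varepsilon$ is a universal constant given by the geometric action and $C$ depends only on $\theta,L,D$.
   Context: A geometric action is a proper cocompact isometric action. The measure $\mu$ is irreducible if its support generates $G$ as a group. With $p_n(x,y)=\mu^{*n}(x^{-1}y)$, the Green function is $\mathcal G(x,y)=\sum_{n\ge0}p_n(x,y)$. The notation $L\gg D$ means that $D>0$ and $L$ is sufficiently large compared with $D$. The constant $\varepsilon$. Fix a finite symmetric generating set $S$ of $G$ containing the support of $\mu$, with word metric $d_S$. A $\mu$-trajectory is a finite sequence $(g_0,\dots,g_n)$ in $G$ with $\mu(g_i^{-1}g_{i+1})>0$ for each $i$, of length $n$. The constant $\varepsilon>1$ is fixed so that $X=N_\varepsilon(Go)$ (the $\varepsilon$-neighborhood of the orbit); $\varepsilon^{-1}d(go,ho)-\varepsilon\le d_S(g,h)\le\varepsilon d(go,ho)+\varepsilon$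 for $g,h\in G$; and for every path $\alpha$ in $X$ there is a $\mu$-trajectory $\beta$ such that $\alpha$ and the image of $\beta$ under the orbit map $g\mapsto go$ lie in the $\varepsilon$-neighborhoods of each other and $\varepsilon^{-1}\|\alpha\|-\varepsilon\le\|\beta\|\le\varepsilon\|\alpha\|+\varepsilon$, where $\|\cdot\|$ is length. Proportional contraction. $\pi_Z$ denotes nearest-point projection onto a closed set $Z$; $Z$ is $D$-contracting if $d(x,y)\le d(x,Z)$ implies $\mathrm{diam}(\pi_Z(x)\cup\pi_Z(y))\le D$. For a geodesic segment $\gamma$, consider decompositions $\gamma=q_1p_1q_2\cdots q_np_nq_{n+1}$ ($n\ge0$) into geodesic segments with each $p_i$ $D$-contracting of length $\|p_i\|\ge L$ ($q_1,q_{n+1}$ may be trivial). Choose one for which $\sum_i\|p_i\|$ realizes, with error within $1$, the supremum over all such decompositions, and put $\|\mathrm{contr}_{(D,L)}(\gamma)\|=\sum_i\|p_i\|$. A geodesic segment $\gamma$ is $\theta$-proportionally $(D,L)$-contracting if $\|\mathrm{contr}_{(D,L)}(\gamma)\|\ge\theta\|\gamma\|>0$. A geodesic ray $\gamma:[0,\infty)\to X$, parameterized by arc length, is a $\theta$-proportionally $(D,L)$-contracting ray if $\liminf_{n\to\infty}\frac1n\|\mathrm{contr}_{(D,L)}(\gamma[0,n])\|\ge\theta>0$. Good points. A good point on the ray $\gamma$ means a point such that any subpath of $\gamma$ starting from that point and longer than a fixed number is proportionally contracting: the total length of $10D$-contracting segments of length $\ge L$ in it takes a proportion at least $\theta/4$.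 In terms of the general definition, a point $x$ on a geodesic $\gamma$ is $(\theta',R,D',L)$-good if for all $y\in\gamma$ with $d(x,y)\ge R$ the subsegment $[x,y]_\gamma$ is $\theta'$-proportionally $(D',L)$-contracting; here $\theta'=\theta/4$, $D'=10D$ and $R>0$ is the fixed number. Antipodality. The ray $\gamma=Y_1\cup Y_2$ is divided at the good point $\tilde z_n$ into its two sides $Y_1,Y_2$. Given $k>0$, points $p,q\in X$ are $k$-antipodal along $(\gamma,z_no)$ if $\pi_\gamma(p)\subset Y_1$, $\pi_\gamma(q)\subset Y_2$ (for one labelling of the two sides), $d(p,\gamma)\le k\cdot\mathrm{diam}(\pi_\gamma(p)\cup\{z_no\})$ and $d(q,\gamma)\le k\cdot\mathrm{diam}(\pi_\gamma(q)\cup\{z_no\})$.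
   Formalization: The constant C may also depend on the antipodality parameter k (besides θ, L, D), uniformly in γ, n, z_n, x, y; a bound uniform in k fails, e.g. in Z²∗Z² with γ=(ac)^∞, x=b^T, y=ab^T, k=T→∞. *)

(* Defs.v *)
From HB Require Import structures.
From mathcomp Require Export all_boot all_order all_algebra.
From mathcomp Require Export finmap.
From mathcomp Require Export all_classical all_reals all_analysis.

Set Implicit Arguments.
Unset Strict Implicit.
Unset Printing Implicit Defensive.
Import Order.TTheory GRing.Theory Num.Theory.
Import numFieldNormedType.Exports.

Local Open Scope classical_set_scope.
Local Open Scope ring_scope.

Section Groups.
Context {R : realType} {G : groupType}.

Definition is_subgroup (H : set G) : Prop :=
  H 1%g /\ forall g h, H g -> H h -> H (g * h^-1)%g.

Definition generates (A : set G) : Prop := smallest is_subgroup A = setT.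

Definition symmetric_set (A : set G) : Prop := forall g, A g -> A (g^-1)%g.

Definition word_dist (S : {fset G}) (g h : G) : R :=
  inf [set (size w)%:R | w in [set w : seq G |
    {subset w <= S} /\ (\big[*%g/1%g]_(s <- w) s = g^-1 * h)%g]].

(* von Neumann's definition: a left-invariant finitely additive probability
   defined on all the subsets of G. *)
Definition amenable : Prop :=
  exists m : set G -> R,
    [/\ forall A, 0 <= m A,
        m setT = 1,
        forall A B, A `&` B = set0 -> m (A `|` B) = m A + m B &
        forall (g : G) A, m [set (g * a)%g | a in A] = m A].

Implicit Types mu : {fsfun G -> R with 0}.

Definition probability_weight mu : Prop :=
  (forall g, 0 <= mu g) /\ \sum_(g <- finsupp mu) mu g = 1.

Definition irreducible_weight mu : Prop := generates [set` finsupp mu].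

Fixpoint conv_pow mu (n : nat) (g : G) : R :=
  if n is n'.+1 then
    \sum_(h <- finsupp mu) mu h * conv_pow mu n' (h^-1 * g)%g
  else (g == 1%g)%:R.

Definition green mu (x y : G) : \bar R :=
  (\sum_(0 <= n <oo) (conv_pow mu n (x^-1 * y)%g)%:E)%E.

(* The trajectory (g, s_1, ..., s_n); its length is size s = n. *)
Definition trajectory mu (g : G) (s : seq G) : bool :=
  path (fun g1 g2 => 0 < mu (g1^-1 * g2)%g) g s.

End Groups.
Arguments amenable R G : clear implicits.

Section Metric.
Context {R : realType} {X : metricType R}.
Implicit Types (x y z o : X) (Z : set X) (gamma alpha : R -> X).

Definition proper_space : Prop :=
  forall x (r : R), compact [set y | mdist x y <= r].

(* gamma is an isometric embedding of the interval I (arc-length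
   parameterization); its values outside I are irrelevant. *)
Definition geodesic_on (I : interval R) gamma : Prop :=
  {in I &, forall s t, mdist (gamma s) (gamma t) = `|s - t|}.

Definition geodesic_space : Prop :=
  forall x y, exists gamma (l : R),
    [/\ 0 <= l, geodesic_on `[0, l] gamma, gamma 0 = x & gamma l = y].

Definition nbhd_set (r : R) Z : set X :=
  [set x | exists2 z, Z z & mdist x z <= r].

Definition setdist x Z : R := inf [set mdist x z | z in Z].

Definition diameter Z : \bar R :=
  ereal_sup [set (mdist p.1 p.2)%:E | p in Z `*` Z].

Definition proj Z x : set X := [set z | Z z /\ mdist x z = setdist x Z].

Definition contracting (D : R) Z : Prop :=
  forall x y, mdist x y <= setdist x Z ->
    (diameter (proj Z x `|` proj Z y) <= D%:E)%E.

Definition path_length alpha (a b : R) : \bar R :=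
  ereal_sup [set (\sum_(i < size s)
      mdist (alpha (nth b (a :: s) i)) (alpha (nth b (a :: s) i.+1)))%:E
    | s in itv_partition a b].

(* The list of the intervals [s_i, t_i] parameterizing the pieces p_i of a
   decomposition q_1 p_1 q_2 ... p_n q_(n+1) of the segment gamma[a, b].
   Only the extreme pieces q_1 and q_(n+1) may be trivial. *)
Definition decomposition (D L : R) gamma (a b : R) (ps : seq (R * R)) : Prop :=
  (forall p, p \in ps ->
     [/\ a <= p.1, p.1 <= p.2, p.2 <= b, L <= p.2 - p.1 &
         contracting D (gamma @` `[p.1, p.2])]) /\
  sorted (fun p q => p.2 < q.1) ps.

Definition pieces_length (ps : seq (R * R)) : R := \sum_(p <- ps) (p.2 - p.1).

Definition near_optimal (D L : R) gamma (a b : R) : set (seq (R * R)) :=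
  [set ps | decomposition D L gamma a b ps /\
     forall qs, decomposition D L gamma a b qs ->
       pieces_length qs <= pieces_length ps + 1].

(* xget is the choice of one such decomposition: near_optimal is nonempty for
   a <= b, as the empty list is a decomposition and sums are at most b - a. *)
Definition contr (D L : R) gamma (a b : R) : R :=
  pieces_length (xget [::] (near_optimal D L gamma a b)).

Definition prop_contracting (theta D L : R) gamma (a b : R) : Prop :=
  theta * (b - a) <= contr D L gamma a b /\ 0 < theta * (b - a).

Definition prop_contracting_ray (theta D L : R) gamma : Prop :=
  [/\ geodesic_on `[0, +oo[ gamma,
      (theta%:E <=
        limn_einf (fun n : nat => (contr D L gamma 0 n%:R / n%:R)%:E))%E &
      0 < theta].

(* The point gamma t of the ray gamma is (theta, r, D, L)-good. *)
Definition good_point (theta r D L : R) gamma (t : R) : Prop :=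
  0 <= t /\ forall u, 0 <= u -> r <= mdist (gamma t) (gamma u) ->
    prop_contracting theta D L gamma (Num.min t u) (Num.max t u).

Definition ray_set gamma : set X := gamma @` `[0, +oo[.

Definition within_ratio (k : R) gamma z p : Prop :=
  ((setdist p (ray_set gamma))%:E <=
     k%:E * diameter (proj (ray_set gamma) p `|` [set z]))%E.

(* p and q are k-antipodal along (gamma, z), the ray gamma being divided at
   the point gamma t. *)
Definition antipodal (k : R) gamma (t : R) z p q : Prop :=
  let pr := proj (ray_set gamma) in
  let Y1 := gamma @` `[0, t] in
  let Y2 := gamma @` `[t, +oo[ in
  [/\ (pr p `<=` Y1 /\ pr q `<=` Y2) \/ (pr p `<=` Y2 /\ pr q `<=` Y1),
      within_ratio k gamma z p &
      within_ratio k gamma z q].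

End Metric.
Arguments proper_space {R} X.
Arguments geodesic_space {R} X.

Section Actions.
Context {R : realType} {G : groupType} {X : metricType R}.
Variables (act : G -> X -> X) (o : X).

Definition geometric_action : Prop :=
  [/\ (forall x, act 1%g x = x) /\
        (forall g h x, act (g * h)%g x = act g (act h x)),
      forall g x y, mdist (act g x) (act g y) = mdist x y,
      forall K, compact K -> finite_set [set g | (act g @` K) `&` K !=set0] &
      exists2 K, compact K & \bigcup_g (act g @` K) = setT].

(* The properties fixing the constant eps. Only rectifiable paths alpha are
   considered, as trajectories are finite. *)
Definition action_constant (mu : {fsfun G -> R with 0}) (S : {fset G})
    (eps : R) : Prop :=
  let orbit (A : set G) := [set act g o | g in A] in
  [/\ 1 < eps,
      nbhd_set eps (orbit setT) = setT,
      forall g h, eps^-1 * mdist (act g o) (act h o) - eps <= word_dist S g h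
        /\ word_dist S g h <= eps * mdist (act g o) (act h o) + eps &
      forall (alpha : R -> X) (a b l : R), a <= b ->
        {within `[a, b], continuous alpha} -> path_length alpha a b = l%:E ->
        exists (g : G) (s : seq G),
          [/\ trajectory mu g s,
              alpha @` `[a, b] `<=` nbhd_set eps (orbit [set` g :: s]),
              orbit [set` g :: s] `<=` nbhd_set eps (alpha @` `[a, b]),
              eps^-1 * l - eps <= (size s)%:R &
              (size s)%:R <= eps * l + eps]].

End Actions.

(* Main.v *)
(** Non-amenability gives [p_n <= C rho^n] with [rho < 1].  A trajectory that stays at
    distance at least [R0] from the ray moves slowly along its contracting pieces: while
    it travels a distance [R0], its projection to each piece moves by a bounded amount,
    and only at most two pieces see it move.  Cut a trajectory from [x] to [y] at its last
    time [w] near the side of [x] and at its next time [v] near the side of [y].  The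
    windows around a good point contain a definite proportion of contracting pieces and
    [x], [y] are antipodal, so the middle part takes at least [K (d(w,z) + d(v,z)) - K']
    steps, where [K] is as large as we like when [R0] is.  By Harnack's inequality,
    [G(x,w) G(v,y)] is at most [G(x,z) G(z,y)] times an exponential in
    [d(w,z) + d(v,z)], which the decay [rho^K] beats in the sum over [w] and [v].  The
    lower bound is the decomposition at the first passage through [z].

    Good points exist because a near-optimal decomposition of [0, n] has density close to
    [theta] on every initial segment, so that some index in a range independent of [n] is
    bad neither to its left nor to its right.

    Harnack's inequality needs every element to be reachable by the walk, while the
    support of [mu] generates [G] only as a group.  Let [P] be the monoid of the reachable
    elements.  Superlinear growth provides translates of one long contracting segment that
    face each other and form a tree.  Trajectories shadow the curves touring this tree; a
    minimality argument on the first visits to its branches yields, for each [g], elements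
    [b], [c] of a finite set independent of [g] with [b g c] invertible in [P].  Thus [G]
    is a finite union of sets [a H c], where [H] is the group of the units of [P], and
    [P = G] by a lemma of B. H. Neumann. *)

Require Import Defs.
From mathcomp Require Import zify ring lra.
Import Order.TTheory GRing.Theory Num.Theory.
Import numFieldNormedType.Exports.
Local Open Scope classical_set_scope.

Set Implicit Arguments.
Unset Strict Implicit.
Unset Printing Implicit Defensive.

(** * Walks in the free group on two letters *)

Local Open Scope group_scope.

(** How large [L] must be does not depend on [theta] or [k], although the distance kept from the ray
    does: a piece has to be longer than the move of a projection during one step or one block of
    steps, and a longer block at a larger distance still moves it by at most the contraction
    constant. The constants are chosen in this order: the Harnack constant and [rho], then [K], the
    block length [B] and the additive constants.

    The factor in [10 * D] is the price of cutting: windows cut pieces of a decomposition, and a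
    subsegment of a [D]-contracting geodesic is [10 * D]-contracting.

    For reachability, the obstacle is that trajectories run in one direction only. A trajectory
    shadowing a tour of the tree is recorded by the vertex that it is near and by a colour, its
    position relative to that vertex at the last crossing of the middle of a leg. There are finitely
    many colours, and a return to an equivalent position gives invertibility. *)

Definition letter := (bool * bool)%type.
Definition linv (s : letter) : letter := (s.1, ~~ s.2).

Lemma linvK : involutive linv. Proof. by case=> a b; rewrite /linv /= negbK. Qed.
Lemma linv_neq s : (linv s == s) = false. Proof. by case: s => [[] []]. Qed.

(* A reduced word is stored with its last letter at the head. *)
Fixpoint reduced (v : seq letter) : bool :=
  if v is s :: v' then (if v' is s' :: _ then s' != linv s else true) && reduced v' else true.

(** Right multiplication by [s] in the free group, that is a move to a neighbour in the 4-regular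
    tree. There, [suffix u v] says that [v] lies in the branch beyond [u]. *)
Definition step (v : seq letter) (s : letter) : seq letter :=
  if v is s' :: v' then if s' == linv s then v' else s :: v else [:: s].

Definition adj (v w : seq letter) : Prop := exists s, w = step v s.

Lemma reduced_step v s : reduced v -> reduced (step v s).
Proof.
case: v => //= s' v' /andP[h1 h2]; case: ifP => // /negbT h; rewrite /= h.
by rewrite h1.
Qed.

Lemma stepK v s : reduced v -> step (step v s) (linv s) = v.
Proof.
case: v => [|s' v'] /=; first by rewrite linvK eqxx.
case: eqP => [->|_ _]; last by rewrite /= linvK eqxx.
case: v' => //= s'' v'' /andP[h _].
by rewrite (negPf h).
Qed.

Lemma suffix_consE (T : eqType) (u v : seq T) a :
  suffix u (a :: v) = (u == a :: v) || suffix u v.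
Proof.
apply/suffixP/orP => [[[|b w] /=]|[/eqP ->|/suffixP[w ->]]].
- by move=> ->; left.
- by case=> _ ->; right; exact: suffix_suffix.
- by exists [::].
- by exists (a :: w).
Qed.

Lemma size_step v s : (size (step v s) <= (size v).+1)%N /\ (size v <= (size (step v s)).+1)%N.
Proof. by case: v => //= s' v'; case: ifP => _ /=; lia. Qed.

Lemma suffix_step (u v : seq letter) s : suffix u v -> (size u < size v)%N -> suffix u (step v s).
Proof.
case: v => [|s' v'] /=; first by case: u.
rewrite suffix_consE => /orP[/eqP-> /=|uv _]; first by rewrite ltnn.
by case: ifP => // _; rewrite !suffix_consE uv !orbT.
Qed.

(** The branch beyond [s :: u] hangs on the single edge that joins it to [u]. *)
Lemma enter_suffix s (u x : seq letter) s' :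
  ~~ suffix (s :: u) x -> suffix (s :: u) (step x s') -> x = u.
Proof.
case: x => [|a x'] /=.
  by move=> _; rewrite suffix_consE => /orP[/eqP[_ ->]|/size_suffix].
case: ifP => _; first by rewrite suffix_consE => /norP[_ /negPf ->].
by move=> /negPf h; rewrite suffix_consE h orbF => /eqP[].
Qed.

Lemma foldl_step_suffix (u v d : seq letter) : suffix u v -> (size u + size d < size v)%N ->
  suffix u (foldl step v d) /\ (size v - size d <= size (foldl step v d) <= size v + size d)%N.
Proof.
elim: d v => [|s d IH] v /=; first by move=> uv _; split => //; rewrite subn0 addn0 leqnn.
move=> uv lt; have [h1 h2] := size_step v s.
have lt1 : (size u < size v)%N by lia.
have lt2 : (size u + size d < size (step v s))%N by lia.
have [h3 h4] := IH _ (suffix_step s uv lt1) lt2.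
by split => //; lia.
Qed.

Lemma reduced_foldl v d : reduced v -> reduced (foldl step v d).
Proof. by elim: d v => //= s d IH v rv; apply: IH; exact: reduced_step. Qed.

Lemma reduced_nseq s v k : reduced (s :: v) -> reduced (nseq k s ++ s :: v).
Proof.
move=> rv; elim: k => //= k ->; rewrite andbT.
by case: k => [|k] /=; rewrite eq_sym linv_neq.
Qed.

(** Among three letters at most one cancels the last letter of [z], and at most one leads towards
    [x]. *)
Lemma fresh_child (z x : seq letter) : exists s, reduced z -> (reduced (s :: z) /\ ~~ suffix (s :: z) x).
Proof.
set ok := fun s => (if z is s' :: _ then s' != linv s else true) && ~~ suffix (s :: z) x.
suff [s /andP[h1 h2]] : exists s, ok s by exists s => rz /=; rewrite h1 rz.
have inj s s' : suffix (s :: z) x -> suffix (s' :: z) x -> s = s'.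
  clear ok; elim: x => [|a x IH]; first by rewrite !suffixs0.
  rewrite !suffix_consE => /orP[/eqP[<- <-]|h] /orP[/eqP|h'].
  - by case.
  - by move/size_suffix: h'; rewrite /= ltnn.
  - by case=> _ e; move/size_suffix: h; rewrite -e /= ltnn.
  - exact: IH.
pose s1 : letter := (true, true); pose s2 : letter := (true, false); pose s3 : letter := (false, true).
case: (boolP (ok s1)) => o1; first by exists s1.
case: (boolP (ok s2)) => o2; first by exists s2.
exists s3; move: o1 o2; rewrite /ok.
have [S1|] := boolP (suffix (s1 :: z) x); have [S2|] := boolP (suffix (s2 :: z) x).
- by have := inj _ _ S1 S2.
- move=> _ _; rewrite !andbT; case: (boolP (suffix (s3 :: z) x)) => [S3|_].
    by have := inj _ _ S1 S3.
  by case: z {ok inj S1} => [//|[[] []] z'].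
- move=> _; rewrite !andbT; case: (boolP (suffix (s3 :: z) x)) => [S3|_].
    by have := inj _ _ S2 S3.
  by case: z {ok inj S2} => [//|[[] []] z'].
- by move=> _ _; rewrite !andbT; case: z {ok inj} => [//|[[] []] z'].
Qed.

Definition monoid_closed (G : groupType) (P : set G) : Prop :=
  P 1%g /\ forall x y, P x -> P y -> P (x * y)%g.

Lemma first_depth (u v v' : seq letter) k : u <> [::] -> (0 < k)%N -> adj v v' ->
  suffix u v' -> (size u + k <= size v')%N -> ~~ (suffix u v && (size u + k <= size v)%N) ->
  size v' = (size u + k)%N.
Proof.
case: u => // a u _ k0 [s E] uv' /= sv' h; have [h1 _] := size_step v s; rewrite -E in h1.
have [su|nsu] := boolP (suffix (a :: u) v); first by move: h; rewrite su /=; lia.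
have := enter_suffix (s' := s) nsu; rewrite -E => /(_ uv') Ev.
by move: sv' h1; rewrite Ev /=; lia.
Qed.

Lemma sub_in_count (T : eqType) (a b : pred T) s : (forall y, y \in s -> a y -> b y) ->
  (count a s <= count b s)%N.
Proof.
elim: s => //= x s IH ab; apply: leq_add.
  by have := ab x (mem_head _ _); case: (a x) => // ->.
by apply: IH => y ys; apply: ab; rewrite inE ys orbT.
Qed.

Lemma count_eq_sub (T : eqType) (a b : pred T) s : (forall y, y \in s -> a y -> b y) ->
  (count b s <= count a s)%N -> forall y, y \in s -> b y -> a y.
Proof.
elim: s => //= x s IH ab.
have prec : (count a s <= count b s)%N.
  by apply: sub_in_count => y ys; apply: ab; rewrite inE ys orbT.
have abx : a x -> b x by apply: ab; rewrite mem_head.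
move=> cnt y; rewrite inE => /orP[/eqP->|ys].
  by move: cnt abx; case: (a x); case: (b x) => //=; lia.
apply: IH => //; first by move=> z zs; apply: ab; rewrite inE zs orbT.
by move: cnt abx; case: (a x); case: (b x) => //= cnt h; try lia; have := h isT.
Qed.

(** * Coloured walks in the tree and the order of a monoid *)

Section TreeWalk.
Variables (G : groupType) (P : set G) (B : seq G) (e : letter -> G).
Hypothesis HP : monoid_closed P.
Hypothesis He : forall s, e (linv s) = (e s)^-1.

(** A left-invariant preorder, whose equivalence classes are the left cosets of the group of units
    of [P]. *)
Definition prec x y := P (x^-1 * y).

Lemma prec_refl x : prec x x.
Proof. by rewrite /prec mulVg; apply HP.1. Qed.

Lemma prec_trans y x z : prec x y -> prec y z -> prec x z.
Proof.
move=> xy yz; rewrite /prec.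
have -> : x^-1 * z = (x^-1 * y) * (y^-1 * z) by rewrite mulgA mulgK.
exact: HP.2.
Qed.

Lemma prec_mul2l a x y : prec (a * x) (a * y) <-> prec x y.
Proof. by rewrite /prec invgM -!mulgA (mulgA a^-1) mulVg mul1g. Qed.

Fixpoint ev (v : seq letter) : G := if v is s :: v' then ev v' * e s else 1.

Lemma ev_step v s : ev (step v s) = ev v * e s.
Proof.
case: v => [|s' v'] //=; case: eqP => //= ->.
by rewrite He mulgVK.
Qed.

Fixpoint disp (d : seq letter) : G := if d is s :: d' then e s * disp d' else 1.

Lemma ev_foldl v d : ev (foldl step v d) = ev v * disp d.
Proof.
by elim: d v => [|s d IH] v /=; rewrite ?mulg1 // IH ev_step mulgA.
Qed.

Lemma disp_cat d1 d2 : disp (d1 ++ d2) = disp d1 * disp d2.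
Proof. by elim: d1 => [|s d IH] /=; rewrite ?mul1g // IH mulgA. Qed.

Lemma dispV d : exists d', disp d' = (disp d)^-1.
Proof.
elim: d => [|s d [d' e']]; first by exists [::]; rewrite /= invg1.
by exists (d' ++ [:: linv s]); rewrite disp_cat /= mulg1 He e' invgM.
Qed.

Lemma ev_disp v : exists d, disp d = ev v.
Proof.
elim: v => [|s v [d ed]]; first by exists [::].
by exists (d ++ [:: s]); rewrite disp_cat /= mulg1 ed.
Qed.

Lemma ev_diff v w : exists d, ev w = ev v * disp d.
Proof.
have [d1 e1] := ev_disp v; have [d2 e2] := ev_disp w; have [d1' e1'] := dispV d1.
by exists (d1' ++ d2); rewrite disp_cat e1' e1 e2 mulgA mulgV mul1g.
Qed.

(** The position in [G] is [ev (nu i) * be i]: a vertex of the tree times a correction from the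
    finite list [B]. Positions only increase for [prec], as the walk cannot be run backwards. *)
Definition walk (T : nat) (nu : nat -> seq letter) (be : nat -> G) : Prop :=
  (forall i, (i <= T)%N -> reduced (nu i) /\ be i \in B) /\
  (forall i, (i < T)%N -> (nu i.+1 = nu i \/ adj (nu i) (nu i.+1)) /\
     prec (ev (nu i) * be i) (ev (nu i.+1) * be i.+1)).

Lemma walk_le T nu be : walk T nu be -> forall i j, (i <= j <= T)%N ->
  prec (ev (nu i) * be i) (ev (nu j) * be j).
Proof.
move=> [_ W] i j; elim: j => [|j IH].
  by rewrite leqn0 => /andP[/eqP-> _]; exact: prec_refl.
rewrite leq_eqVlt => /andP[/orP[/eqP<- _|ij jT]]; first exact: prec_refl.
by apply: prec_trans (IH _) (W j jT).2; lia.
Qed.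

(* The walk enters the branch of the words extending u from outside and visits it
   up to depth M; at the first time at depth at least k its colour is b. *)
Definition first_color (k M : nat) (b : G) : Prop :=
  exists T nu be (u : seq letter), [/\ walk T nu be, u <> [::] /\ reduced u, ~~ suffix u (nu 0%N),
    (forall v, reduced v -> suffix u v -> (size v <= size u + M)%N ->
       exists2 i, (i <= T)%N & nu i = v) &
    exists i, [/\ (i <= T)%N, suffix u (nu i) && (size u + k <= size (nu i))%N,
      (forall j, (j < i)%N -> ~~ (suffix u (nu j) && (size u + k <= size (nu j))%N)) &
      be i = b]].

Lemma first_colorW k M M' b : (M' <= M)%N -> first_color k M b -> first_color k M' b.
Proof.
move=> MM [T [nu [be [u [W U N C F]]]]]; exists T, nu, be, u; split => // v rv uv sv.
by apply: C => //; lia.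
Qed.

Lemma exists_first_color k M T nu be (u : seq letter) : walk T nu be -> u <> [::] -> reduced u ->
  ~~ suffix u (nu 0%N) -> (k <= M)%N ->
  (forall v, reduced v -> suffix u v -> (size v <= size u + M)%N ->
       exists2 i, (i <= T)%N & nu i = v) ->
  exists i, [/\ (i <= T)%N, suffix u (nu i), be i \in B & first_color k M (be i)].
Proof.
move=> W u0 ru nu0 kM C.
case: u u0 ru nu0 C => // s u _ ru nu0 C.
set v := nseq k s ++ s :: u.
have rv : reduced v by exact: reduced_nseq.
have uv : suffix (s :: u) v by exact: suffix_suffix.
have sv : size v = (size (s :: u) + k)%N by rewrite size_cat size_nseq addnC.
have ex : exists i, suffix (s :: u) (nu i) && (size (s :: u) + k <= size (nu i))%N && (i <= T)%N.
  have [|i iT ni] := C v rv uv; first by lia.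
  by exists i; rewrite ni uv sv leqnn.
case: (ex_minnP ex) => i /andP[/andP[h3 h4] iT] mi.
exists i; split => //; first by have [_] := W.1 i iT.
exists T, nu, be, (s :: u); split => //; exists i; split => //; first by rewrite h3 h4.
move=> j ji; apply/negP => hj; have := mi j; rewrite hj /= => /(_ _).
by move=> h; have := h ltac:(lia); lia.
Qed.

(** The depth [k] is chosen before [M], because the [M] that [recurrent_step] asks for depends on
    [k]. *)
Definition recurrent (b : G) : Prop :=
  forall K, exists2 k, (K <= k)%N & forall M, first_color k M b.

(** A colour that is not recurrent is excluded, for every large [k], by some [M]. As [first_color]
    gets stronger when [M] grows, maxima over the finite list [B] exclude all of them at once. *)
Lemma recurrent_bound : exists k1 M1, (k1 <= M1)%N /\
  forall b, b \in B -> first_color k1 M1 b -> recurrent b.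
Proof.
suff [K HK] : exists K, forall k, (K <= k)%N -> exists M, forall b, b \in B ->
    first_color k M b -> recurrent b.
  have [M HM] := HK K (leqnn K); exists K, (maxn K M); split; first exact: leq_maxl.
  by move=> b bB /(first_colorW (leq_maxr K M)); exact: HM.
elim: B => [|b B' [K IH]]; first by exists 0%N => k _; exists 0%N.
have [rb|] := pselect (recurrent b).
  exists K => k Kk; have [M HM] := IH k Kk; exists M => b'.
  by rewrite inE => /orP[/eqP-> //|]; exact: HM.
move=> /existsNP[Kb Hb]; exists (maxn K Kb) => k Kk.
have [M HM] := IH k ltac:(lia).
have /existsNP[M' HM'] : ~ forall M, first_color k M b.
  by move=> h; apply: Hb; exists k => //; lia.
exists (maxn M M') => b'; rewrite inE => /orP[/eqP->|b'B] h.
  by case: HM'; apply: first_colorW h; exact: leq_maxr.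
by apply: HM b'B (first_colorW _ h); exact: leq_maxl.
Qed.

(** Colours met on the way to a recurrent one. An intermediate time of a walk provides such a
    colour, and one can step from it as from a recurrent colour. *)
Definition super (b : G) : Prop :=
  b \in B /\ exists d c, [/\ c \in B, recurrent c & prec b (disp d * c)].

(** When the walk first reaches depth [k] in the branch of [u], with colour [b], the vertex [z] at
    displacement [d] still has an unvisited part beyond it. The walk visits this part later, hence
    passes through [z], and meets a recurrent colour in it; the colour at [z] is the wanted one. *)
Lemma recurrent_step b d : b \in B -> recurrent b ->
  exists2 b', super b' & prec b (disp d * b').
Proof.
move=> bB rb; have [k1 [M1 [k1M1 R1]]] := recurrent_bound.
have [k kd Hk] := rb (size d).+1.
(* [z] has depth at most [k + size d] below [u], the word [u'] adds [k + 1] letters, and its branch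
   must be visited down to depth [M1]. *)
have [T [nu [be [u [W [u0 ru] nu0 C [i [iT /andP[ui si] mi bi]]]]]]] :=
  Hk (k + size d + k + 2 + M1)%N.
have rni := (W.1 _ iT).1.
have kpos : (0 < k)%N by move: kd; clear; lia.
have ipos : (0 < i)%N.
  by rewrite lt0n; apply/eqP => i0; rewrite i0 (negPf nu0) in ui.
have szi : size (nu i) = (size u + k)%N.
  case: i ipos iT ui si mi {bi rni} => // i _ iT ui si mi.
  have [E|A] := (W.2 i iT).1; first by have := mi i (ltnSn i); rewrite -E ui si.
  exact: first_depth u0 kpos A ui si (mi i (ltnSn i)).
pose z := foldl step (nu i) d.
have [uz /andP[z1 z2]] : suffix u z /\ (size (nu i) - size d <= size z <= size (nu i) + size d)%N.
  by apply: foldl_step_suffix => //; move: szi kd; clear; lia.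
have rz : reduced z by exact: reduced_foldl.
have [s /(_ rz)[rs nsi]] := fresh_child z (nu i).
(* The [k] copies of [s] push [u'] to depth at least [k] below [u], where no time before [i] has
   been. *)
pose u' := nseq k s ++ s :: z.
have ru' : reduced u' by exact: reduced_nseq.
have szu' : size u' = (size z + k).+1 by rewrite size_cat size_nseq /= addnS addnC.
have u'0 : u' <> [::] by move=> E; rewrite E in szu'.
have suff1 v : suffix u' v -> suffix (s :: z) v by move/catl_suffix.
have suff2 v : suffix u' v -> suffix u v.
  by move/suff1; apply: suffix_trans; rewrite suffix_consE uz orbT.
have fresh j : (j <= i)%N -> ~~ suffix u' (nu j).
  rewrite leq_eqVlt => /orP[/eqP->|ji]; first by apply: contra nsi; exact: suff1.
  apply/negP => h; have := mi j ji; rewrite suff2 //=.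
  have : (size u' <= size (nu j))%N := size_suffix h.
  by move: szu' z1 szi kd; clear; lia.
have [|i' [i'T ui' bi'B fc]] := exists_first_color W u'0 ru' (fresh 0%N (leq0n i)) k1M1.
  by move=> v rv uv sv; apply: C => //; [exact: suff2|move: sv szu' z2 szi; clear; lia].
have rb' := R1 _ bi'B fc.
have ii' : (i < i')%N.
  by rewrite ltnNge; apply/negP => /fresh; rewrite ui'.
(* The branch of [s :: z] does not contain the vertex at time [i], so the walk enters it after [i],
   from [z]. *)
have [t [ti ti' nt]] : exists t, [/\ (i <= t)%N, (t <= i')%N & nu t = z].
  have ex : exists j, (i <= j)%N && suffix (s :: z) (nu j).
    by exists i'; rewrite (ltnW ii') suff1.
  case: (ex_minnP ex) => j /andP[ij sj] mj.
  have ij' : (i < j)%N.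
    by rewrite ltn_neqAle ij andbT; apply/eqP => E; rewrite E sj in nsi.
  have ji' : (j <= i')%N by apply: mj; rewrite (ltnW ii') suff1.
  exists j.-1; split; [by move: ij'; clear; lia|by move: ji'; clear; lia|].
  have nsj : ~~ suffix (s :: z) (nu j.-1).
    by apply/negP => h; have := mj j.-1; rewrite h andbT; move: ij'; clear; lia.
  have := (W.2 j.-1 ltac:(move: ij' ji' i'T; clear; lia)).1; rewrite prednK; last by move: ij'; clear; lia.
  case=> [E|[s' E]]; first by rewrite -E sj in nsj.
  by apply: (enter_suffix nsj (s' := s')); rewrite -E.
have tT : (t <= T)%N by exact: leq_trans ti' i'T.
exists (be t).
  split; first by have [] := W.1 t tT.
  have [d' E] := ev_diff z (nu i').
  exists d', (be i'); split => //; have := walk_le W (i := t) (j := i') ltac:(by rewrite ti').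
  by rewrite E nt -mulgA prec_mul2l.
have := walk_le W (i := i) (j := t) ltac:(by rewrite ti).
by rewrite nt /z ev_foldl bi -mulgA prec_mul2l.
Qed.

Lemma super_step b d : super b -> exists2 b', super b' & prec b (disp d * b').
Proof.
move=> [bB [d1 [c [cB rc bc]]]]; have [d1' E] := dispV d1.
have [b' sb' h] := recurrent_step (d1' ++ d) cB rc.
exists b' => //; apply: prec_trans bc _.
have : prec (disp d1 * c) (disp d1 * (disp (d1' ++ d) * b')) by rewrite prec_mul2l.
by rewrite disp_cat E !mulgA mulgV mul1g.
Qed.

Hypothesis cover : forall n, exists T nu be s0, [/\ walk T nu be, ~~ suffix [:: s0] (nu 0%N) &
  forall v, reduced v -> suffix [:: s0] v -> (size v <= n)%N -> exists2 i, (i <= T)%N & nu i = v].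

Lemma exists_super : exists b, super b.
Proof.
have [k1 [M1 [k1M1 R1]]] := recurrent_bound.
have [T [nu [be [s0 [W nu0 C]]]]] := cover M1.+1.
have s00 : [:: s0] <> [::] by [].
have [|i [iT ui bB fc]] := exists_first_color W s00 isT nu0 k1M1.
  by move=> v rv uv sv; apply: C.
have rb := R1 _ bB fc; exists (be i); split => //; exists [::], (be i).
by split => //=; rewrite mul1g; exact: prec_refl.
Qed.

(* Choose a super colour b above a translate x with as few super colours above x as
   possible: every translate of a super colour above b then lies also below b. *)
Lemma exists_cycle s : exists b c, [/\ b \in B, c \in B,
  P (b^-1 * e s * c) & P (b^-1 * e s * c)^-1].
Proof.
pose Phi x := size [seq b <- B | `[< super b /\ prec x b >]].
have [b1 sb1] := exists_super.
have ex : exists m, `[< exists d b, super b /\ m = Phi (disp d * b) >].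
  by exists (Phi (disp [::] * b1)); apply/asboolP; exists [::], b1.
case: (ex_minnP ex) => m /asboolP[d [b [sb Em]]] min.
have [d' Ed] := dispV d.
have [b0 sb0 h] := super_step d' sb.
have xb0 : prec (disp d * b) b0 by move: h; rewrite -(prec_mul2l (disp d)) Ed mulgA mulgV mul1g.
have [c sc bc] := super_step [:: s] sb0.
have /asboolP[_ cb] : `[< super b0 /\ prec (disp [:: s] * c) b0 >].
  apply: (count_eq_sub (a := fun b => `[< super b /\ prec (disp [:: s] * c) b >])
            (b := fun b' => `[< super b' /\ prec (disp d * b) b' >]) (s := B)).
  - move=> y _ /asboolP[sy ly]; apply/asboolP; split => //.
    exact: prec_trans xb0 (prec_trans bc ly).
  - by rewrite -!size_filter -/(Phi _) -/(Phi (disp d * b)) -Em; apply: min; apply/asboolP; exists [:: s], c.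
  - by have [] := sb0.
  - by apply/asboolP.
exists b0, c; move: bc cb; rewrite /prec /= mulg1 => bc cb.
by split; [exact: sb0.1|exact: sc.1|rewrite -mulgA|rewrite -mulgA invgM invgK].
Qed.
End TreeWalk.

(** * Covers by cosets and by double cosets *)

Lemma pigeonhole (T : eqType) (L : seq T) (f : nat -> T) : (forall i, f i \in L) ->
  exists i j, (i < j)%N /\ f i = f j.
Proof.
move=> fL; have : ~~ uniq [seq f i | i <- iota 0 (size L).+1].
  apply/negP => u; have := uniq_leq_size u (s2 := L).
  rewrite size_map size_iota ltnn => h; suff : false by [].
  by apply: h => x /mapP[i _ ->].
move=> /(uniqPn (f 0%N)) [i [j [ij]]]; rewrite size_map size_iota => jL.
rewrite !(nth_map 0%N) ?size_iota //; try lia.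
by rewrite !nth_iota //; try lia; move=> E; exists (0 + i)%N, (0 + j)%N.
Qed.

Section Neumann.
Variable G : groupType.

Lemma subgroup1 (H : set G) : is_subgroup H -> H 1. Proof. by case. Qed.
Lemma subgroupV (H : set G) x : is_subgroup H -> H x -> H x^-1.
Proof. by move=> [H1 HM] Hx; rewrite -(mul1g x^-1); exact: HM. Qed.
Lemma subgroupM (H : set G) x y : is_subgroup H -> H x -> H y -> H (x * y).
Proof.
by move=> sH Hx Hy; rewrite -(invgK y); apply: sH.2 => //; exact: subgroupV.
Qed.

Definition finite_index (H : set G) : Prop :=
  exists L : seq G, forall g, exists2 c, c \in L & H (c^-1 * g).

(* B. H. Neumann's lemma *)
Lemma cosets_cover (K : nat -> set G) n (R : seq (G * nat)) :
  (forall i, is_subgroup (K i)) ->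
  (forall r, r \in R -> (r.2 < n)%N) ->
  (forall g, exists2 r, r \in R & K r.2 (r.1^-1 * g)) ->
  exists i, finite_index (K i).
Proof.
move=> sK; elim: n R => [|n IH] R Rn cR.
  by have [r rR _] := cR 1; have := Rn r rR.
have [fin|/existsNP[c Hc]] := pselect (forall c, exists r, [/\ r \in R, r.2 = n & K n (r.1^-1 * c)]).
  exists n, [seq r.1 | r <- R] => g; have [r [rR _ kr]] := fin g.
  by exists r.1 => //; apply/mapP; exists r.
(* No coset of [K n] in the cover contains [c], so [c K n] is covered by the cosets of the other
   subgroups. Their translates by [a c^-1] cover [a K n]. *)
pose R0 := [seq r <- R | (r.2 < n)%N].
apply: (IH (R0 ++ [seq (a.1 * c^-1 * r.1, r.2) | a <- R, r <- R0])).
  move=> r; rewrite mem_cat => /orP[|/allpairsP[[a r'] [_ h ->]] /=].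
    by rewrite mem_filter => /andP[].
  by move: h; rewrite mem_filter => /andP[].
move=> g; have [a aR Ka] := cR g.
have [an|] := ltnP a.2 n.
  by exists a => //; rewrite mem_cat mem_filter an aR.
move=> na; have ea : a.2 = n by have := Rn a aR; lia.
rewrite ea in Ka.
have [r rR Kr] := cR (c * (a.1^-1 * g)).
have rn : (r.2 < n)%N.
  rewrite ltn_neqAle -ltnS Rn // andbT; apply/eqP => er; apply: Hc; exists r; split => //.
  rewrite er in Kr; have := (sK n).2 _ _ Kr Ka.
  by rewrite [_^-1 * (c * _)]mulgA mulgK.
exists (a.1 * c^-1 * r.1, r.2) => /=; last by rewrite !invgM invgK !mulgA in Kr *.
rewrite mem_cat; apply/orP; right; apply/allpairsP; exists (a, r); split => //=.
by rewrite mem_filter rn rR.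
Qed.

(** A set [a H c^-1] is the left coset by [a c^-1] of the conjugate [c H c^-1]. Neumann's lemma
    gives a conjugate of finite index, and two powers of the corresponding conjugate of [p] lie in
    the same coset of it. *)
Lemma double_cosets_power (H : set G) (L : seq (G * G)) : is_subgroup H ->
  (forall g, exists2 c, c \in L & H (c.1^-1 * g * c.2)) ->
  forall p, exists2 n, (0 < n)%N & H (p ^+ n).
Proof.
move=> sH cov p.
pose K i : set G := [set z | H ((nth (1, 1) L i).2^-1 * z * (nth (1, 1) L i).2)].
have sK i : is_subgroup (K i).
  rewrite /K; move: (nth _ _ _).2 => y; split => /=.
    by rewrite mulg1 mulVg; exact: subgroup1.
  move=> g h Hg Hh; have := sH.2 _ _ Hg Hh.
  by rewrite !invgM invgK !mulgA mulgK.
have [||i [L' hL']] := @cosets_cover K (size L)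
    [seq ((nth (1, 1) L i).1 * (nth (1, 1) L i).2^-1, i) | i <- iota 0 (size L)] sK.
- by move=> r /mapP[i]; rewrite mem_iota => /andP[_ il] ->.
- move=> g; have [c cL Hc] := cov g.
  exists (c.1 * c.2^-1, index c L).
    apply/mapP; exists (index c L); first by rewrite mem_iota index_mem.
    by rewrite nth_index.
  by rewrite /K /= nth_index // invgM invgK !mulgA mulVg mul1g.
set y := (nth (1, 1) L i).2 in hL'.
pose q := y * p * y^-1.
have qn n : K i (q ^+ n) = H (p ^+ n).
  rewrite /K /= -/y; congr H; elim: n => [|n IH]; first by rewrite !expg0 mulg1 mulVg.
  by rewrite !expgSr -IH /q !mulgA mulgVK.
have ch n : {c | c \in L' & K i (c^-1 * q ^+ n)}.
  by apply: cid2; have [c] := hL' (q ^+ n); exists c.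
have [m [n [mn E]]] := pigeonhole (f := fun n => s2val (ch n)) (fun n => s2valP (ch n)).
exists (n - m)%N; first by lia.
rewrite -qn; have h1 := s2valP' (ch m); have h2 := s2valP' (ch n); rewrite -E in h2.
have := subgroupM (sK i) (subgroupV (sK i) h1) h2.
rewrite invgM invgK mulgA mulgK.
have -> : q ^+ n = q ^+ m * q ^+ (n - m) by rewrite -expgnDr subnKC // ltnW.
by rewrite mulKg.
Qed.

(** Each [p] in [P] has a power that is a unit of [P]; the inverse of [p] is the inverse of that
    power times a smaller power of [p]. So [P] is a group. *)
Lemma monoid_double_cosets (P : set G) (L : seq (G * G)) : monoid_closed P ->
  generates P ->
  (forall g, exists2 c, c \in L & P (c.1^-1 * g * c.2) /\ P (c.1^-1 * g * c.2)^-1) ->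
  P = setT.
Proof.
move=> HP gP cov.
pose H : set G := [set g | P g /\ P g^-1].
have sH : is_subgroup H.
  split; first by rewrite /H /= invg1; split; exact: HP.1.
  move=> g h [Pg Pg'] [Ph Ph']; split; first exact: HP.2.
  by rewrite invgM invgK; exact: HP.2.
have PV p : P p -> P p^-1.
  move=> Pp; have [n n0 [_ hn]] := double_cosets_power sH cov p.
  case: n n0 hn => // n _; rewrite expgSr invgM => h.
  suff Pn m : P (p ^+ m).
    by have := HP.2 _ _ h (Pn n); rewrite mulgVK.
  by elim: m => [|m IH]; [rewrite expg0; exact: HP.1|rewrite expgSr; exact: HP.2].
apply/seteqP; split => // g _.
move: gP => /seteqP[_ /(_ g I)]; apply; split => //; split; first exact: HP.1.
by move=> x y Px Py; apply: HP.2 => //; exact: PV.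
Qed.
End Neumann.

Local Close Scope group_scope.
Local Open Scope ring_scope.

(** * Projections to contracting geodesics *)

Section Lipschitz.
Context {R : realType}.

Lemma lipschitz_continuous (Y : metricType R) (f : R -> Y) (a b K : R) : 0 <= K ->
  (forall s t, a <= s <= b -> a <= t <= b -> mdist (f s) (f t) <= K * `|s - t|) ->
  {within `[a, b], continuous f}.
Proof.
move=> K0 L; apply/subspace_continuousP => x; rewrite /= in_itv /= => xab.
move=> U /nbhs_ballP[e /= e0 eU].
have K1 : 0 < K + 1 by lra.
apply/nbhs_ballP; exists (e / (K + 1)); first by rewrite /= divr_gt0.
move=> y /= xy; rewrite in_itv /= => yab; apply: eU; rewrite ballEmdist /=.
apply: le_lt_trans (L _ _ xab yab) _.
rewrite -ball_normE /= ltr_pdivlMr // in xy; apply: le_lt_trans xy.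
by rewrite mulrC ler_wpM2l // lerDl.
Qed.

Lemma lipschitz_continuous_real (f : R -> R) (a b K : R) : 0 <= K ->
  (forall s t, a <= s <= b -> a <= t <= b -> `|f s - f t| <= K * `|s - t|) ->
  {within `[a, b], continuous f}.
Proof.
move=> K0 L; apply/subspace_continuousP => x; rewrite /= in_itv /= => xab.
move=> U /nbhs_ballP[e /= e0 eU].
have K1 : 0 < K + 1 by lra.
apply/nbhs_ballP; exists (e / (K + 1)); first by rewrite /= divr_gt0.
move=> y /= xy; rewrite in_itv /= => yab; apply: eU => /=.
apply: le_lt_trans (L _ _ xab yab) _.
rewrite -ball_normE /= ltr_pdivlMr // in xy; apply: le_lt_trans xy.
by rewrite mulrC ler_wpM2l // lerDl.
Qed.
End Lipschitz.

Section Nearest.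
Context {R : realType} {X : metricType R}.
Implicit Types (x y z : X) (q g : R -> X) (a b : R).

Lemma dist_tri x y z : mdist x z <= mdist x y + mdist y z.
Proof. exact: metric_triangle. Qed.

Lemma dist_triB x y z : `|mdist x z - mdist y z| <= mdist x y.
Proof.
rewrite ler_norml; apply/andP; split.
  by have := dist_tri y x z; rewrite (metric_sym y x); lra.
by have := dist_tri x y z; lra.
Qed.

Definition geod a b q : Prop :=
  forall s t, a <= s <= b -> a <= t <= b -> mdist (q s) (q t) = `|s - t|.

Lemma geodesic_onP a b q : geodesic_on `[a, b] q <-> geod a b q.
Proof.
split=> [h s t hs ht|h s t]; first by apply: h; rewrite in_itv.
by rewrite !in_itv; exact: h.
Qed.

Definition nearest q a b x t : Prop :=
  a <= t <= b /\ forall s, a <= s <= b -> mdist x (q t) <= mdist x (q s).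

Lemma nearest_ex q a b x : a <= b -> geod a b q -> exists t, nearest q a b x t.
Proof.
move=> ab gq.
have cf : {within `[a, b], continuous (fun t => mdist x (q t))}.
  apply: (@lipschitz_continuous_real _ _ _ _ 1) => // s t hs ht.
  by rewrite mul1r -(gq s t) // !(metric_sym x); exact: dist_triB.
have [c cab H] := EVT_min ab cf; exists c; split; first by rewrite in_itv in cab.
by move=> s hs; apply: H; rewrite in_itv.
Qed.

Lemma setdist_le x (Z : set X) z : Z z -> setdist x Z <= mdist x z.
Proof.
move=> Zz; apply: ge_inf; last by exists z.
by exists 0 => _ [w _ <-]; exact: mdist_ge0.
Qed.

Lemma setdist_nearest q a b x t : nearest q a b x t ->
  setdist x (q @` `[a, b]) = mdist x (q t).
Proof.
move=> [tab H]; apply/eqP; rewrite eq_le; apply/andP; split.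
  by apply: setdist_le; exists t => //=; rewrite in_itv.
apply: lb_le_inf; first by exists (mdist x (q t)); exists (q t) => //; exists t => //=; rewrite in_itv.
by move=> _ [_ [s /= hs <-] <-]; apply: H; rewrite in_itv in hs.
Qed.

Lemma proj_nearest q a b x t : a <= b -> geod a b q -> a <= t <= b ->
  (proj (q @` `[a, b]) x (q t) <-> nearest q a b x t).
Proof.
move=> ab gq tab; split=> [[_ E]|n]; last first.
  split; first by exists t => //=; rewrite in_itv.
  by rewrite (setdist_nearest n).
split => // s hs; rewrite E; apply: setdist_le; exists s => //=; by rewrite in_itv.
Qed.

Lemma diameter_le (Z : set X) (D : R) :
  (diameter Z <= D%:E)%E <-> (forall x y, Z x -> Z y -> mdist x y <= D).
Proof.
split=> [h x y Zx Zy|h].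
  by rewrite -lee_fin; apply: le_trans h; apply: ereal_sup_ubound; exists (x, y).
by apply: ge_ereal_sup => _ [[x y] [/= Zx Zy] <-]; rewrite lee_fin; exact: h.
Qed.

(* The projection to a contracting geodesic, read on the parameter interval. *)
Definition cgeod D q a b : Prop :=
  [/\ a <= b, geod a b q &
  forall x y s t, nearest q a b x s -> nearest q a b y t ->
    mdist x y <= mdist x (q s) -> `|s - t| <= D].

Lemma contracting_cgeod D q a b : a <= b -> geod a b q ->
  contracting D (q @` `[a, b]) -> cgeod D q a b.
Proof.
move=> ab gq C; split => // x y s t nx ny xy.
have := C x y; rewrite (setdist_nearest nx) => /(_ xy) /diameter_le.
move=> /(_ (q s) (q t)); rewrite gq; [|exact: nx.1|exact: ny.1]; apply.
  by left; apply/proj_nearest => //; exact: nx.1.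
by right; apply/proj_nearest => //; exact: ny.1.
Qed.

Lemma cgeod_contracting D q a b :
  (forall x s t, nearest q a b x s -> nearest q a b x t -> `|s - t| <= D) ->
  cgeod D q a b -> contracting D (q @` `[a, b]).
Proof.
move=> dx [ab gq C] x y xy.
have pr z w : proj (q @` `[a, b]) z w -> exists2 s, w = q s & nearest q a b z s.
  move=> pzw; have [[s /= hs E] _] := pzw; rewrite in_itv /= in hs.
  by exists s => //; apply/proj_nearest => //; rewrite E.
apply/diameter_le => z w [/pr[s -> ns]|/pr[s -> ns]] [/pr[t -> nt]|/pr[t -> nt]];
  rewrite (gq _ _ ns.1 nt.1).
- exact: dx ns nt.
- by apply: (C _ _ _ _ ns nt); rewrite -(setdist_nearest ns).
- by rewrite distrC; apply: (C _ _ _ _ nt ns); rewrite -(setdist_nearest nt).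
- exact: dx ns nt.
Qed.
End Nearest.

Section Contracting.
Context {R : realType} {X : metricType R}.
Implicit Types (x y z m u v : X) (q g : R -> X) (a b r s t D : R).

Lemma dist_tri3 (x y z : R) : `|x - z| <= `|x - y| + `|y - z|.
Proof. exact: ler_distD. Qed.

(** Which nearest parameter is chosen matters little: on a contracting segment two of them differ by
    at most [D]. *)
Definition cp q a b x : R := xget a [set t | nearest q a b x t].
Definition dq q a b x : R := mdist x (q (cp q a b x)).

Hypothesis geoX : geodesic_space X.

Lemma geodesic_between x y : exists g, [/\ geod 0 (mdist x y) g, g 0 = x, g (mdist x y) = y &
  forall t, 0 <= t <= mdist x y -> mdist x (g t) = t /\ mdist (g t) y = mdist x y - t].
Proof.
have [g [l [l0 /geodesic_onP gl g0 gl']]] := geoX x y.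
have E : l = mdist x y by rewrite -g0 -gl' gl ?lexx ?l0 // sub0r normrN ger0_norm.
rewrite -E; exists g; split => // t /andP[t0 tl]; split.
  by rewrite -g0 gl ?lexx ?l0 ?t0 // sub0r normrN ger0_norm.
by rewrite -gl' gl ?lexx ?l0 ?t0 // distrC ger0_norm // subr_ge0.
Qed.

Lemma intermediate x y r : 0 <= r <= mdist x y ->
  exists m, mdist x m = r /\ mdist m y = mdist x y - r.
Proof.
by move=> h; have [g [_ _ _ H]] := geodesic_between x y; exists (g r); exact: H.
Qed.

Variables (D : R) (q : R -> X) (a b : R).
Hypotheses (D0 : 0 < D) (CG : cgeod D q a b).
Ltac lr := move: (D0); clear -CG geoX D0; lra.
Notation c := (cp q a b).
Notation d := (dq q a b).

Lemma cp_nearest x : nearest q a b x (c x).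
Proof.
by rewrite /cp; case: xgetP => [t -> //|h]; have [t /h] := nearest_ex x (let: And3 h _ _ := CG in h) (let: And3 _ h _ := CG in h).
Qed.

Lemma cp_in x : a <= c x <= b. Proof. exact: (cp_nearest x).1. Qed.

Lemma dq_ge0 x : 0 <= d x. Proof. exact: mdist_ge0. Qed.

Lemma dq_le x t : a <= t <= b -> d x <= mdist x (q t).
Proof. by move=> h; apply: (cp_nearest x).2. Qed.

Lemma dist_q s t : a <= s <= b -> a <= t <= b -> mdist (q s) (q t) = `|s - t|.
Proof. by case: CG => _ gq _; exact: gq. Qed.

Lemma cp_contr x y : mdist x y <= d x -> `|c x - c y| <= D.
Proof. by case: CG => _ _; apply; exact: cp_nearest. Qed.

Lemma nearest_cp x t : nearest q a b x t -> `|t - c x| <= D.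
Proof.
move=> nt; case: CG => _ _ C; apply: (C x x _ _ nt (cp_nearest x)).
by rewrite mdistxx mdist_ge0.
Qed.

Lemma dq_lip x y : d x <= d y + mdist x y.
Proof.
by apply: le_trans (dq_le x (cp_in y)) _; rewrite addrC; exact: dist_tri.
Qed.

Lemma cp_q t : a <= t <= b -> c (q t) = t.
Proof.
move=> ht; have := dq_le (q t) ht; rewrite mdistxx /dq dist_q ?cp_in //.
by rewrite normr_le0 subr_eq0 => /eqP.
Qed.

Lemma dq_q t : a <= t <= b -> d (q t) = 0.
Proof. by move=> ht; rewrite /dq cp_q // mdistxx. Qed.

Lemma dist_cp x y : `|c x - c y| <= d x + mdist x y + d y.
Proof.
rewrite -dist_q ?cp_in //; have := dist_tri (q (c x)) x (q (c y)).
have := dist_tri x y (q (c y)); rewrite (metric_sym (q (c x)) x) /dq; lra.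
Qed.

Lemma dist_le_cp x y : mdist x y <= d x + `|c x - c y| + d y.
Proof.
rewrite -dist_q ?cp_in //; have := dist_tri x (q (c x)) y.
have := dist_tri (q (c x)) (q (c y)) y; rewrite (metric_sym (q (c y)) y) /dq; lra.
Qed.

(** Outside the ball where contraction applies, [d x] is smaller than the distance and the triangle
    inequality suffices. *)
Lemma cp_lip x y : `|c x - c y| <= D \/ `|c x - c y| <= 4 * mdist x y.
Proof.
have [h|h] := leP (mdist x y) (d x); first by left; exact: cp_contr.
by right; have := dist_cp x y; have := dq_lip y x; rewrite (metric_sym y x); lra.
Qed.

Lemma cp_dist_q x t : a <= t <= b -> `|c x - t| <= 2 * mdist x (q t).
Proof.
move=> ht; have := dist_cp x (q t); rewrite cp_q // dq_q // addr0.
by have := dq_le x ht; lra.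
Qed.

Lemma archi_ind (P : X -> Prop) z e : 0 < e ->
  (forall x, (forall y, mdist y z <= mdist x z - e -> P y) -> P x) -> forall x, P x.
Proof.
move=> e0 H x.
suff : forall n x, mdist x z < n%:R * e -> P x.
  move=> h; apply: (h (Num.bound (mdist x z / e))); rewrite -ltr_pdivrMr //.
  by apply: archi_boundP; rewrite divr_ge0 ?mdist_ge0 // ltW.
elim=> [|n IH] {}x; first by rewrite mul0r ltNge mdist_ge0.
move=> h; apply: H => y hy; apply: IH; rewrite -natr1 mulrDl mul1r in h; lra.
Qed.

(** Walk towards [q t] by steps of length [d x]. A step moves the projection by at most [D], and as
    long as the new point is at distance at least [D] from the segment, that distance pays for the
    move. *)
Lemma dist_q_ge x t : a <= t <= b -> d x + `|c x - t| - 2 * D <= mdist x (q t).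
Proof.
move=> ht; move: x; apply: (@archi_ind _ (q t) D) => // x IH.
have [rD|Dr] := ltP (d x) D.
  have := dist_cp x (q t); rewrite cp_q // dq_q //; lra.
have [|m [xm mt]] := @intermediate x (q t) (d x); first by rewrite dq_ge0 dq_le.
have cxm : `|c x - c m| <= D by apply: cp_contr; rewrite xm.
have tr := dist_tri3 (c x) (c m) t.
have [h|h] := ltP (d m) D.
  have := dist_cp m (q t); rewrite cp_q // dq_q //; lra.
have := IH m; rewrite mt; lra.
Qed.

(** The same descent with a target off the segment. It stops within [D] of the segment, where
    [dist_q_ge] applied to [y] takes over, or when [y] enters the contraction ball. *)
Lemma dist_ge x y : d x <= mdist x y -> d x + `|c x - c y| - 4 * D <= mdist x y.
Proof.
have near u : d u < D -> d y + `|c u - c y| - 3 * D <= mdist u y.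
  move=> h; have := dist_q_ge y (cp_in u); have := dist_tri y u (q (c u)).
  rewrite (metric_sym y u) (distrC (c y)) -/(d u); lra.
move: x; apply: (@archi_ind _ y D) => // x IH xy.
have [rD|Dr] := ltP (d x) D; first by have := near x rD; have := dq_ge0 y; lra.
have [|m [xm my]] := @intermediate x y (d x); first by rewrite dq_ge0.
have cxm : `|c x - c m| <= D by apply: cp_contr; rewrite xm.
have tr := dist_tri3 (c x) (c m) (c y).
have [h|h] := ltP (d m) D; first by have := near m h; have := dq_ge0 y; lra.
have [h'|h'] := leP (d m) (mdist m y); first by have := IH m; rewrite my; lra.
have : `|c m - c y| <= D by apply: cp_contr; exact: ltW.
by move: D0 tr cxm xy; lr.
Qed.

Definition between x m y : Prop := mdist x m + mdist m y = mdist x y.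

Lemma between_trans x p m p' : between x p m -> between p p' m -> between x p' m.
Proof.
rewrite /between => h1 h2; apply/eqP; rewrite eq_le dist_tri andbT.
have := dist_tri x p p'; lra.
Qed.

(** Cut the way from [x] to [m] into steps of length [e]: each stays in the contraction ball of its
    origin and moves the projection by at most [D]. *)
Lemma cp_slow e x m : 0 < e -> (forall p, between x p m -> e <= d p) ->
  e * (`|c x - c m| - D) <= D * mdist x m.
Proof.
move=> e0; move: x; apply: (@archi_ind _ m e) => // x IH far.
have xx : e <= d x by apply: far; rewrite /between mdistxx add0r.
have [h|h] := leP (mdist x m) e.
  have : `|c x - c m| <= D by apply: cp_contr; exact: le_trans xx.
  move=> h1; apply: (@le_trans _ _ 0); last by rewrite mulr_ge0 ?mdist_ge0 ?(ltW D0).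
  by rewrite mulr_ge0_le0 ?(ltW e0) ?subr_le0.
have [|p [xp pm]] := @intermediate x m e; first by rewrite ltW //= ltW.
have cxp : `|c x - c p| <= D by apply: cp_contr; rewrite xp.
have bp : between x p m by rewrite /between xp pm subrKC.
have := IH p; rewrite pm => /(_ (lexx _)) => h1.
have {}h1 : e * (`|c p - c m| - D) <= D * (mdist x m - e).
  by apply: h1 => p' bp'; apply: far; exact: between_trans bp'.
have tr := dist_tri3 (c x) (c p) (c m).
have : e * (`|c x - c m| - D) <= e * (`|c p - c m| - D) + e * D.
  by rewrite -mulrDr ler_wpM2l ?(ltW e0) //; move: tr cxp; lr.
by move: h1; rewrite mulrBr (mulrC e D); lr.
Qed.

(** By [cp_slow] a move [w] of the projection costs a length of about [e * w / D], whereas the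
    detour through the segment is only [w] longer than the two distances to it. For [e] at least
    [3 * D] this bounds [w]. *)
Lemma cp_far e x m : 3 * D <= e -> (forall p, between x p m -> e <= d p) ->
  d m <= e + 3 * D -> `|c x - c m| <= 6 * D.
Proof.
move=> eD far dm; have e0 : 0 < e by move: eD D0; lr.
have [h|h] := leP (mdist x m) (d x).
  by have := cp_contr h; lr.
have [|p [xp pm]] := @intermediate x m (d x); first by rewrite dq_ge0 ltW.
have cxp : `|c x - c p| <= D by apply: cp_contr; rewrite xp.
have bp : between x p m by rewrite /between xp pm subrKC.
have h1 : e * (`|c p - c m| - D) <= D * (mdist x m - d x).
  by rewrite -pm; apply: cp_slow => // p' bp'; apply: far; exact: between_trans bp'.
have tr := dist_tri3 (c x) (c p) (c m).
have h2 := dist_le_cp x m.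
have h3 : D * (mdist x m - d x) <= D * (`|c x - c m| + e + 3 * D).
  by rewrite ler_wpM2l ?(ltW D0) //; move: h2 dm; lr.
have h4 : e * (`|c x - c m| - 2 * D) <= e * (`|c p - c m| - D).
  by rewrite ler_wpM2l ?(ltW e0) //; move: tr cxp; lr.
set w := `|c x - c m| in h2 h3 h4 *.
have h5 : (e - D) * w <= 3 * D * e + 3 * D * D by move: h1 h3 h4; lr.
rewrite leNgt; apply/negP => h6.
have : (e - D) * (6 * D) < 3 * D * e + 3 * D * D.
  by apply: lt_le_trans h5; rewrite ltr_pM2l //; move: eD D0; lr.
have : D * (3 * D) <= D * e by rewrite ler_wpM2l ?(ltW D0).
by lr.
Qed.

(* From a point almost closest to the segment, at distance about e, the projection moves
   by at most D along each step of length e. *)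
Lemma near_point x y : 12 * D < `|c x - c y| ->
  exists2 m, between x m y & d m < 3 * D.
Proof.
move=> big; apply: contrapT => no.
have far p : between x p y -> 3 * D <= d p.
  by move=> bp; rewrite leNgt; apply/negP => h; apply: no; exists p.
pose E := [set d p | p in [set p | between x p y]].
have bx : between x x y by rewrite /between mdistxx add0r.
have hE : has_inf E.
  split; first by exists (d x), x.
  by exists (3 * D) => _ [p bp <-]; exact: far.
have D3 : 0 < 3 * D by rewrite mulr_gt0.
have [_ [m bm <-] hm] := inf_adherent D3 hE.
have ge p : between x p y -> inf E <= d p.
  by move=> bp; apply: ge_inf; [exact: hE.2|exists p].
have e3 : 3 * D <= inf E.
  by apply: lb_le_inf; [exact: hE.1|move=> _ [p bp <-]; exact: far].
have sym u v w : between u v w -> between w v u.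
  by rewrite /between (metric_sym w v) (metric_sym v u) (metric_sym w u) addrC.
have h1 : `|c x - c m| <= 6 * D.
  apply: (cp_far e3 _ (ltW hm)) => p bp; apply: ge.
  by apply: (sym); apply: (between_trans (sym _ _ _ bm) (sym _ _ _ bp)).
have h2 : `|c y - c m| <= 6 * D.
  apply: (cp_far e3 _ (ltW hm)) => p bp; apply: ge.
  exact: (between_trans bm (sym _ _ _ bp)).
have := dist_tri3 (c x) (c m) (c y); rewrite (distrC (c m)).
by move: h1 h2 big; lr.
Qed.

(** The geodesic passes a point within [3 * D] of the segment, and [dist_q_ge] applies to both
    halves. *)
Lemma dist_ge_far x y : 12 * D < `|c x - c y| ->
  d x + `|c x - c y| + d y - 10 * D <= mdist x y.
Proof.
move=> /near_point[m <- dm].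
have pt u : d u + `|c u - c m| - 5 * D <= mdist u m.
  have := dist_q_ge u (cp_in m); have := dist_tri u m (q (c m)); rewrite -/(d m).
  by move: dm; lr.
have := pt x; have := pt y; rewrite (metric_sym m y) (distrC (c y)).
by have := dist_tri3 (c x) (c m) (c y); lr.
Qed.

(** Either [m] lies in the contraction ball of [u] or of [v], or the lower bounds [dist_ge] on both
    halves are compared with the upper bound [dist_le_cp] on the whole. *)
Lemma cp_quasiconvex u m v : between u m v ->
  `|c u - c m| + `|c m - c v| <= `|c u - c v| + 8 * D.
Proof.
rewrite /between => E; have tr w : `|c w - c m| <= D -> forall w',
    `|c w' - c m| <= `|c w' - c w| + D.
  by move=> h w'; have := dist_tri3 (c w') (c w) (c m); move: h; lr.
have [h1|h1] := leP (d u) (mdist u m); last first.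
  have h : `|c u - c m| <= D.
    by apply: cp_contr; exact: ltW.
  have := tr u h v; rewrite (distrC (c v) (c m)) (distrC (c v) (c u)).
  by move: h D0; lr.
have [h2|h2] := leP (d v) (mdist v m); last first.
  have h : `|c v - c m| <= D.
    by apply: cp_contr; exact: ltW.
  have := tr v h u; rewrite (distrC (c m) (c v)).
  by move: h D0; lr.
have := dist_ge h1; have := dist_ge h2; have := dist_le_cp u v.
by rewrite (distrC (c v)) (metric_sym v) -E; lr.
Qed.

(** Some point of [g] projects to within [D] after [s]. The lower bounds of [dist_ge_far] before and
    after it add up to the length of [g], up to [20 * D], so its distance to the segment, counted
    twice, is at most [20 * D]. *)
Lemma near_passing g l s : 0 <= l -> geod 0 l g ->
  c (g 0) + 14 * D <= s <= c (g l) - 14 * D ->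
  exists2 t, 0 <= t <= l & mdist (g t) (q s) <= 11 * D.
Proof.
move=> l0 gg /andP[s1 s2]; set x := g 0 in s1; set y := g l in s2.
have gt t : 0 <= t <= l -> mdist x (g t) = t /\ mdist (g t) y = l - t.
  move=> /andP[t0 tl]; split.
    by rewrite gg ?lexx ?l0 ?t0 // sub0r normrN ger0_norm.
  by rewrite gg ?lexx ?l0 ?t0 // distrC ger0_norm // subr_ge0.
suff [t tl h] : exists2 t, 0 <= t <= l & s <= c (g t) <= s + D.
  have [e1 e2] := gt t tl; exists t => //.
  have sin : a <= s <= b.
    have /andP[a1 _] := cp_in x; have /andP[_ b1] := cp_in y.
    by move: a1 b1 s1 s2; lr.
  set m := g t in h e1 e2 *; have /andP[h1 h2] := h.
  have f1 : `|c x - c m| = c m - c x.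
    by rewrite distrC ger0_norm //; move: h1 s1; lr.
  have f2 : `|c m - c y| = c y - c m.
    by rewrite distrC ger0_norm //; move: h2 s2; lr.
  have := @dist_ge_far x m; rewrite f1 => /(_ ltac:(move: h1 s1; lr)).
  have := @dist_ge_far m y; rewrite f2 => /(_ ltac:(move: h2 s2; lr)).
  have := dist_le_cp x y.
  have -> : `|c x - c y| = c y - c x.
    by rewrite distrC ger0_norm //; move: s1 s2; lr.
  have := dist_tri m (q (c m)) (q s); rewrite dist_q ?cp_in // -/(d m).
  have : `|c m - s| <= D by rewrite ger0_norm; move: h1 h2; lr.
  have -> : mdist x y = l by rewrite -(gt l _).1 // l0 lexx.
  by rewrite e1 e2; lr.
(* With a mesh of [D / 4], both cases of [cp_lip] bound the jump of the projection by [D]: the first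
   mesh point beyond [s] is the one wanted. *)
pose dl := D / 4; have dl0 : 0 < dl by rewrite divr_gt0.
have ex : exists n : nat, `[< s <= c (g (Num.min (n%:R * dl) l)) >].
  exists (Num.bound (l / dl)); apply/asboolP; rewrite min_r.
    by move: s2; rewrite -/y; lr.
  by rewrite -ler_pdivrMr // ltW //; apply: archi_boundP; rewrite divr_ge0 // ltW.
case: (ex_minnP ex) => n /asboolP hn mn.
have n0 : (0 < n)%N.
  rewrite lt0n; apply/eqP => n0; move: hn; rewrite n0 mul0r min_l // -/x.
  by move: s1; lr.
have hp : c (g (Num.min (n.-1%:R * dl) l)) < s.
  rewrite ltNge; apply/negP => h; have := mn n.-1; rewrite (asboolT h) => /(_ isT).
  by move: n0; lia.
have mi k : 0 <= Num.min (k%:R * dl) l <= l.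
  by rewrite ge_min lexx orbT andbT le_min l0 andbT mulr_ge0 // ltW.
exists (Num.min (n%:R * dl) l); first exact: mi.
rewrite hn /=.
have step : mdist (g (Num.min (n%:R * dl) l)) (g (Num.min (n.-1%:R * dl) l)) <= dl.
  rewrite gg ?mi // -[n in n%:R](prednK n0) -natr1 mulrDl mul1r.
  move: (n.-1%:R * dl) => w; rewrite ler_norml /Num.min.
  by case: ltP => h3; case: ltP => h4; move: h3 h4 dl0; lr.
have [h|h] := cp_lip (g (Num.min (n%:R * dl) l)) (g (Num.min (n.-1%:R * dl) l)).
  by move: h; rewrite ler_norml => /andP[_]; move: hp; lr.
have : `|c (g (Num.min (n%:R * dl) l)) - c (g (Num.min (n.-1%:R * dl) l))| <= D.
  by apply: le_trans h _; move: step; rewrite /dl; lr.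
by rewrite ler_norml => /andP[_]; move: hp; lr.
Qed.

End Contracting.

(** * Subsegments of contracting geodesics *)

Section Subsegment.
Context {R : realType} {X : metricType R}.
Implicit Types (x y z : X) (q : R -> X) (a b D : R).

Definition clamp (a b t : R) : R := Num.max a (Num.min b t).

Lemma clamp_in a b t : a <= b -> a <= clamp a b t <= b.
Proof. by move=> ab; rewrite /clamp le_max lexx /= ge_max ab ge_min lexx. Qed.

Lemma clamp_id a b t : a <= t <= b -> clamp a b t = t.
Proof. by move=> /andP[h1 h2]; rewrite /clamp min_r // max_r. Qed.

Lemma clamp_lo a b t : a <= b -> t <= a -> clamp a b t = a.
Proof. by move=> ab ta; rewrite /clamp min_r ?max_l // (le_trans ta). Qed.

Lemma clamp_hi a b t : a <= b -> b <= t -> clamp a b t = b.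
Proof. by move=> ab bt; rewrite /clamp min_l // max_r. Qed.

Lemma clampP a b t : a <= b -> [\/ a <= t <= b /\ clamp a b t = t,
  t <= a /\ clamp a b t = a | b <= t /\ clamp a b t = b].
Proof.
move=> ab; have [ta|at_] := leP t a; first by constructor 2; rewrite clamp_lo.
have [bt|tb] := leP b t; first by constructor 3; rewrite clamp_hi.
by constructor 1; rewrite clamp_id // !ltW.
Qed.

Lemma clamp_near (a b c t e : R) : a <= b -> a <= t <= b ->
  `|c - t| <= `|c - clamp a b c| + e -> `|t - clamp a b c| <= e.
Proof.
move=> ab /andP[t1 t2]; have [[_ ->]|[h ->]|[h ->]] := clampP c ab.
- by rewrite subrr normr0 add0r distrC.
- by rewrite !(distrC c) (ger0_norm (x := t - c)) ?(ger0_norm (x := a - c)) ?(ger0_norm (x := t - a)); move: h t1 t2; clear; lra.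
- by rewrite (distrC t) (ger0_norm (x := c - t)) ?(ger0_norm (x := c - b)) ?(ger0_norm (x := b - t)); move: h t1 t2; clear; lra.
Qed.

Lemma geodW a b a' b' q : a <= a' -> b' <= b -> geod a b q -> geod a' b' q.
Proof.
move=> aa bb gq s t /andP[s1 s2] /andP[t1 t2]; apply: gq.
  by rewrite (le_trans aa s1) (le_trans s2 bb).
by rewrite (le_trans aa t1) (le_trans t2 bb).
Qed.

(** Up to [2 * D], the distance from [x] to a point of the segment grows like the distance from that
    point to the projection, by [dist_q_ge]. *)
Lemma nearest_clamp D q a b a' b' x t : geodesic_space X -> 0 < D -> cgeod D q a b ->
  a <= a' -> a' <= b' -> b' <= b -> nearest q a' b' x t ->
  `|t - clamp a' b' (cp q a b x)| <= 2 * D.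
Proof.
move=> geoX D0 CG aa ab' bb [tin H].
have cin := clamp_in (cp q a b x) ab'; set w := clamp _ _ _ in cin *.
have win : a <= w <= b by move: cin aa bb; clear; lra.
have tin' : a <= t <= b by move: tin aa bb; clear; lra.
have h1 := dist_q_ge geoX D0 CG x tin'.
have h2 := H w cin; have h3 : mdist x (q w) <= dq q a b x + `|cp q a b x - w|.
  by rewrite -(dist_q CG) ?(cp_in CG) //; exact: dist_tri.
have : `|cp q a b x - t| <= `|cp q a b x - w| + 2 * D by move: h1 h2 h3; clear; lra.
exact: clamp_near.
Qed.

Lemma clamp_homo a b s t : a <= b -> s <= t -> clamp a b s <= clamp a b t.
Proof. by move=> ab st; rewrite /clamp le_max2 // le_min2. Qed.

Lemma clamp_incr a b s t : a <= b -> s <= t -> clamp a b t - clamp a b s <= t - s.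
Proof.
move=> ab st; have /andP[h1 h2] := clamp_in s ab; have /andP[h3 h4] := clamp_in t ab.
have [[/andP[? ?] E1]|[? E1]|[? E1]] := clampP s ab;
  have [[/andP[? ?] E2]|[? E2]|[? E2]] := clampP t ab; lra.
Qed.

Lemma clamp_lip a b s t : a <= b -> `|clamp a b s - clamp a b t| <= `|s - t|.
Proof.
move=> ab; wlog st : s t / s <= t => [H|].
  by have [/H //|/ltW/H] := leP s t; rewrite distrC (distrC t).
rewrite (distrC (clamp a b s)) (distrC s) !ger0_norm ?subr_ge0 ?clamp_homo //.
exact: clamp_incr.
Qed.

Lemma clamp_close (a b s t e : R) : a <= b -> 0 <= e ->
  `|s - t| <= `|s - clamp a b s| + e -> `|clamp a b s - clamp a b t| <= e.
Proof.
move=> ab e0; have /andP[h1 h2] := clamp_in t ab.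
have l1 := ler_norm (s - t); have l2 := ler_norm (t - s); rewrite (distrC t) in l2.
have [[ins E]|[h E]|[h E]] := clampP s ab; rewrite E.
- by rewrite subrr normr0 add0r -{2}E => hs; apply: le_trans hs; exact: clamp_lip.
- rewrite (distrC s a) (distrC a (clamp a b t)) (ger0_norm (x := a - s)) ?subr_ge0 // (ger0_norm (x := clamp a b t - a)) ?subr_ge0 // => h3.
  by have [[/andP[? ?] ->]|[? ->]|[? ->]] := clampP t ab; move: h3 l1 l2 e0; lra.
- rewrite (ger0_norm (x := s - b)) ?subr_ge0 // (ger0_norm (x := b - clamp a b t)) ?subr_ge0 // => h3.
  by have [[/andP[? ?] ->]|[? ->]|[? ->]] := clampP t ab; move: h3 l1 l2 e0; lra.
Qed.

Lemma cgeod_sub D q a b a' b' : geodesic_space X -> 0 < D -> cgeod D q a b ->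
  a <= a' -> a' <= b' -> b' <= b -> cgeod (8 * D) q a' b'.
Proof.
move=> geoX D0 CG aa ab' bb; split => //.
  by case: CG => _ gq _; exact: geodW gq.
move=> x y s t ns nt xy.
have h1 := nearest_clamp geoX D0 CG aa ab' bb ns.
have h2 := nearest_clamp geoX D0 CG aa ab' bb nt.
set c := cp q a b in h1 h2.
suff h : `|clamp a' b' (c x) - clamp a' b' (c y)| <= 4 * D.
  have := dist_tri3 s (clamp a' b' (c x)) t; have := dist_tri3 (clamp a' b' (c x)) (clamp a' b' (c y)) t.
  by rewrite (distrC (clamp a' b' (c y)) t); move: h1 h2 h; clear; lra.
have [le|lt] := leP (mdist x y) (dq q a b x).
  apply: le_trans (clamp_lip _ _ ab') _; have := cp_contr CG le; rewrite -/c; move: D0; clear; lra.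
have h3 := dist_ge geoX D0 CG (ltW lt).
have cin := clamp_in (c x) ab'.
have win : a <= clamp a' b' (c x) <= b by move: cin aa bb; clear; lra.
have h4 := ns.2 _ cin.
have h5 := dist_tri x (q (c x)) (q (clamp a' b' (c x))).
rewrite (dist_q CG) ?(cp_in CG) // -/(dq q a b x) in h5.
have h6 : `|c x - c y| <= `|c x - clamp a' b' (c x)| + 4 * D by move: h3 h4 h5 xy; clear; lra.
by apply: clamp_close => //; move: D0; clear; lra.
Qed.

(** Two nearest points of one [x] are within [4 * D] by [nearest_clamp], and [cgeod_sub] gives
    [8 * D] for two points. *)
Lemma contracting_sub D q a b a' b' : geodesic_space X -> 0 < D ->
  a <= a' -> a' <= b' -> b' <= b -> geod a b q -> contracting D (q @` `[a, b]) ->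
  contracting (10 * D) (q @` `[a', b']).
Proof.
move=> geoX D0 aa ab' bb gq C.
have ab : a <= b by move: aa ab' bb; clear; lra.
have CG := contracting_cgeod ab gq C.
apply: cgeod_contracting.
  move=> x s t ns nt; have h1 := nearest_clamp geoX D0 CG aa ab' bb ns.
  have h2 := nearest_clamp geoX D0 CG aa ab' bb nt.
  have := dist_tri3 s (clamp a' b' (cp q a b x)) t; rewrite (distrC (clamp _ _ _) t).
  by move: h1 h2 D0; clear; lra.
have [h1 h2 h3] := cgeod_sub geoX D0 CG aa ab' bb; split => // x y s t ns nt xy.
by apply: le_trans (h3 _ _ _ _ ns nt xy) _; move: D0; clear; lra.
Qed.
End Subsegment.

(** * Non-amenability: expansion and exponential decay *)

Section FiniteSums.
Context {R : realType} {G : groupType}.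
Implicit Types (f g : G -> R).

Definition fin_supp f : Prop := exists A : {fset G}, forall x, x \notin A -> f x = 0.
Definition gsum f : R := \sum_(x \in setT) f x.

Lemma gsumE (A : {fset G}) f : (forall x, x \notin A -> f x = 0) ->
  gsum f = \sum_(x <- A) f x.
Proof. exact: fsbigTE. Qed.

Lemma fin_supp2 f g : fin_supp f -> fin_supp g -> exists A : {fset G},
  (forall x, x \notin A -> f x = 0) /\ (forall x, x \notin A -> g x = 0).
Proof.
move=> [A fA] [B gB]; exists (A `|` B)%fset; split => x; rewrite inE negb_or => /andP[h1 h2].
  exact: fA.
exact: gB.
Qed.

Lemma eq_gsum f g : f =1 g -> gsum f = gsum g.
Proof. by move=> /funext ->. Qed.

Lemma gsumD f g : fin_supp f -> fin_supp g ->
  gsum (fun x => f x + g x) = gsum f + gsum g.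
Proof.
move=> ff fg; have [A [fA gA]] := fin_supp2 ff fg.
by rewrite !(@gsumE A) ?big_split // => x xA; rewrite fA // gA // addr0.
Qed.

Lemma gsumZ c f : gsum (fun x => c * f x) = c * gsum f.
Proof. by rewrite /gsum mulr_fsumr. Qed.

Lemma gsum_ge0 f : (forall x, 0 <= f x) -> 0 <= gsum f.
Proof. by move=> f0; apply: fsumr_ge0 => x _. Qed.

Lemma gsum_le f g : fin_supp f -> fin_supp g -> (forall x, f x <= g x) -> gsum f <= gsum g.
Proof.
move=> ff fg fg'; have [A [fA gA]] := fin_supp2 ff fg.
by rewrite !(@gsumE A) //; apply: ler_sum.
Qed.

Lemma gsum_shift f s : gsum (fun x => f (x * s)%g) = gsum f.
Proof.
have bij : bijective (fun x : G => x * s)%g.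
  by exists (fun x => x * s^-1)%g => x; rewrite ?mulgK ?mulgVK.
by rewrite /gsum (reindex_fsbigT _ f bij).
Qed.

Lemma fin_supp_shift f s : fin_supp f -> fin_supp (fun x => f (x * s)%g).
Proof.
move=> [A fA]; exists [fset (x * s^-1)%g | x in A]%fset => x xA; apply: fA.
by apply: contra xA => h; apply/imfsetP; exists (x * s)%g => //=; rewrite mulgK.
Qed.

Lemma fin_supp_op (h : R -> R -> R) f g : h 0 0 = 0 -> fin_supp f -> fin_supp g ->
  fin_supp (fun x => h (f x) (g x)).
Proof.
move=> h0 ff fg; have [A [fA gA]] := fin_supp2 ff fg.
by exists A => x xA; rewrite fA // gA.
Qed.

Lemma fin_supp_map (h : R -> R) f : h 0 = 0 -> fin_supp f -> fin_supp (fun x => h (f x)).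
Proof. by move=> h0 [A fA]; exists A => x xA; rewrite fA. Qed.

Lemma fin_supp_mul f (g : G -> R) : fin_supp f -> fin_supp (fun x => f x * g x).
Proof. by move=> [A fA]; exists A => x xA; rewrite fA // mul0r. Qed.

Lemma fin_supp_sum (I : Type) (r : seq I) (F : I -> G -> R) : (forall i, fin_supp (F i)) ->
  fin_supp (fun x => \sum_(i <- r) F i x).
Proof.
move=> hF; elim: r => [|i r IH]; first by exists fset0 => x _; rewrite big_nil.
have [A hA] := fin_supp_op (h := +%R) (addr0 0) (hF i) IH.
by exists A => x xA; rewrite big_cons hA.
Qed.

Lemma gsum_sum (I : Type) (r : seq I) (F : I -> G -> R) : (forall i, fin_supp (F i)) ->
  gsum (fun x => \sum_(i <- r) F i x) = \sum_(i <- r) gsum (F i).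
Proof.
move=> hF; elim: r => [|i r IH].
  rewrite big_nil (@gsumE fset0) ?big_seq_fset0 //; last by move=> x _; rewrite big_nil.
rewrite big_cons -IH -gsumD //; last exact: fin_supp_sum.
by apply: eq_gsum => x; rewrite big_cons.
Qed.

Lemma gsum_ge_term f x : fin_supp f -> (forall y, 0 <= f y) -> f x <= gsum f.
Proof.
move=> [A fA] f0; have [xA|xA] := boolP (x \in A).
  rewrite (gsumE fA) (big_fsetD1 x) //= lerDl; apply: sumr_ge0 => y _; exact: f0.
by rewrite fA //; exact: gsum_ge0.
Qed.

Lemma gsum_norm f : fin_supp f -> `|gsum f| <= gsum (fun x => `|f x|).
Proof.
move=> [A fA]; rewrite !(@gsumE A) ?ler_norm_sum // => x xA.
by rewrite fA // normr0.
Qed.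

Lemma gsumB f g : fin_supp f -> fin_supp g ->
  gsum (fun x => f x - g x) = gsum f - gsum g.
Proof.
move=> ff fg; rewrite -mulN1r -gsumZ -gsumD //; last first.
  by apply: (fin_supp_map (h := fun y => -1 * y)); rewrite ?mulr0.
by apply: eq_gsum => x; rewrite mulN1r.
Qed.

(* Reiter's condition for right translations; inverting the variable turns the limit of
   the almost invariant weights into a left-invariant mean. *)
Lemma reiter_amenable (T : seq G) : generates [set` T] ->
  (forall e : R, 0 < e -> exists f, [/\ fin_supp f, (forall x, 0 <= f x), gsum f = 1 &
     forall s, s \in T -> gsum (fun x => `|f x - f (x * s)%g|) <= e]) ->
  amenable R G.
Proof.
move=> gT H.
have [F HF] : {F : nat -> G -> R | forall n, [/\ fin_supp (F n), (forall x, 0 <= F n x),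
    gsum (F n) = 1 & forall s, s \in T ->
      gsum (fun x => `|F n x - F n (x * s)%g|) <= n.+1%:R^-1]}.
  have ch n : {f | [/\ fin_supp f, (forall x, 0 <= f x), gsum f = 1 &
     forall s, s \in T -> gsum (fun x => `|f x - f (x * s)%g|) <= n.+1%:R^-1]}.
    by apply: cid; apply: H; rewrite invr_gt0.
  by exists (fun n => sval (ch n)) => n; exact: svalP (ch n).
(* An ultrafilter finer than the tails: every sequence in [[0, 1]] converges along it by
   compactness. *)
have [U [UU ooU]] := ultraFilterLemma (eventually_filter).
pose w (A : set G) x : R := (x^-1%g \in A)%:R.
pose m n A := gsum (fun x => F n x * w A x).
have w01 A x : 0 <= w A x <= 1 by rewrite ler0n lern1 leq_b1.
have ff n : fin_supp (F n) by have [] := HF n.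
have F0 n x : 0 <= F n x by have [] := HF n.
have m0 n A : 0 <= m n A.
  by apply: gsum_ge0 => x; rewrite mulr_ge0 //; have /andP[] := w01 A x.
have mT n : m n setT = 1.
  have [_ _ <- _] := HF n; apply: eq_gsum => x.
  by rewrite /w in_setT mulr1.
have m1 n A : m n A <= 1.
  have [_ _ <- _] := HF n; apply: gsum_le => //; first exact: fin_supp_mul.
  by move=> x; rewrite ler_piMr //; have /andP[] := w01 A x.
have mU n A B : A `&` B = set0 -> m n (A `|` B) = m n A + m n B.
  move=> AB; rewrite /m -gsumD; try exact: fin_supp_mul.
  apply: eq_gsum => x; rewrite -mulrDr; congr (_ * _); rewrite /w in_setU.
  have : ~ (A `&` B) x^-1%g by rewrite AB.
  case: (boolP (x^-1%g \in A)) => hA; case: (boolP (x^-1%g \in B)) => hB h /=; rewrite ?addr0 ?add0r //.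
  by case: h; split; apply: set_mem.
have cv A : cvg (m n A @[n --> U]).
  have [p [p01 cp]] : `[0, 1]%classic `&` cluster (m n A @[n --> U]) !=set0.
    have hU : U [set n | `[0, 1]%classic (m n A)].
      by apply: filterE => n /=; rewrite in_itv /=; apply/andP; split; [exact: m0|exact: m1].
    by apply: segment_compact; exact: hU.
  apply: (cvgP p) => V Vp; rewrite /nbhs /=.
  have [//|UV] := in_ultra_setVsetC ((fun n => m n A) @^-1` V) UU.
  by have [y []] := cp (~` V) V UV Vp.
have inv s A : s \in T -> forall n, `|m n [set (s^-1 * a)%g | a in A] - m n A| <= n.+1%:R^-1.
  move=> sT n; have [_ _ _ h] := HF n; apply: le_trans (h s sT).
  have fm : fin_supp (fun x => F n (x * s)%g * w A x).
    by apply: fin_supp_mul; exact: fin_supp_shift.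
  have -> : m n [set (s^-1 * a)%g | a in A] = gsum (fun x => F n (x * s)%g * w A x).
    rewrite /m -(gsum_shift _ s); apply: eq_gsum => x /=.
    congr (_ * _); rewrite /w; congr ((nat_of_bool _)%:R); apply/idP/idP => /set_mem.
      by move=> [a Aa]; rewrite invgM => /mulgI <-; exact: mem_set.
    by move=> h'; apply: mem_set; exists x^-1%g => //; rewrite invgM.
  rewrite /m -gsumB //; last exact: fin_supp_mul.
  have fB : fin_supp (fun x => F n (x * s)%g * w A x - F n x * w A x).
    apply: (fin_supp_op (h := fun a b => a - b)) => //; first by rewrite subr0.
    exact: fin_supp_mul.
  apply: le_trans (gsum_norm fB) _; apply: gsum_le.
  - exact: (fin_supp_map (h := fun y => `|y|)) (normr0 _) fB.
  - apply: (fin_supp_op (h := fun a b => `|a - b|)) => //; first by rewrite subr0 normr0.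
    exact: fin_supp_shift.
  move=> x; rewrite -mulrBl normrM distrC ler_piMr // ger0_norm; by have /andP[] := w01 A x.
pose M A := lim (m n A @[n --> U]).
have MP A : m n A @[n --> U] --> M A by exact: cv.
have invM s A : s \in T -> M [set (s^-1 * a)%g | a in A] = M A.
  move=> sT; apply/eqP; rewrite -subr_eq0; apply/eqP.
  have c1 : (m n [set (s^-1 * a)%g | a in A] - m n A) @[n --> U] -->
      (M [set (s^-1 * a)%g | a in A] - M A) by apply: cvgB; exact: MP.
  have c2 : (m n [set (s^-1 * a)%g | a in A] - m n A) @[n --> \oo] --> (0 : R).
    apply/cvgrPdist_le => e e0; near=> n; rewrite sub0r normrN.
    apply: le_trans (inv s A sT n) _.
    rewrite invf_ple ?posrE // -natr1; apply: le_trans (_ : n%:R <= _); last by rewrite lerDl.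
    near: n; exact: nbhs_infty_ger.
  have c3 : (m n [set (s^-1 * a)%g | a in A] - m n A) @[n --> U] --> (0 : R).
    by move=> V V0; apply: ooU; exact: c2.
  exact: (cvg_unique (@Rhausdorff R) c1 c3).
exists M; split.
- move=> A; apply: (cvgr_to_ge (MP A)); apply: filterE => n; exact: m0.
- have c1 := MP setT; have c2 : m n setT @[n --> U] --> (1 : R).
    by under eq_fun do rewrite mT; exact: cvg_cst.
  exact: (cvg_unique (@Rhausdorff R) c1 c2).
- move=> A B AB; have c1 := MP (A `|` B).
  have c2 : m n (A `|` B) @[n --> U] --> M A + M B.
    by under eq_fun do rewrite mU //; apply: cvgD; exact: MP.
  exact: (cvg_unique (@Rhausdorff R) c1 c2).
move=> g.
pose K : set G := [set g | forall A, M [set (g * a)%g | a in A] = M A].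
have imV (h : G) (A : set G) : [set (h * a)%g | a in [set (h^-1 * a)%g | a in A]] = A.
  apply/seteqP; split => [_ [_ [a Aa <-] <-]|a Aa]; first by rewrite mulVKg.
  by exists (h^-1 * a)%g; [exists a|rewrite mulVKg].
have sK : is_subgroup K.
  split => [A|h k Hh Hk A].
    congr M; apply/seteqP; split => [_ [a Aa <-]|a Aa]; first by rewrite mul1g.
    by exists a => //; rewrite mul1g.
  have -> : [set (h * k^-1 * a)%g | a in A] = [set (h * a)%g | a in [set (k^-1 * a)%g | a in A]].
    apply/seteqP; split => [_ [a Aa <-]|_ [_ [a Aa <-] <-]]; last by exists a => //; rewrite mulgA.
    by exists (k^-1 * a)%g; [exists a|rewrite /= mulgA].
  by rewrite Hh -(Hk [set (k^-1 * a)%g | a in A]) imV.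
suff Kg : K g by exact: Kg.
move: gT => /seteqP[_ /(_ g I)]; apply; split => // s sT A.
by rewrite -[LHS](invM s _ sT) -[in RHS](imV s^-1%g A) invgK.
Unshelve. all: by end_near.
Qed.
End FiniteSums.

Section Nonamenable.
Context {R : realType} {G : groupType}.
Implicit Types (f g : G -> R).

(** The negation of Reiter's condition, made homogeneous by dividing [f] by its sum. *)
Lemma nonamenable_gap (T : seq G) : ~ amenable R G -> generates [set` T] ->
  exists2 e : R, 0 < e & forall f, fin_supp f -> (forall x, 0 <= f x) ->
    exists2 s, s \in T & e * gsum f <= gsum (fun x => `|f x - f (x * s)%g|).
Proof.
move=> na gT.
have [e e0 He] : exists2 e : R, 0 < e & forall f, fin_supp f -> (forall x, 0 <= f x) ->
    gsum f = 1 -> exists2 s, s \in T & e <= gsum (fun x => `|f x - f (x * s)%g|).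
  apply: contrapT => no; apply: na; apply: (reiter_amenable gT) => e e0.
  apply: contrapT => no'; apply: no; exists e => // f ff f0 f1.
  apply: contrapT => no''; apply: no'; exists f; split => // s sT.
  by rewrite leNgt; apply/negP => h; apply: no''; exists s => //; exact: ltW.
exists e => // f ff f0; have [E|n0] := eqVneq (gsum f) 0.
  (* Only a member of [T] is wanted here; the indicator of the identity provides one. *)
  have [|||s sT _] := He (fun x => (x == 1%g)%:R).
  - by exists [fset 1%g]%fset => x; rewrite inE => /negPf ->.
  - by move=> x; rewrite ler0n.
  - rewrite (@gsumE _ _ [fset 1%g]%fset); first by rewrite big_seq_fset1 eqxx.
    by move=> x; rewrite inE => /negPf ->.
  by exists s => //; rewrite E mulr0; apply: gsum_ge0.
have fp : 0 < gsum f by rewrite lt_neqAle eq_sym n0 gsum_ge0.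
have [|||s sT h] := He (fun x => (gsum f)^-1 * f x).
- by apply: (fin_supp_map (h := fun y => (gsum f)^-1 * y)); rewrite ?mulr0.
- by move=> x; rewrite mulr_ge0 // invr_ge0 ltW.
- by rewrite gsumZ mulVf.
exists s => //; move: h.
rewrite (_ : (fun x => _) = (fun x => (gsum f)^-1 * `|f x - f (x * s)%g|)); last first.
  by apply/funext => x; rewrite -mulrBr normrM ger0_norm // invr_ge0 ltW.
by rewrite gsumZ ler_pdivlMl // mulrC.
Qed.

Fixpoint wball (T : seq G) (n : nat) : {fset G} :=
  if n is n'.+1 then (wball T n' `|` [fset (x * s)%g | x in wball T n', s in T])%fset
  else [fset 1%g]%fset.

Lemma gsum_indicator (A : {fset G}) : gsum (fun x => (x \in A)%:R) = #|` A|%:R :> R.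
Proof.
rewrite (@gsumE _ _ A); last by move=> x /negPf ->.
by rewrite big_seq (eq_bigr (fun=> 1)) -?big_seq ?sumr_const_seq ?big_const_seq //;
  [rewrite count_predT iter_addr addr0 cardfE|move=> x ->].
Qed.

(** The gap for the indicator of a ball makes the next ball larger by the factor [1 + e / 2]. This
    exponential growth is used through the square of Bernoulli's inequality, which is quadratic in
    the radius. *)
Lemma superlinear_growth (T : seq G) : ~ amenable R G -> generates [set` T] ->
  forall K : R, exists n, K * n.+1%:R < #|` wball T n|%:R.
Proof.
move=> na gT K; have [e e0 He] := nonamenable_gap na gT.
have fI n : fin_supp (fun x => (x \in wball T n)%:R : R).
  by exists (wball T n) => x /negPf ->.
have grow n : (1 + e / 2) * #|` wball T n|%:R <= #|` wball T n.+1|%:R.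
  have [|s sT] := He _ (fI n); first by move=> x; rewrite ler0n.
  rewrite gsum_indicator => h.
  pose u x : R := (x \in wball T n)%:R; pose v x : R := (x \in wball T n.+1)%:R.
  have uv x : u x <= v x by rewrite /u /v ler_nat inE; case: (x \in wball T n).
  (* The difference of two reals [a] and [b] has absolute value [2 (max - b) - (a - b)], and [v] at
     [x * s] bounds both indicators. After summation, the last bracket vanishes and the first one is
     the growth of the ball. *)
  have hx x : `|u x - u (x * s)%g| <= 2 * (v (x * s)%g - u (x * s)%g) - (u x - u (x * s)%g).
    have := uv (x * s)%g; rewrite /u /v; case: (boolP (x \in wball T n)) => hx.
      have -> : (x * s)%g \in wball T n.+1.
        by rewrite inE; apply/orP; right; apply/imfset2P; exists x => //; exists s.
      case: ((x * s)%g \in _) => _; rewrite /= ?subrr ?normr0 ?subr0 ?normr1; lra.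
    case: ((x * s)%g \in wball T n) => /= h'; rewrite ?subrr ?normr0 ?sub0r ?normrN ?normr1; lra.
  have fB (a b : G -> R) : fin_supp a -> fin_supp b -> fin_supp (fun x => a x - b x).
    by apply: (fin_supp_op (h := fun a b => a - b)); rewrite subr0.
  have fus : fin_supp (fun x => u (x * s)%g) := fin_supp_shift s (fI n).
  have fvs : fin_supp (fun x => v (x * s)%g) := fin_supp_shift s (fI n.+1).
  have f2 : fin_supp (fun x => 2 * (v (x * s)%g - u (x * s)%g)).
    exact: (fin_supp_map (h := fun y => 2 * y) (mulr0 _) (fB _ _ fvs fus)).
  have fuu : fin_supp (fun x => u x - u (x * s)%g) := fB _ _ (fI n) fus.
  have : gsum (fun x => `|u x - u (x * s)%g|) <=
     gsum (fun x => 2 * (v (x * s)%g - u (x * s)%g) - (u x - u (x * s)%g)).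
    apply: gsum_le => //; last exact: (fB _ _ f2 fuu).
    exact: (fin_supp_map (h := fun y => `|y|) (normr0 _) fuu).
  rewrite (gsumB f2 fuu) gsumZ (gsumB fvs fus) (gsumB (fI n) fus).
  rewrite (gsum_shift v s) (gsum_shift u s) /u /v !gsum_indicator subrr subr0.
  move: h; rewrite -/u; clear; lra.
pose h := e / 2; have h0 : 0 < h by rewrite divr_gt0.
have pow n : (1 + h) ^+ n <= #|` wball T n|%:R.
  elim: n => [|n IH]; first by rewrite expr0 /= cardfs1.
  apply: le_trans (grow n); rewrite exprS ler_wpM2l //; move: h0; clear; lra.
have bern m : 1 + m%:R * h <= (1 + h) ^+ m.
  elim: m => [|m IH]; first by rewrite mul0r addr0 expr0.
  rewrite exprS; apply: le_trans (_ : (1 + h) * (1 + m%:R * h) <= _).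
    rewrite -natr1; have : 0 <= m%:R * h * h by rewrite !mulr_ge0 // ltW.
    by clear; lra.
  by rewrite ler_wpM2l //; move: h0; clear; lra.
pose m := (Num.bound (3 * `|K| / h ^+ 2)).+1.
have hm : 3 * `|K| < m%:R * h ^+ 2.
  have hb : 3 * `|K| / h ^+ 2 < (Num.bound (3 * `|K| / h ^+ 2))%:R.
    by apply: archi_boundP; rewrite divr_ge0 ?mulr_ge0 ?sqr_ge0 // ltW.
  rewrite -ltr_pdivrMr ?exprn_gt0 //; apply: lt_trans hb _.
  by rewrite ltr_nat.
exists (m + m)%N; apply: lt_le_trans (pow _); rewrite exprD.
apply: lt_le_trans (_ : (1 + m%:R * h) * (1 + m%:R * h) <= _); last first.
  by apply: ler_pM; rewrite ?bern // addr_ge0 // mulr_ge0 // ltW.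
have m1 : 1 <= m%:R :> R by rewrite ler1n.
have Kn := ler_norm K; have K0 := normr_ge0 K.
have k1 : m%:R * (3 * `|K|) <= m%:R * (m%:R * h ^+ 2) by rewrite ler_wpM2l ?ler0n // ltW.
have k2 : `|K| * (1 - m%:R) <= 0 by rewrite mulr_ge0_le0 //; move: m1; clear; lra.
have k3 : K * (m + m).+1%:R <= `|K| * (m + m).+1%:R by rewrite ler_wpM2r.
apply: le_lt_trans k3 _; rewrite -natr1 natrD.
have k4 : 0 <= m%:R * h by rewrite mulr_ge0 // ltW.
move: k1 k2 k4; rewrite expr2; clear; lra.
Qed.
End Nonamenable.

Lemma fiber_bound (T : eqType) (A : seq T) (f : T -> nat) M N :
  (forall x, x \in A -> (f x < M)%N) ->
  (forall i, (size [seq x <- A | f x == i] <= N)%N) -> (size A <= M * N)%N.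
Proof.
elim: M A => [|M IH] A fM fN; first by case: A fM {fN} => // a A /(_ a (mem_head _ _)).
have := count_predC (fun x => f x == M) A; rewrite -!size_filter => <-.
rewrite mulSn leq_add //; apply: IH => [x|i].
  rewrite mem_filter /= => /andP[h xA]; have := fM x xA.
  by rewrite ltnS leq_eqVlt (negPf h).
apply: leq_trans (fN i); rewrite !size_filter count_filter.
by apply: sub_count => x /= /andP[].
Qed.

(** * Trees of translates of a contracting segment *)

Section Action.
Context {R : realType} {G : groupType} {X : metricType R}.
Variables (act : G -> X -> X) (o : X).
Hypothesis geoX : geodesic_space X.
Hypothesis propX : proper_space X.
Hypothesis gact : geometric_action act.
Implicit Types (x y z : X) (g h k : G) (q : R -> X) (D : R).

Lemma act1 x : act 1%g x = x. Proof. by case: gact => [[h _] _ _ _]. Qed.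
Lemma actM g h x : act (g * h)%g x = act g (act h x).
Proof. by case: gact => [[_ H] _ _ _]. Qed.
Lemma act_iso g x y : mdist (act g x) (act g y) = mdist x y.
Proof. by case: gact => [_ H _ _]. Qed.
Lemma actK g x : act g^-1%g (act g x) = x.
Proof. by rewrite -actM mulVg act1. Qed.
Lemma actVK g x : act g (act g^-1%g x) = x.
Proof. by rewrite -actM mulgV act1. Qed.
Lemma act_isoV g x y : mdist (act g x) y = mdist x (act g^-1%g y).
Proof. by rewrite -(act_iso g x) actVK. Qed.

Lemma dist_act g x y : mdist x (act g y) = mdist (act g^-1%g x) y.
Proof. by rewrite -(act_iso g^-1%g x) actK. Qed.

Lemma disp_finite x (r : R) : exists F : seq G, forall g, mdist (act g x) x <= r -> g \in F.
Proof.
have [_ _ pr _] := gact; have := pr _ (@propX x r).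
move=> /finite_seqP[F E]; exists F => g h.
suff : [set` F] g by [].
rewrite -E /=; exists (act g x); split => /=; last by rewrite metric_sym.
exists x => //=; rewrite mdistxx; apply: le_trans h; exact: mdist_ge0.
Qed.

Definition translate q h : R -> X := fun t => act h (q t).

Lemma nearest_translate q h a b x t : nearest (translate q h) a b x t <-> nearest q a b (act h^-1%g x) t.
Proof.
rewrite /nearest /translate; split=> -[h1 h2]; split=> // s hs; have := h2 s hs.
  by rewrite !dist_act.
by rewrite -!dist_act.
Qed.

Lemma cp_translate q h a b x : cp (translate q h) a b x = cp q a b (act h^-1%g x).
Proof.
rewrite /cp; congr (xget _ _); apply/seteqP; split => t /=; by rewrite nearest_translate.
Qed.

Lemma cp_translateM q g h a b x : cp (translate q (g * h)%g) a b (act g x) = cp (translate q h) a b x.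
Proof. by rewrite !cp_translate invgM actM actK. Qed.

Lemma cgeod_translate D q a b h : cgeod D q a b -> cgeod D (translate q h) a b.
Proof.
move=> [ab gq C]; split => //; first by move=> s t hs ht; rewrite act_iso gq.
move=> x y s t /nearest_translate ns /nearest_translate nt xy; apply: C ns nt _.
by rewrite act_iso -dist_act.
Qed.

Variables (eps : R).
Hypothesis dense : nbhd_set eps [set act g o | g in setT] = setT.

Ltac lrc := clear -geoX propX gact dense; lra.

Lemma near_orbit x : exists g, mdist x (act g o) <= eps.
Proof.
have : nbhd_set eps [set act g o | g in setT] x by rewrite dense.
by move=> [_ [g _ <-] h]; exists g.
Qed.

Lemma eps_ge0 : 0 <= eps.
Proof. by have [g h] := near_orbit o; apply: le_trans h; exact: mdist_ge0. Qed.

Lemma disp_uniform (r : R) : exists F : seq G, forall x, exists g, forall h,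
  mdist (act h x) x <= r -> (g^-1 * h * g)%g \in F.
Proof.
have [F HF] := disp_finite o (r + 2 * eps); exists F => x; have [g xg] := near_orbit x.
exists g => h hx; apply: HF; rewrite !actM act_isoV invgK.
have := dist_tri (act h (act g o)) (act h x) (act g o); have := dist_tri (act h x) x (act g o).
by rewrite act_iso (metric_sym (act g o) x); move: hx xg; lrc.
Qed.

(** Cut the window of parameters into unit cells. Relative to one element of a cell, any other one
    moves a point [x] by at most [r], so after conjugation it lies in a finite set; by cocompactness
    this set does not depend on [x]. *)
Lemma cells_bound (r : R) : exists N : nat, forall (w v : R) (A : seq G) (t : G -> R), uniq A ->
  0 <= w -> (forall k, k \in A -> `|t k - v| <= w) ->
  (forall k, k \in A -> exists x, forall k', k' \in A -> `|t k - t k'| <= 1 ->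
     mdist (act k x) (act k' x) <= r) ->
  (size A)%:R <= (2 * w + 1) * N%:R :> R.
Proof.
have [F HF] := disp_uniform r; exists (size F) => w v A t uA w0 tw close.
have pos k : k \in A -> 0 <= t k - v + w <= 2 * w.
  by move=> /tw; rewrite ler_norml; lrc.
have fl k : k \in A -> (Num.truncn (t k - v + w))%:R <= t k - v + w < (Num.truncn (t k - v + w)).+1%:R.
  by move=> kA; apply: truncn_itv; have /andP[] := pos k kA.
have w20 : 0 <= 2 * w by rewrite mulr_ge0.
have szA : (size A <= (Num.truncn (2 * w)).+1 * size F)%N.
  apply: (@fiber_bound _ _ (fun k => Num.truncn (t k - v + w))) => [k kA|i].
    have /andP[h1 _] := fl k kA; have /andP[_ h2] := pos k kA; have /andP[_ h3] := truncn_itv w20.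
    by rewrite -(ltr_nat R); apply: le_lt_trans h1 _; apply: le_lt_trans h2 h3.
  case E : [seq _ <- A | _] => [//|k0 A'].
  have : k0 \in [seq k <- A | Num.truncn (t k - v + w) == i] by rewrite E mem_head.
  rewrite mem_filter => /andP[/eqP i0 k0A]; have [x Hx] := close k0 k0A.
  have [g Hg] := HF x; rewrite -E -(size_map (fun f => k0 * (g * f * g^-1))%g F).
  apply: uniq_leq_size; first exact: filter_uniq.
  move=> k; rewrite mem_filter => /andP[/eqP ik kA].
  apply/mapP; exists (g^-1 * (k0^-1 * k) * g)%g.
    apply: Hg; rewrite actM act_isoV invgK metric_sym; apply: Hx => //.
    have := fl k kA; have := fl k0 k0A; rewrite ik i0 -natr1 ler_norml; lrc.
  by rewrite !mulgA !mulgK mulgV mul1g.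
apply: le_trans (_ : ((Num.truncn (2 * w)).+1 * size F)%:R <= _); first by rewrite ler_nat.
rewrite natrM ler_wpM2r // -natr1 lerD2r.
by have /andP[] := truncn_itv w20.
Qed.
End Action.

(** * Diverging legs at the base point *)

Section Ports.
Context {R : realType} {G : groupType} {X : metricType R}.
Variables (act : G -> X -> X) (o : X).
Hypothesis geoX : geodesic_space X.
Hypothesis propX : proper_space X.
Hypothesis gact : geometric_action act.
Variables (eps : R).
Hypothesis dense : nbhd_set eps [set act g o | g in setT] = setT.
Implicit Types (x y z : X) (g h k : G) (q : R -> X).
Notation leg := (translate act).

Ltac lrc := clear -geoX propX gact dense; lra.

Lemma wball_disp (T : seq G) (lam : R) : 0 <= lam ->
  (forall s, s \in T -> mdist (act s o) o <= lam) ->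
  forall n g, g \in wball T n -> mdist (act g o) o <= n%:R * lam.
Proof.
move=> lam0 Hl; elim=> [|n IH] g /=.
  by rewrite inE => /eqP->; rewrite (act1 gact) mdistxx mul0r.
rewrite inE -natr1 mulrDl mul1r => /orP[/IH h|/imfset2P[h hW [s sT ->]]].
  by apply: le_trans h _; rewrite lerDl.
rewrite (actM gact); apply: le_trans (dist_tri _ (act h o) _) _.
by rewrite (act_iso gact) addrC lerD ?IH // Hl.
Qed.

Lemma seq_bound (I : eqType) (T : seq I) (f : I -> R) : exists2 lam, 0 <= lam & forall s, s \in T -> f s <= lam.
Proof.
elim: T => [|s T [lam l0 IH]]; first by exists 0.
exists (Num.max lam (f s)); first by rewrite le_max l0.
by move=> t; rewrite inE le_max => /orP[/eqP->|/IH ->]; rewrite ?lexx ?orbT.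
Qed.

Definition meets D q (l v : R) k0 k : Prop :=
  exists2 t, 0 <= t <= l & mdist (leg q k t) (leg q k0 v) <= 11 * D.

(** All the legs start within [tau + eps] of [o], so two legs that meet at parameter [v] of one do
    so at nearly the same parameter of the other. The window is linear in [tau], hence so is the
    number of legs; the final factor [2] is for the two directions of [meets]. *)
Lemma meets_count D : 0 < D -> exists N : nat, forall q l v tau (W : seq G) k0,
  geod 0 l q -> mdist (q 0) o <= eps -> 0 <= tau -> 0 <= v <= l -> uniq W ->
  mdist (act k0 o) o <= tau -> (forall k, k \in W -> mdist (act k o) o <= tau) ->
  (forall k, k \in W -> meets D q l v k0 k \/ meets D q l v k k0) ->
  (size W)%:R <= 2 * ((2 * (11 * D + 2 * tau + 2 * eps) + 1) * N%:R).
Proof.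
move=> D0; have [N HN] := cells_bound propX gact dense (22 * D + 1).
exists N => q l v tau W k0 gq q0 tau0 vl uW k0t Wt Wm.
have l0 : 0 <= l by move: vl => /andP[]; exact: le_trans.
have e0 := eps_ge0 dense.
set w := 11 * D + 2 * tau + 2 * eps.
have w0 : 0 <= w by rewrite /w; move: D0 tau0 e0; lrc.
have start k : mdist (act k o) o <= tau -> mdist (leg q k 0) o <= tau + eps.
  move=> h; have := dist_tri (leg q k 0) (act k o) o; rewrite (act_iso gact).
  by move: h q0; lrc.
have win k t k' : mdist (act k o) o <= tau -> mdist (act k' o) o <= tau -> 0 <= t <= l ->
    mdist (leg q k t) (leg q k' v) <= 11 * D -> `|t - v| <= w.
  move=> hk hk' tl h; have s1 := start k hk; have s2 := start k' hk'.
  have e1 : mdist (leg q k t) (leg q k 0) = t.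
    by rewrite (act_iso gact) gq ?lexx ?l0 // subr0 ger0_norm //; case/andP: tl.
  have e2 : mdist (leg q k' v) (leg q k' 0) = v.
    by rewrite (act_iso gact) gq ?lexx ?l0 // subr0 ger0_norm //; case/andP: vl.
  have t1 := dist_tri (leg q k t) (leg q k' v) (leg q k 0).
  have t2 := dist_tri (leg q k' v) (leg q k' 0) (leg q k 0).
  have t3 := dist_tri (leg q k' v) (leg q k t) (leg q k' 0).
  have t4 := dist_tri (leg q k t) (leg q k 0) (leg q k' 0).
  have t5 := dist_tri (leg q k 0) o (leg q k' 0).
  rewrite (metric_sym (leg q k' v) (leg q k t)) in t3.
  rewrite (metric_sym o) in t5; rewrite (metric_sym (leg q k' 0) (leg q k 0)) in t2.
  by rewrite ler_norml /w; apply/andP; move: h s1 s2 e1 e2 t1 t2 t3 t4 t5; clear -geoX propX gact dense; split; lra.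
pose W1 := [seq k <- W | `[< meets D q l v k0 k >]].
pose W2 := [seq k <- W | `[< meets D q l v k k0 >]].
have sz : (size W <= size W1 + size W2)%N.
  rewrite -size_cat; apply: uniq_leq_size => // k kW; rewrite mem_cat !mem_filter kW !andbT.
  by case: (Wm k kW) => h; apply/orP; [left|right]; exact/asboolP.
have b1 : (size W1)%:R <= (2 * w + 1) * N%:R.
  pose t k := xget 0 [set t | 0 <= t <= l /\ mdist (leg q k t) (leg q k0 v) <= 11 * D].
  have tP k : k \in W1 -> (0 <= t k <= l /\ mdist (leg q k (t k)) (leg q k0 v) <= 11 * D) /\ k \in W.
    rewrite mem_filter => /andP[/asboolP[u ul hu] kW]; split => //.
    by rewrite /t; case: xgetP => [t' -> //|/(_ u)]; case.
  apply: (HN w v W1 t) => //; first exact: filter_uniq.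
    by move=> k /tP[[h1 h2] kW]; apply: win h2 => //; exact: Wt.
  move=> k /tP[[h1 h2] kW]; exists (q (t k)) => k' /tP[[h1' h2'] kW'] tt.
  have := dist_tri (leg q k (t k)) (leg q k0 v) (leg q k' (t k)).
  have := dist_tri (leg q k0 v) (leg q k' (t k')) (leg q k' (t k)).
  rewrite [mdist (leg q k' _) _](act_iso gact) gq // distrC (metric_sym (leg q k0 v) (leg q k' (t k'))) /leg.
  by move: h2 h2' tt; lrc.
have b2 : (size W2)%:R <= (2 * w + 1) * N%:R.
  pose t k := xget 0 [set t | 0 <= t <= l /\ mdist (leg q k0 t) (leg q k v) <= 11 * D].
  have tP k : k \in W2 -> (0 <= t k <= l /\ mdist (leg q k0 (t k)) (leg q k v) <= 11 * D) /\ k \in W.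
    rewrite mem_filter => /andP[/asboolP[u ul hu] kW]; split => //.
    by rewrite /t; case: xgetP => [t' -> //|/(_ u)]; case.
  apply: (HN w v W2 t) => //; first exact: filter_uniq.
    by move=> k /tP[[h1 h2] kW]; apply: win h2 => //; exact: Wt.
  move=> k /tP[[h1 h2] kW]; exists (q v) => k' /tP[[h1' h2'] kW'] tt.
  have := dist_tri (leg q k v) (leg q k0 (t k)) (leg q k' v).
  have := dist_tri (leg q k0 (t k)) (leg q k0 (t k')) (leg q k' v).
  rewrite [mdist (leg q k0 _) (leg q k0 _)](act_iso gact) gq // (metric_sym (leg q k v) (leg q k0 (t k))) /leg.
  by move: h2 h2' tt; lrc.
have : (size W)%:R <= (size W1 + size W2)%:R :> R by rewrite ler_nat.
by rewrite natrD; move: b1 b2; lrc.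
Qed.

Lemma not_meets_proj D q l v k0 k B : 0 < D -> cgeod D q 0 l -> ~ meets D q l v k0 k ->
  mdist (leg q k 0) (leg q k0 0) <= B -> 2 * B + 14 * D <= v ->
  forall t, 0 <= t <= l -> cp (leg q k0) 0 l (leg q k t) <= v + 14 * D.
Proof.
move=> D0 CG nm h1 Bv t tl; rewrite leNgt; apply/negP => h2; apply: nm.
have CG0 := cgeod_translate gact k0 CG; have [_ gk _] := cgeod_translate gact k CG.
have [t0 tll] := andP tl; have l0 := le_trans t0 tll.
have gt : geod 0 t (leg q k) by apply: geodW gk.
have [|u ul hu] := near_passing geoX D0 CG0 t0 gt (s := v).
- apply/andP; split; last by move: h2; lrc.
  have := cp_dist_q CG0 (leg q k 0) (t := 0) ltac:(by rewrite lexx l0).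
  by rewrite subr0 => /(le_trans (ler_norm _)); move: h1 Bv; lrc.
exists u => //; have /andP[u0 ut] := ul.
by rewrite u0 (le_trans ut).
Qed.

Definition separated q (l B : R) k k' : Prop :=
  forall t, 0 <= t <= l -> cp (leg q k) 0 l (leg q k' t) <= B.

(** Each leg already chosen excludes a number of elements of the ball of radius [n] that is linear
    in [n]. By superlinear growth the ball outnumbers three such exclusions, so that four legs can
    be chosen. *)
Lemma ports (T : seq G) D : ~ amenable R G -> generates [set` T] -> 0 < D ->
  exists tau B : R, [/\ 0 <= tau, 0 <= B & forall q l, 0 <= l -> cgeod D q 0 l ->
    mdist (q 0) o <= eps -> exists k : letter -> G,
      (forall s, mdist (act (k s) o) o <= tau) /\
      (forall s s', s != s' -> separated q l B (k s) (k s'))].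
Proof.
move=> na gT D0; have [lam lam0 Hlam] := seq_bound T (fun s => mdist (act s o) o).
have [N HN] := meets_count D0; have e0 := eps_ge0 dense.
pose W0 := 11 * D + 2 * lam + 2 * eps.
have [n Hn] := superlinear_growth na gT (3 * (2 * ((2 * W0 + 1) * N%:R))).
(* [v] is [2 * B + 14 * D] as required by [not_meets_proj], where [B = 2 * tau + 2 * eps] bounds the
   distance between the starts of two legs. *)
pose tau := n%:R * lam; pose v := 4 * tau + 4 * eps + 14 * D.
have tau0 : 0 <= tau by rewrite mulr_ge0.
have v0 : 0 <= v by rewrite /v; move: tau0 e0 D0; lrc.
exists tau, (v + 14 * D); split; [exact: tau0|by move: v0 D0; lrc|].
move=> q l l0 CG q0.
have [vl|lv] := leP v l; last first.
  (* A segment shorter than [v] is separated from anything by the bound itself. *)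
  exists (fun=> 1%g); split; first by move=> s; rewrite (act1 gact) mdistxx.
  move=> s s' _ t _; have := cp_in (cgeod_translate gact 1%g CG) (leg q 1%g t) => /andP[_].
  by move: lv D0; lrc.
have Wt k : k \in (wball T n : seq G) -> mdist (act k o) o <= tau.
  by move=> kW; apply: (wball_disp lam0 Hlam).
have gq : geod 0 l q by case: CG.
have extend (ks : seq G) : (size ks <= 3)%N -> {subset ks <= (wball T n : seq G)} ->
    exists2 k, k \in (wball T n : seq G) & forall k0, k0 \in ks ->
      ~ meets D q l v k0 k /\ ~ meets D q l v k k0.
  move=> sks ksW; apply: contrapT => no.
  have Wm k : k \in (wball T n : seq G) -> has (fun k0 => `[< meets D q l v k0 k \/ meets D q l v k k0 >]) ks.
    move=> kW; apply: contrapT => h; apply: no; exists k => // k0 k0s.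
    by split=> m; apply: h; apply/hasP; exists k0 => //; apply/asboolP; [left|right].
  have bd : forall ks' : seq G, {subset ks' <= (wball T n : seq G)} ->
      (size [seq k <- (wball T n : seq G) | has (fun k0 => `[< meets D q l v k0 k \/ meets D q l v k k0 >]) ks'])%:R
        <= (size ks')%:R * (2 * ((2 * W0 + 1) * N%:R)) * n.+1%:R :> R.
    elim=> [|k0 ks' IH] sub; first by rewrite (eq_filter (a2 := pred0)) ?filter_pred0 //= !mul0r.
    have := IH (fun u us => sub u (mem_behead (s := k0 :: ks') us)).
    set W1 := [seq k <- _ | has _ ks'] => h1.
    pose W2 := [seq k <- (wball T n : seq G) | `[< meets D q l v k0 k \/ meets D q l v k k0 >]].
    have h2 : (size W2)%:R <= 2 * ((2 * (11 * D + 2 * tau + 2 * eps) + 1) * N%:R) :> R.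
      apply: (HN q l v tau W2 k0) => //.
      - by rewrite v0 vl.
      - by rewrite filter_uniq // fset_uniq.
      - by apply: Wt; apply: sub; exact: mem_head.
      - by move=> k; rewrite mem_filter => /andP[_]; exact: Wt.
      - by move=> k; rewrite mem_filter => /andP[/asboolP].
    have h3 : 2 * ((2 * (11 * D + 2 * tau + 2 * eps) + 1) * N%:R) <= (2 * ((2 * W0 + 1) * N%:R)) * n.+1%:R.
      have -> : (2 * ((2 * W0 + 1) * N%:R)) * n.+1%:R = 2 * ((2 * W0 + 1) * n.+1%:R * N%:R) by ring.
      rewrite ler_wpM2l // ler_wpM2r //.
      rewrite /tau /W0 -natr1; have : 0 <= n%:R * D by rewrite mulr_ge0 // ltW.
      have : 0 <= n%:R * eps by rewrite mulr_ge0.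
      have : 0 <= n%:R :> R by [].
      by move: lam0; lrc.
    have sz : (size [seq k <- (wball T n : seq G) | has (fun k1 => `[< meets D q l v k1 k \/ meets D q l v k k1 >]) (k0 :: ks')]
        <= size W1 + size W2)%N.
      rewrite -size_cat; apply: uniq_leq_size; first by rewrite filter_uniq // fset_uniq.
      move=> k; rewrite mem_filter /= mem_cat !mem_filter => /andP[/orP[h|h] ->]; rewrite andbT.
        by rewrite h orbT.
      by rewrite h.
    apply: le_trans (_ : (size W1 + size W2)%:R <= _); first by rewrite ler_nat.
    rewrite natrD [size (k0 :: ks')]/= -natr1 -mulrA mulrDl mul1r mulrA lerD //.
    exact: le_trans h3.
  have := bd ks ksW; rewrite (_ : [seq k <- _ | _] = wball T n :> seq G); last first.
    by apply/all_filterP/allP => k; exact: Wm.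
  have : (size ks)%:R * (2 * ((2 * W0 + 1) * N%:R)) * n.+1%:R <= 3 * (2 * ((2 * W0 + 1) * N%:R)) * n.+1%:R.
    rewrite ler_wpM2r // ler_wpM2r ?ler_nat // !mulr_ge0 // addr_ge0 // mulr_ge0 // /W0.
    by move: D0 lam0 e0; lrc.
  by move: Hn; rewrite cardfE; lrc.
have [k1 k1W H1] := extend [::] isT ltac:(by []).
have [k2 k2W H2] := extend [:: k1] isT ltac:(by move=> x; rewrite inE => /eqP->).
have [k3 k3W H3] := extend [:: k1; k2] isT ltac:(by move=> x; rewrite !inE => /orP[] /eqP->).
have [k4 k4W H4] := extend [:: k1; k2; k3] isT ltac:(by move=> x; rewrite !inE => /or3P[] /eqP->).
pose k (s : letter) := if s.1 then (if s.2 then k1 else k2) else (if s.2 then k3 else k4).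
have kW s : k s \in (wball T n : seq G) by case: s => [[] []].
exists k; split; first by move=> s; apply: Wt.
move=> s s' ss' t tl.
have nm : ~ meets D q l v (k s) (k s').
  have m12 := H2 k1 (mem_head _ _); have m13 := H3 k1 ltac:(by rewrite !inE eqxx ?orbT).
  have m23 := H3 k2 ltac:(by rewrite !inE eqxx ?orbT); have m14 := H4 k1 ltac:(by rewrite !inE eqxx ?orbT).
  have m24 := H4 k2 ltac:(by rewrite !inE eqxx ?orbT); have m34 := H4 k3 ltac:(by rewrite !inE eqxx ?orbT).
  by case: s s' ss' => [[] []] [[] []] //= _; rewrite /k /=;
    first [exact: m12.1|exact: m12.2|exact: m13.1|exact: m13.2|exact: m14.1|exact: m14.2
          |exact: m23.1|exact: m23.2|exact: m24.1|exact: m24.2|exact: m34.1|exact: m34.2].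
apply: (not_meets_proj D0 CG nm (B := 2 * tau + 2 * eps)) => //; last by rewrite /v; lrc.
have st s0 : mdist (leg q (k s0) 0) o <= tau + eps.
  have := dist_tri (leg q (k s0) 0) (act (k s0) o) o; rewrite (act_iso gact).
  by have := Wt _ (kW s0); move: q0; lrc.
have := dist_tri (leg q (k s') 0) o (leg q (k s) 0).
by rewrite (metric_sym o); have := st s; have := st s'; lrc.
Qed.
End Ports.

(** * Legs facing each other *)

Definition redf (d : seq letter) : bool := sorted (fun s t => t != linv s) d.

Lemma redf_rcons d s : redf (rcons d s) = redf d && (if d is s1 :: d' then s != linv (last s1 d') else true).
Proof. by case: d => [|s1 d] //=; rewrite rcons_path. Qed.

Lemma redf_path v0 v : reduced v0 -> reduced v -> exists2 d, redf d & foldl step v0 d = v.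
Proof.
move=> r0; elim: v => [_|s v IH rv].
  exists (map linv v0).
    elim: v0 r0 => [|a [|b v0] IH] //= /andP[h1 h2].
    by rewrite linvK (inv_eq linvK) h1; exact: IH.
  by elim: v0 r0 => [|a v0 IH] //= /andP[_ /IH]; rewrite linvK eqxx.
have rv' : reduced v by move: rv => /= /andP[].
have sv : step v s = s :: v by move: rv => /= /andP[]; case: v {IH rv'} => [|b v] //= /negPf ->.
have [d rd E] := IH rv'.
case: (lastP d) rd E => [|d' s'] rd E; first by exists [:: s] => //=; rewrite -sv -E.
rewrite -cats1 foldl_cat /= in E.
have [ss'|ss'] := eqVneq s (linv s').
  exists d'; first by move: rd; rewrite redf_rcons => /andP[].
  by rewrite -sv -E ss' stepK // reduced_foldl.
exists (rcons (rcons d' s') s); last by rewrite -!cats1 !foldl_cat /= E.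
by rewrite redf_rcons rd; case: d' {rd E} => [|a d'] //=; rewrite last_rcons.
Qed.

Lemma three_good (bad : letter -> Prop) :
  (forall s s', s != s' -> ~ bad s \/ ~ bad s') ->
  exists a b c, [/\ a != b, a != c, b != c & [/\ ~ bad a, ~ bad b & ~ bad c]].
Proof.
move=> H; pose t1 : letter := (true, true); pose t2 : letter := (true, false).
pose t3 : letter := (false, true); pose t4 : letter := (false, false).
have [b1|n1] := pselect (bad t1).
  by exists t2, t3, t4; split => //; split; [case: (H t1 t2 isT)|case: (H t1 t3 isT)|case: (H t1 t4 isT)].
have [b2|n2] := pselect (bad t2).
  by exists t1, t3, t4; split => //; split => //; [case: (H t2 t3 isT)|case: (H t2 t4 isT)].
have [b3|n3] := pselect (bad t3).
  by exists t1, t2, t4; split => //; split => //; case: (H t3 t4 isT).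
by exists t1, t2, t3.
Qed.

Section Facing.
Context {R : realType} {G : groupType} {X : metricType R}.
Variables (act : G -> X -> X) (o : X).
Hypothesis geoX : geodesic_space X.
Hypothesis gact : geometric_action act.
Implicit Types (x y z : X) (f g h : G).
Notation leg := (translate act).
Notation separated := (separated act).

Variables (D : R) (q : R -> X) (l : R).
Hypotheses (D0 : 0 < D) (CG : cgeod D q 0 l) (l0 : 0 <= l).

Ltac lrc := move: (D0); clear -geoX gact CG D0 l0; lra.

Lemma separatedM B h k k' : separated q l B (h * k)%g (h * k')%g <-> separated q l B k k'.
Proof.
have E t : leg q (h * k')%g t = act h (leg q k' t) by exact: (actM gact).
by split=> H t tl; have := H t tl; rewrite E (cp_translateM gact).
Qed.

(** The point of the nearer leg closest to [x] lies in the contraction ball of [x] for the other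
    leg, and projects near the start of it. *)
Lemma far_or B k k' x : separated q l B k k' -> separated q l B k' k ->
  cp (leg q k) 0 l x <= B + D \/ cp (leg q k') 0 l x <= B + D.
Proof.
move=> s1 s2; have C1 := cgeod_translate gact k CG; have C2 := cgeod_translate gact k' CG.
have [h|h] := leP (dq (leg q k') 0 l x) (dq (leg q k) 0 l x).
  left; have := cp_contr C1 h; have := s1 _ (cp_in C2 x).
  by rewrite ler_norml => h1 /andP[_]; move: h1; lrc.
right; have := cp_contr C2 (ltW h); have := s2 _ (cp_in C1 x).
by rewrite ler_norml => h1 /andP[_]; move: h1; lrc.
Qed.

(** If [J] and [J'] both projected far along [K], both would pass close to the point of [K] at
    parameter [v], hence close to each other. As [J'] projects near the start of [J], that point
    would be close to [b], which projects near the start of [K]. *)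
Lemma one_bad B r K J J' b : 0 <= B -> 0 <= r -> separated q l B J J' ->
  mdist (leg q J 0) b <= r -> mdist (leg q J' 0) b <= r ->
  cp (leg q K) 0 l b <= B + D ->
  separated q l (3 * B + 126 * D + 4 * r) K J \/ separated q l (3 * B + 126 * D + 4 * r) K J'.
Proof.
move=> B0 r0 sJ hJ hJ' hb; apply: contrapT => /not_orP[n1 n2].
pose v := 3 * B + 112 * D + 4 * r.
have CK := cgeod_translate gact K CG.
have pass J1 : mdist (leg q J1 0) b <= r -> ~ separated q l (3 * B + 126 * D + 4 * r) K J1 ->
    [/\ v <= l & exists2 t, 0 <= t <= l & mdist (leg q J1 t) (leg q K v) <= 11 * D].
  move=> h1 /existsNP[t /not_implyP[tl /negP]]; rewrite -ltNge => ht.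
  have CJ := cgeod_translate gact J1 CG; have [_ gJ _] := CJ.
  have vl : v <= l.
    by have /andP[_] := cp_in CK (leg q J1 t); move: ht; rewrite /v; lrc.
  split => //; have /andP[t0 tl'] := tl.
  have gt : geod 0 t (leg q J1) by apply: geodW gJ.
  have [|u /andP[u0 ut] hu] := near_passing geoX D0 CK t0 gt (s := v); last first.
    by exists u => //; rewrite u0 (le_trans ut).
  apply/andP; split; last by move: ht; rewrite /v; lrc.
  have : cp (leg q K) 0 l (leg q J1 0) <= cp (leg q K) 0 l b + D + 4 * r.
    have [h|h] := cp_lip CK (leg q J1 0) b; move: h; rewrite ler_norml => /andP[_].
      by move: r0; lrc.
    by move: h1; lrc.
  by move: hb; rewrite /v; move: B0 r0; lrc.
have [vl [t1 t1l h1]] := pass J hJ n1; have [_ [t2 t2l h2]] := pass J' hJ' n2.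
have CJ := cgeod_translate gact J CG.
have c1 := sJ t2 t2l; have c2 := cp_dist_q CJ (leg q J' t2) t1l.
have d12 : mdist (leg q J' t2) (leg q J t1) <= 22 * D.
  have := dist_tri (leg q J' t2) (leg q K v) (leg q J t1).
  by rewrite (metric_sym (leg q K v)); move: h1 h2; lrc.
have t1s : t1 <= B + 44 * D.
  by move: c2; rewrite ler_norml => /andP[]; move: c1 d12; lrc.
have e1 : mdist (leg q J t1) (leg q J 0) = t1.
  by rewrite (dist_q CJ) ?lexx ?l0 // subr0 ger0_norm //; case/andP: t1l.
have v0 : 0 <= v <= l by rewrite vl andbT /v; move: B0 r0; lrc.
have c3 := cp_dist_q CK b v0.
have d3 : mdist b (leg q K v) <= B + 55 * D + r.
  have := dist_tri b (leg q J 0) (leg q K v); have := dist_tri (leg q J 0) (leg q J t1) (leg q K v).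
  by rewrite (metric_sym b (leg q J 0)) (metric_sym (leg q J 0) (leg q J t1)); move: h1 hJ e1 t1s; lrc.
by move: c3; rewrite ler_norml => /andP[h _]; move: h hb d3 r0; rewrite /v; lrc.
Qed.

(** Two indices [i] have legs seeing [act g o] near their starts, and three indices [j] have
    translated legs seeing [o] so. By [one_bad] each of the two [i] rejects at most one [j], so some
    [j] suits both of them; that [j] in turn rejects at most one of the two. *)
Lemma facing (k : letter -> G) tau eps B : 0 <= B -> 0 <= tau -> 0 <= eps ->
  (forall s, mdist (act (k s) o) o <= tau) -> mdist (q 0) o <= eps ->
  (forall s s', s != s' -> separated q l B (k s) (k s')) ->
  forall g, exists i j,
    separated q l (3 * B + 126 * D + 4 * (tau + eps)) (k i) (g * k j)%g /\
    separated q l (3 * B + 126 * D + 4 * (tau + eps)) (g * k j)%g (k i).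
Proof.
move=> B0 tau0 e0 kt q0 ks g.
have st s : mdist (leg q (k s) 0) o <= tau + eps.
  have := dist_tri (leg q (k s) 0) (act (k s) o) o; rewrite (act_iso gact).
  by have := kt s; move: q0; lrc.
have gst s : mdist (leg q (g * k s)%g 0) (act g o) <= tau + eps.
  by rewrite /translate (actM gact) (act_iso gact); exact: st.
have gks s s' : s != s' -> separated q l B (g * k s)%g (g * k s')%g.
  by move=> /ks; rewrite separatedM.
have r0 : 0 <= tau + eps by rewrite addr_ge0.
have [i1 [i2 [_ [i12 _ _ [gi1 gi2 _]]]]] : exists a b c, [/\ a != b, a != c, b != c &
   [/\ ~ ~ cp (leg q (k a)) 0 l (act g o) <= B + D, ~ ~ cp (leg q (k b)) 0 l (act g o) <= B + D
     & ~ ~ cp (leg q (k c)) 0 l (act g o) <= B + D]].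
  apply: three_good => s s' ss'.
  have ss := ss'; rewrite eq_sym in ss.
  by have [h|h] := far_or (act g o) (ks _ _ ss') (ks _ _ ss); [left => n; exact: (n h)|right => n; exact: (n h)].
have [j1 [j2 [j3 [j12 j13 j23 [gj1 gj2 gj3]]]]] : exists a b c, [/\ a != b, a != c, b != c &
   [/\ ~ ~ cp (leg q (g * k a)%g) 0 l o <= B + D, ~ ~ cp (leg q (g * k b)%g) 0 l o <= B + D
     & ~ ~ cp (leg q (g * k c)%g) 0 l o <= B + D]].
  apply: three_good => s s' ss'.
  have ss := ss'; rewrite eq_sym in ss.
  by have [h|h] := far_or o (gks _ _ ss') (gks _ _ ss); [left => n; exact: (n h)|right => n; exact: (n h)].
move: gi1 gi2 gj1 gj2 gj3 => /contrapT gi1 /contrapT gi2 /contrapT gj1 /contrapT gj2 /contrapT gj3.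
set B2 := 3 * B + _ + _.
have T1 i : cp (leg q (k i)) 0 l (act g o) <= B + D -> forall j j', j != j' ->
    separated q l B2 (k i) (g * k j)%g \/ separated q l B2 (k i) (g * k j')%g.
  by move=> hi j j' jj'; apply: (one_bad B0 r0 (gks _ _ jj') (gst j) (gst j') hi).
have T2 j : cp (leg q (g * k j)%g) 0 l o <= B + D ->
    separated q l B2 (g * k j)%g (k i1) \/ separated q l B2 (g * k j)%g (k i2).
  by move=> hj; apply: (one_bad B0 r0 (ks _ _ i12) (st i1) (st i2) hj).
have [j [gj s1 s2]] : exists j, [/\ cp (leg q (g * k j)%g) 0 l o <= B + D,
    separated q l B2 (k i1) (g * k j)%g & separated q l B2 (k i2) (g * k j)%g].
  have A1 := T1 i1 gi1; have A2 := T1 i2 gi2.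
  have a12 := A1 _ _ j12; have a13 := A1 _ _ j13; have a23 := A1 _ _ j23.
  have b12 := A2 _ _ j12; have b13 := A2 _ _ j13; have b23 := A2 _ _ j23.
  apply: contrapT => no.
  have n1 : ~ (separated q l B2 (k i1) (g * k j1)%g /\ separated q l B2 (k i2) (g * k j1)%g).
    by move=> [h1 h2]; apply: no; exists j1.
  have n2 : ~ (separated q l B2 (k i1) (g * k j2)%g /\ separated q l B2 (k i2) (g * k j2)%g).
    by move=> [h1 h2]; apply: no; exists j2.
  have n3 : ~ (separated q l B2 (k i1) (g * k j3)%g /\ separated q l B2 (k i2) (g * k j3)%g).
    by move=> [h1 h2]; apply: no; exists j3.
  by clear -a12 a13 a23 b12 b13 b23 n1 n2 n3; tauto.
by have [h|h] := T2 j gj; [exists i1, j|exists i2, j].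
Qed.
End Facing.

(** * Curves visiting prescribed points *)

Section Curves.
Context {R : realType} {X : metricType R}.
Implicit Types (A V : set X) (x y z : X) (alpha : R -> X).

Definition nonexpanding (l : R) alpha : Prop :=
  forall s t, 0 <= s <= l -> 0 <= t <= l -> mdist (alpha s) (alpha t) <= `|s - t|.

(** Trajectories are only known to shadow paths of finite length. *)
Lemma nonexpanding_length l alpha : 0 <= l -> nonexpanding l alpha ->
  exists L : R, path_length alpha 0 l = L%:E.
Proof.
move=> l0 na; rewrite /path_length; set S := [set _ | _ in _].
have ub (u : \bar R) : S u -> (u <= l%:E)%E.
  move=> [s ps <-]; rewrite lee_fin.
  suff : forall a, 0 <= a -> itv_partition a l s ->
      \sum_(i < size s) mdist (alpha (nth l (a :: s) i)) (alpha (nth l (a :: s) i.+1)) <= l - a.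
    by move=> /(_ 0 (lexx _) ps); rewrite subr0.
  elim: s {ps} => [|b s IH] a a0 p; first by rewrite big_ord0 (itv_partition_nil p) subrr.
  have p' := itv_partition_cons p; have bl := itv_partition_le p'.
  have ab : a < b by move: p => [/= /andP[]].
  rewrite big_ord_recl /=; have := IH b (le_trans a0 (ltW ab)) p'.
  have := na a b; rewrite a0 (le_trans (ltW ab) bl) (le_trans a0 (ltW ab)) bl => /(_ isT isT).
  rewrite distrC ger0_norm ?subr_ge0 ?(ltW ab) // => h1 h2.
  by apply: le_trans (lerD h1 h2) _; lra.
have [u Su] : exists u, S u /\ (0%:E <= u)%E.
  have [l1|l1] := ltP 0 l.
    exists (\sum_(i < size [:: l]) mdist (alpha (nth l [:: 0; l] i)) (alpha (nth l [:: 0; l] i.+1)))%:E.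
    split; first by exists [:: l] => //; exact: itv_partition1.
    by rewrite lee_fin; apply: sumr_ge0 => i _; exact: mdist_ge0.
  have l00 : l = 0 by apply/eqP; rewrite eq_le l0 l1.
  exists 0%:E; split => //; exists [::]; last by rewrite big_ord0.
  by split => //=; rewrite l00.
have h1 : (0%:E <= ereal_sup S)%E by apply: le_trans Su.2 _; apply: ereal_sup_ubound; exact: Su.1.
have h2 : (ereal_sup S <= l%:E)%E by apply: ge_ereal_sup.
case: (ereal_sup S) h1 h2 => [r _ _||] //; by exists r.
Qed.

Definition curve A V x y : Prop := exists l alpha, [/\ 0 <= l, nonexpanding l alpha,
  alpha 0 = x, alpha l = y &
  (forall t, 0 <= t <= l -> A (alpha t)) /\ (forall z, V z -> exists2 t, 0 <= t <= l & alpha t = z)].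

Lemma curve_cat A V V' x y z : curve A V x y -> curve A V' y z -> curve A (V `|` V') x z.
Proof.
move=> [l [al [l0 na a0 al_ [aA aV]]]] [m [be [m0 nb b0 bm [bA bV]]]].
pose ga t := if t <= l then al t else be (t - l).
have gb t : l <= t -> ga t = be (t - l).
  move=> lt; rewrite /ga; case: ifP => // tl.
  have tl' : t = l by apply/eqP; rewrite eq_le tl lt.
  by rewrite tl' subrr al_ b0.
have ga1 t : t <= l -> ga t = al t by rewrite /ga => ->.
exists (l + m), ga; split.
- by rewrite addr_ge0.
- suff H s t : 0 <= s -> s <= t -> t <= l + m -> mdist (ga s) (ga t) <= t - s.
    move=> s t /andP[s0 sm] /andP[t0 tm]; have [st|ts] := leP s t.
      by rewrite distrC ger0_norm ?subr_ge0 //; exact: H.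
    by rewrite ger0_norm ?subr_ge0 ?(ltW ts) // metric_sym; apply: H => //; exact: ltW.
  move=> s0 st tm; have [tl|lt] := leP t l.
    rewrite !ga1 // ?(le_trans st) //; apply: le_trans (na _ _ _ _) _.
    + by rewrite s0 (le_trans st).
    + by rewrite (le_trans s0 st).
    by rewrite distrC ger0_norm ?subr_ge0.
  have tin : 0 <= t - l <= m by move: lt tm; clear; lra.
  have [sl|ls] := leP s l; last first.
    rewrite !gb ?(ltW ls) ?(ltW lt) //; apply: le_trans (nb _ _ _ tin) _.
      by move: ls st tm; clear; lra.
    by rewrite distrC ger0_norm; move: st; clear; lra.
  rewrite (gb t) ?(ltW lt) // ga1 //; apply: le_trans (dist_tri _ (al l) _) _.
  have h1 := na s l ltac:(by rewrite s0) ltac:(by rewrite lexx l0).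
  have h2 := nb 0 (t - l) ltac:(by rewrite lexx m0) tin.
  rewrite {2}al_ -b0; move: h1 h2; rewrite distrC ger0_norm ?subr_ge0 // sub0r normrN ger0_norm; last by move: lt; clear; lra.
  by clear; lra.
- by rewrite ga1 // a0.
- by rewrite gb ?lerDl // addrC addKr bm.
split.
  move=> t /andP[t0 tm]; have [tl|lt] := leP t l; first by rewrite ga1 //; apply: aA; rewrite t0.
  by rewrite gb ?(ltW lt) //; apply: bA; move: lt tm; clear; lra.
move=> w [/aV[t /andP[t0 tl] <-]|/bV[t /andP[t0 tm] <-]].
  by exists t; [move: t0 tl m0; clear; lra|rewrite ga1].
exists (l + t); first by move: t0 tm l0; clear; lra.
by rewrite gb ?lerDl // addrC addKr.
Qed.

Lemma curve_rev A V x y : curve A V x y -> curve A V y x.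
Proof.
move=> [l [al [l0 na a0 al_ [aA aV]]]]; exists l, (fun t => al (l - t)).
have H t : 0 <= t <= l -> 0 <= l - t <= l by clear; lra.
split => //.
- move=> s t hs ht; apply: le_trans (na _ _ (H s hs) (H t ht)) _.
  by rewrite (_ : l - s - (l - t) = t - s) ?(distrC t) //; ring.
- by rewrite subr0.
- by rewrite subrr.
split; first by move=> t /H /aA.
by move=> z /aV[t tl <-]; exists (l - t); [exact: H|rewrite opprB addrC subrK].
Qed.

Lemma curve_sub A V V' x y : V' `<=` V -> curve A V x y -> curve A V' x y.
Proof.
by move=> VV [l [al [l0 na a0 al_ [aA aV]]]]; exists l, al; split => //; split => // z /VV; exact: aV.
Qed.

Lemma curve_ends A x y V : curve A V x y -> curve A (V `|` [set x; y]) x y.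
Proof.
move=> [l [al [l0 na a0 al_ [aA aV]]]]; exists l, al; split => //; split => // z [/aV //|[->|->]].
  by exists 0; rewrite ?lexx.
by exists l; rewrite ?lexx ?l0.
Qed.

Lemma curve_geod A l q : 0 <= l -> geod 0 l q -> (forall t, 0 <= t <= l -> A (q t)) ->
  curve A set0 (q 0) (q l).
Proof.
by move=> l0 gq qA; exists l, q; split => // s t hs ht; rewrite gq.
Qed.

Lemma curve_between A x y : geodesic_space X -> (forall z, between x z y -> A z) ->
  curve A set0 x y.
Proof.
move=> geoX bA; have [g [gg g0 gl H]] := geodesic_between geoX x y.
have := curve_geod (A := A) (mdist_ge0 x y) gg; rewrite g0 gl; apply => t tl.
by apply: bA; have [e1 e2] := H t tl; rewrite /between e1 e2 subrKC.
Qed.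
End Curves.

Fixpoint words (T : eqType) (S : seq T) (M : nat) : seq (seq T) :=
  if M is M'.+1 then [::] :: [seq s :: w | s <- S, w <- words S M'] else [::].

Lemma mem_words (T : eqType) (S : seq T) (M : nat) (w : seq T) :
  (size w < M)%N -> {subset w <= S} -> w \in words S M.
Proof.
elim: M w => // M IH [|s w] /= sw ws; rewrite inE //=; apply/allpairsP; exists (s, w).
split=> //=; first by apply: ws; exact: mem_head.
by apply: IH => // t tw; apply: ws; rewrite inE tw orbT.
Qed.

(** * The tree of legs and its coding by words *)

Section TreeOfLegs.
Context {R : realType} {G : groupType} {X : metricType R}.
Variables (act : G -> X -> X).
Hypothesis geoX : geodesic_space X.
Hypothesis gact : geometric_action act.
Implicit Types (x y z : X) (f g h : G).
Notation leg := (translate act).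
Notation separated := (separated act).

Variables (D : R) (q : R -> X) (l : R) (k e : letter -> G) (B1 B2 sig : R).
Hypotheses (D0 : 0 < D) (CG : cgeod D q 0 l).
Hypothesis He : forall s, e (linv s) = (e s)^-1%g.
Hypothesis F1 : forall s s', s != s' -> separated q l B1 (k s) (k s').
Hypothesis F2 : forall s t, 0 <= t <= l ->
  l - B2 <= cp (leg q (k s)) 0 l (leg q (e s * k (linv s))%g t).
Hypotheses (B10 : 0 <= B1) (B20 : 0 <= B2) (sig0 : 0 <= sig).
Hypothesis big : 2 * (B1 + B2 + 40 * D + 20 * sig) <= l.

Let K0 : 0 < D /\ (0 <= B1 /\ (0 <= B2 /\ (0 <= sig /\ 2 * (B1 + B2 + 40 * D + 20 * sig) <= l))).
Proof. by []. Qed.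

Ltac lrc := clear -geoX gact CG He F1 F2 D0 B10 B20 sig0 big K0; move: (K0) => [? [? [? [? ?]]]] *; lra.

(* The parameter of the projection of x to the leg leaving the vertex f through the
   port s. *)
Definition side f s x : R := cp (leg q (f * k s)%g) 0 l x.

Lemma side_lip f s x y : mdist x y <= sig -> `|side f s x - side f s y| <= D + 4 * sig.
Proof.
move=> xy; have [h|h] := cp_lip (cgeod_translate gact (f * k s)%g CG) x y.
  by apply: le_trans h _; lrc.
by apply: le_trans h _; move: xy; lrc.
Qed.

Lemma side_leg f s t : 0 <= t <= l -> side f s (leg q (f * k s)%g t) = t.
Proof. exact: (cp_q (cgeod_translate gact (f * k s)%g CG)). Qed.

Lemma side_other f s s' t : s != s' -> 0 <= t <= l -> side f s (leg q (f * k s')%g t) <= B1.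
Proof. by move=> ss' tl; exact: ((separatedM gact q l B1 f (k s) (k s')).2 (F1 ss')). Qed.

Lemma side_opp f s t : 0 <= t <= l -> l - B2 <= side f s (leg q (f * e s * k (linv s))%g t).
Proof.
move=> tl; rewrite -mulgA; have -> : leg q (f * (e s * k (linv s)))%g t =
  act f (leg q (e s * k (linv s))%g t) by exact: (actM gact).
by rewrite /side (cp_translateM gact); exact: F2.
Qed.

Lemma side_port f s s' x : s != s' -> side f s x <= B1 + D \/ side f s' x <= B1 + D.
Proof.
move=> ss'; have ss := ss'; rewrite eq_sym in ss.
by apply: (far_or gact D0 CG); apply/(separatedM gact); exact: F1.
Qed.

(** As in [far_or], the nearest point of [x] on the nearer leg of the edge lies in the contraction
    ball of [x] for the other leg; by [F2] it projects near the far end of it. *)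
Lemma side_edge f s x : l - B2 - D <= side f s x \/ l - B2 - D <= side (f * e s)%g (linv s) x.
Proof.
have C1 := cgeod_translate gact (f * k s)%g CG; have C2 := cgeod_translate gact (f * e s * k (linv s))%g CG.
have [h|h] := leP (dq (leg q (f * e s * k (linv s))%g) 0 l x) (dq (leg q (f * k s)%g) 0 l x).
  left; have := cp_contr C1 h; have := side_opp f s (cp_in C2 x).
  by rewrite ler_norml => h1 /andP[h2 _]; move: h1 h2; rewrite /side; lrc.
right; have := cp_contr C2 (ltW h); have := side_opp (f * e s)%g (linv s) (cp_in C1 x).
have -> : (f * e s * e (linv s) * k (linv (linv s)))%g = (f * k s)%g.
  by rewrite linvK He mulgK.
by rewrite ler_norml => h1 /andP[h2 _]; move: h1 h2; rewrite /side; lrc.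
Qed.

Lemma side_out f s t x : s != t -> B1 + D < side f s x ->
  side f t x <= B1 + D /\ l - B2 - D <= side (f * e t)%g (linv t) x.
Proof.
move=> st h; have [h'|h'] := side_port f x st; first by move: h h'; lrc.
by split => //; have [h2|//] := side_edge f t x; move: h' h2; lrc.
Qed.

(** From the second vertex of a reduced path [x] is seen backwards. Since it is seen in one
    direction only, the next vertex sees it backwards as well, and so on to the end. *)
Lemma side_far m f s1 d x : B1 + D < m -> m <= l - B2 - D -> redf (s1 :: d) ->
  m <= side (f * e s1)%g (linv s1) x ->
  m <= side (f * disp e (s1 :: d))%g (linv (last s1 d)) x /\
  forall t, t != linv (last s1 d) -> side (f * disp e (s1 :: d))%g t x <= B1 + D.
Proof.
move=> m1 m2; elim: d s1 f => [|s2 d IH] s1 f rd h.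
  rewrite /= mulg1; split => // t t1; rewrite eq_sym in t1.
  by apply: (side_out t1 _).1; exact: lt_le_trans h.
move: rd => /= /andP[s12 rd]; rewrite mulgA.
apply: (IH s2 (f * e s1)%g) => //; rewrite eq_sym in s12.
by apply: le_trans m2 _; apply: (side_out s12 _).2; exact: lt_le_trans h.
Qed.

(* The point x is seen from every neighbour of f in the direction of f. *)
Definition located f x : Prop := forall s, l / 2 <= side (f * e s)%g (linv s) x.

(** A small move can leave [f] only across the middle of a leg: the side was at least [l / 2] before
    and drops by no more than the jump of [side_lip]. *)
Lemma located_step f x y s : located f x -> mdist x y <= sig ->
  side (f * e s)%g (linv s) y < l / 2 ->
  located (f * e s)%g y /\ l / 2 - D - 4 * sig <= side (f * e s)%g (linv s) y.
Proof.
move=> lf xy h; have h1 : l / 2 - D - 4 * sig <= side (f * e s)%g (linv s) y.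
  have := side_lip (f * e s)%g (linv s) xy; rewrite ler_norml => /andP[_].
  by have := lf s; lrc.
split => // t; have [->|ts] := eqVneq t (linv s).
  rewrite linvK He mulgK; have [h2|h2] := side_edge f s y; first by move: h2; lrc.
  by move: h h2; lrc.
apply: le_trans (side_out (s := linv s) (t := t) (f := (f * e s)%g) (x := y) _ _).2.
- by lrc.
- by rewrite eq_sym.
- by move: h1; lrc.
Qed.

(** On a nontrivial reduced path from [v0] to [v], the point would be seen backwards at every vertex
    by [side_far], whereas the last vertex before [v] sees it towards [v]. *)
Lemma located_unique v v0 x : reduced v -> reduced v0 -> located (ev e v) x ->
  (forall t, side (ev e v0) t x < l / 2) -> v = v0.
Proof.
move=> rv rv0 lv hub; have [d rd E] := redf_path rv0 rv.
have Ev : ev e v = (ev e v0 * disp e d)%g by rewrite -E (ev_foldl He).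
case: (lastP d) rd E Ev => [|d' s] rd E Ev; first by rewrite -E.
have := lv (linv s); rewrite Ev -cats1 disp_cat /= mulg1 linvK He mulgA mulgK => h.
exfalso; case: d' rd h {E Ev} => [|s1 d'] rd h.
  by have := hub s; move: h; rewrite /= mulg1; lrc.
move: rd; rewrite redf_rcons => /andP[rd sl].
have h1 : l - B2 - D <= side (ev e v0 * e s1)%g (linv s1) x.
  by have [h2|//] := side_edge (ev e v0) s1 x; have := hub s1; move: h2; lrc.
have [_ H] := side_far (m := l - B2 - D) (f := ev e v0) (s1 := s1) (d := d') (x := x)
  ltac:(lrc) (lexx _) rd h1.
by have := H s sl; move: h; lrc.
Qed.

(* The points of the tree at the vertex f: geodesics joining the starts of the legs at f,
   the legs, and geodesics joining the ends of the two legs of each edge. *)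
Definition hub_pt f s : X := leg q (f * k s)%g 0.
Definition end_pt f s : X := leg q (f * k s)%g l.

Definition piece f z : Prop :=
  [\/ exists s s', between (hub_pt f s) z (hub_pt f s'),
      exists s t, 0 <= t <= l /\ z = leg q (f * k s)%g t |
      exists s, between (end_pt f s) z (end_pt (f * e s)%g (linv s))].

Lemma side_between f s x m y w : between x m y ->
  (w <= side f s x -> w <= side f s y -> w - 8 * D <= side f s m) /\
  (side f s x <= w -> side f s y <= w -> side f s m <= w + 8 * D).
Proof.
move=> b; have := cp_quasiconvex geoX D0 (cgeod_translate gact (f * k s)%g CG) b.
rewrite -/(side f s x) -/(side f s m) -/(side f s y).
move: (side f s x) (side f s m) (side f s y) => u c v h.
have t1 := ler_norm (u - c); have t2 := ler_norm (c - u); have t3 := ler_norm (c - v).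
have t4 := ler_norm (v - c); rewrite (distrC c u) in t2; rewrite (distrC v c) in t4.
have [uv|uv] := leP u v.
  rewrite (distrC u v) (ger0_norm (x := v - u)) ?subr_ge0 // in h.
  by split; move: h t1 t2 t3 t4 uv; lrc.
rewrite (ger0_norm (x := u - v)) ?subr_ge0 ?(ltW uv) // in h.
by split; move: h t1 t2 t3 t4 uv; lrc.
Qed.

Lemma l_ge0 : 0 <= l. Proof. by lrc. Qed.

Lemma in0 : (0 : R) <= 0 <= l. Proof. by rewrite lexx l_ge0. Qed.
Lemma inl_ : (0 : R) <= l <= l. Proof. by rewrite lexx l_ge0. Qed.

Lemma hub_side f s s' : side f s (hub_pt f s') <= B1.
Proof.
have [->|ss] := eqVneq s s'; first by rewrite side_leg ?in0 //; lrc.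
by apply: side_other => //; exact: in0.
Qed.

(** The legs are controlled by [F1] and [F2], and the connecting geodesics by their ends through
    quasiconvexity of the projection. *)
Lemma piece_home f z : piece f z -> forall s, l - B2 - 9 * D <= side (f * e s)%g (linv s) z.
Proof.
have lo s x : side f s x <= B1 + D -> l - B2 - D <= side (f * e s)%g (linv s) x.
  by move=> h; have [h2|//] := side_edge f s x; move: h h2; lrc.
have legp s s' t : 0 <= t <= l -> l - B2 - D <= side (f * e s)%g (linv s) (leg q (f * k s')%g t).
  move=> tl; have [->|ss] := eqVneq s s'.
    have := side_opp (f * e s')%g (linv s') tl; rewrite linvK He mulgK.
    by lrc.
  by apply: lo; have := side_other f ss tl; lrc.
move=> [[s1 [s2 b]]|[s1 [t [tl ->]]]|[s1 b]] s.
- have [h _] := side_between (f * e s)%g (linv s) (l - B2 - D) b.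
  have := h (legp s s1 0 in0) (legp s s2 0 in0); lrc.
- by have := legp s s1 t tl; lrc.
have [h _] := side_between (f * e s)%g (linv s) (l - B2 - D) b.
suff h2 : l - B2 - D <= side (f * e s)%g (linv s) (end_pt (f * e s1)%g (linv s1)).
  by have := h (legp s s1 l inl_) h2; lrc.
have [->|ss] := eqVneq s s1; first by rewrite side_leg ?inl_ //; lrc.
have h3 := side_opp f s1 inl_.
have [h4|h4] := side_port f (end_pt (f * e s1)%g (linv s1)) ss; first exact: lo.
by move: h3 h4; rewrite /end_pt; lrc.
Qed.

Lemma piece_located_near f z x : piece f z -> mdist z x <= sig -> located f x.
Proof.
move=> pz zx s; have := piece_home pz s; have := side_lip (f * e s)%g (linv s) zx.
by rewrite ler_norml => /andP[_]; lrc.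
Qed.

(** Pieces at the other vertices project near an end of the leg by [side_far], and so do the
    connecting geodesics and the other legs at [u]. Only points of the leg itself project to its
    middle, and they are their own projections. *)
Lemma piece_middle v u s z : reduced v -> reduced u -> piece (ev e v) z ->
  l / 2 - 2 * D - 8 * sig <= side (ev e u) s z <= l / 2 + 2 * D + 8 * sig ->
  mdist z (leg q (ev e u * k s)%g (l / 2)) <= 2 * D + 8 * sig.
Proof.
move=> rv ru pz win; have [d rd E] := redf_path rv ru.
have Eu : ev e u = (ev e v * disp e d)%g by rewrite -E (ev_foldl He).
have home := piece_home pz.
case: d rd E Eu => [|s1 d] rd E Eu.
  rewrite {}Eu /= mulg1 in win *; set f := ev e v in pz win home *.
  have exc w : (w <= B1 + 10 * D) \/ (l - B2 - 10 * D <= w) -> side f s z = w -> False.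
    by move=> h hw; move: h win; rewrite hw => -[h|h] /andP[]; move: h; lrc.
  case: pz => [[s1 [s2 b]]|[s1 [t [tl ez]]]|[s1 b]].
  - exfalso; apply: (exc _ _ erefl); left.
    have [_ h] := side_between f s (B1 + D) b.
    have h1 := hub_side f s s1; have h2 := hub_side f s s2.
    have := h ltac:(move: h1; lrc) ltac:(move: h2; lrc); lrc.
  - have [ss|ss] := eqVneq s s1; last first.
      by exfalso; apply: (exc _ _ erefl); left; rewrite ez; have := side_other f ss tl; lrc.
    rewrite ez ss side_leg // in win *.
    have [_ gq _] := cgeod_translate gact (f * k s1)%g CG; rewrite gq //; last first.
      by apply/andP; split; lrc.
    by rewrite ler_norml; move: win => /andP[w1 w2]; apply/andP; split; move: w1 w2; lrc.
  exfalso; have [_ hi] := side_between f s (B1 + D) b; have [lo _] := side_between f s (l - B2) b.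
  have h3 := side_opp f s1 inl_.
  have [ss|ss] := eqVneq s s1.
    apply: (exc _ _ erefl); right; rewrite ss in lo *.
    have := lo ltac:(rewrite side_leg ?inl_ //; lrc) h3; lrc.
  apply: (exc _ _ erefl); left.
  have h1 := side_other f ss inl_.
  have h2 : side f s (end_pt (f * e s1)%g (linv s1)) <= B1 + D.
    have [//|h4] := side_port f (end_pt (f * e s1)%g (linv s1)) ss.
    by move: h3 h4; rewrite /end_pt; lrc.
  have := hi ltac:(move: h1; lrc) h2; lrc.
exfalso; have [h1 h2] := side_far (m := l - B2 - 9 * D) (f := ev e v) (s1 := s1) (d := d) (x := z)
  ltac:(lrc) ltac:(lrc) rd (home s1).
rewrite -Eu in h1 h2; move: win => /andP[w1 w2].
have [ss|ss] := eqVneq s (linv (last s1 d)); first by move: h1; rewrite -ss; move: w1 w2; lrc.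
by have := h2 s ss; move: w1 w2; lrc.
Qed.

Definition tree_pt z : Prop := exists v, reduced v /\ piece (ev e v) z.
Definition base_letter : letter := (true, true).
Definition hub v : X := hub_pt (ev e v) base_letter.

Lemma hub_tree_pt v : reduced v -> tree_pt (hub v).
Proof.
by move=> rv; exists v; split => //; constructor 2; exists base_letter, 0; split => //; exact: in0.
Qed.

Lemma edge_curve v s : reduced v -> reduced (s :: v) -> curve tree_pt set0 (hub v) (hub (s :: v)).
Proof.
move=> rv rsv; set f := ev e v.
have legc g s1 : (forall z, piece g z -> tree_pt z) -> curve tree_pt set0 (hub_pt g s1) (end_pt g s1).
  move=> gA; apply: (curve_geod (q := leg q (g * k s1)%g)); first exact: l_ge0.
    by case: (cgeod_translate gact (g * k s1)%g CG).
  by move=> t tl; apply: gA; constructor 2; exists s1, t.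
have hubc g s1 s2 : (forall z, piece g z -> tree_pt z) -> curve tree_pt set0 (hub_pt g s1) (hub_pt g s2).
  by move=> gA; apply: curve_between => // z b; apply: gA; constructor 1; exists s1, s2.
have fA z : piece f z -> tree_pt z by move=> pz; exists v.
have gA z : piece (f * e s)%g z -> tree_pt z by move=> pz; exists (s :: v).
have c1 := curve_cat (hubc f base_letter s fA) (legc f s fA).
have c2 : curve tree_pt set0 (end_pt f s) (end_pt (f * e s)%g (linv s)).
  by apply: curve_between => // z b; apply: fA; constructor 3; exists s.
have c3 := curve_cat (curve_rev (legc (f * e s)%g (linv s) gA)) (hubc (f * e s)%g (linv s) base_letter gA).
by apply: curve_sub (curve_cat (curve_cat c1 c2) c3).
Qed.

Lemma word_curve v : reduced v -> curve tree_pt [set hub v] (hub [::]) (hub v).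
Proof.
elim: v => [_|s v IH rsv].
  exists 0, (fun=> hub [::]); split => //; first by move=> s t _ _; rewrite mdistxx.
  split; first by move=> _ _; exact: hub_tree_pt.
  by move=> z ->; exists 0; rewrite ?lexx.
have rv : reduced v by case/andP: rsv.
have := curve_ends (curve_cat (IH rv) (edge_curve rv rsv)).
by apply: curve_sub => z ->; right; right.
Qed.

Lemma tour (vs : seq (seq letter)) : (forall v, v \in vs -> reduced v) ->
  curve tree_pt [set hub v | v in [set` vs]] (hub [::]) (hub [::]).
Proof.
elim: vs => [_|v vs IH rvs].
  by apply: curve_sub (word_curve (v := [::]) isT) => z [].
have cv := word_curve (rvs v (mem_head _ _)).
have := curve_cat (curve_cat cv (curve_rev cv)) (IH (fun w wv => rvs w (mem_behead (s := v :: vs) wv))).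
apply: curve_sub => z [w /=]; rewrite inE => /orP[/eqP->|wv] <-; first by left; left.
by right; exists w.
Qed.

Variables (o : X) (P : set G) (Bl : seq G).
Hypothesis HP : monoid_closed P.
Hypothesis colors : forall b s,
  mdist (act b o) (leg q (k s) (l / 2)) <= 2 * D + 9 * sig -> b \in Bl.
Hypothesis shadow : forall L alpha, 0 <= L -> nonexpanding L alpha -> exists m (xs : nat -> G),
  [/\ forall i, (i < m)%N -> P ((xs i)^-1 * xs i.+1)%g /\ mdist (act (xs i) o) (act (xs i.+1) o) <= sig,
     forall t, 0 <= t <= L -> exists2 i, (i <= m)%N & mdist (alpha t) (act (xs i) o) <= sig &
     forall i, (i <= m)%N -> exists2 t, 0 <= t <= L & mdist (alpha t) (act (xs i) o) <= sig].

(** The vertex is kept as long as the trajectory is located there, so that every change happens at a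
    crossing of the middle of a leg. *)
Lemma track v0 m (xs : nat -> G) : reduced v0 -> located (ev e v0) (act (xs 0%N) o) ->
  (forall i, (i < m)%N -> mdist (act (xs i) o) (act (xs i.+1) o) <= sig) ->
  exists nu : nat -> seq letter, nu 0%N = v0 /\
    (forall i, (i <= m)%N -> reduced (nu i) /\ located (ev e (nu i)) (act (xs i) o)) /\
    (forall i, (i < m)%N -> nu i.+1 = nu i \/ exists s, nu i.+1 = step (nu i) s /\
       l / 2 - D - 4 * sig <= side (ev e (nu i.+1)) (linv s) (act (xs i.+1) o) < l / 2).
Proof.
move=> rv0 lv0; elim: m => [|m IH] st.
  by exists (fun=> v0); split => //; split => // i; rewrite leqn0 => /eqP->.
have [nu [nu0 [h1 h2]]] := IH (fun i im => st i (ltnW im)).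
have [rm lm] := h1 m (leqnn m).
have [w [rw lw ad]] : exists w, [/\ reduced w, located (ev e w) (act (xs m.+1) o) &
    w = nu m \/ exists s, w = step (nu m) s /\
       l / 2 - D - 4 * sig <= side (ev e w) (linv s) (act (xs m.+1) o) < l / 2].
  have [lw|/existsNP[s /negP]] := pselect (located (ev e (nu m)) (act (xs m.+1) o)).
    by exists (nu m); split => //; left.
  rewrite -ltNge => hs; have [l1 l2] := located_step lm (st m (ltnSn m)) hs.
  exists (step (nu m) s); rewrite (ev_step He); split => //; first exact: reduced_step.
  by right; exists s; rewrite l2 hs.
exists (fun i => if (i <= m)%N then nu i else w); split; first by [].
split => [i|i im].
  by rewrite leq_eqVlt => /orP[/eqP->|im]; [rewrite ltnn|rewrite -ltnS im; apply: h1].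
have im' : (i <= m)%N by [].
rewrite im'; have [ilt|] := ltnP i m; first exact: h2.
by move=> mi; have -> : i = m by apply/eqP; rewrite eqn_leq im' mi.
Qed.

Lemma free_letter (v w : seq letter) : exists s : letter, ~~ suffix [:: s] v /\ ~~ suffix [:: s] w.
Proof.
have inj (u : seq letter) s s' : suffix [:: s] u -> suffix [:: s'] u -> s = s'.
  case: (lastP u) => [|u' a]; first by rewrite suffixs0.
  rewrite (suffix_rcons [::] u' s a) (suffix_rcons [::] u' s' a).
  by move=> /andP[/eqP-> _] /andP[/eqP-> _].
pose bad (s : letter) := suffix [:: s] v.
pose bad' (s : letter) := suffix [:: s] w.
have H (b : seq letter) : forall s s' : letter, s != s' -> ~ suffix [:: s] b \/ ~ suffix [:: s'] b.
  move=> s s' ss'; have [h|h] := pselect (suffix [:: s] b); last by left.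
  by right => h'; move: ss'; rewrite (inj _ _ _ h h') eqxx.
have [a [b [c [ab ac bc [na nb nc]]]]] := three_good (H v).
have [h|h] := H w _ _ ab; [exists a|exists b]; by split; apply/negP.
Qed.

(** A trajectory shadowing a tour of the tree through all the words of length at most [n + 1] is
    read as a walk of vertices. It is located at each such vertex when it comes near its hub. *)
Lemma cover_walk n : exists T nu be s0, [/\ walk P Bl e T nu be, ~~ suffix [:: s0] (nu 0%N) &
  forall v, reduced v -> suffix [:: s0] v -> (size v <= n)%N -> exists2 i, (i <= T)%N & nu i = v].
Proof.
pose vs := [seq v <- words (enum {: bool * bool}) n.+2 | reduced v].
have rvs v : v \in vs -> reduced v by rewrite mem_filter => /andP[].
have [L [al [L0 nal al0 _ [alA alV]]]] := tour rvs.
have [m [xs [xsP xsal xsnear]]] := shadow L0 nal.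
have [t0 t0L d0] := xsnear 0%N (leq0n m).
have [v0 [rv0 pz0]] := alA t0 t0L.
have [nu [nu0 [nuP nuS]]] := track rv0 (piece_located_near pz0 d0) (fun i im => (xsP i im).2).
have visit v : reduced v -> (size v <= n.+1)%N -> exists2 i, (i <= m)%N & nu i = v.
  move=> rv sv; have [|t tL E] := alV (hub v).
    by exists v => //=; rewrite mem_filter rv mem_words // => s _; rewrite mem_enum.
  have [i im di] := xsal t tL; exists i => //; have [ri li] := nuP i im.
  apply: (located_unique ri rv li) => s.
  have := side_lip (ev e v) s di; have := hub_side (ev e v) s base_letter.
  by rewrite E ler_norml /hub => h1 /andP[h2 _]; move: h1 h2; lrc.
(* The last time up to [i] at which the vertex changed. The trajectory is then near the middle of a
   leg at that vertex, so the colour defined from it lies in [Bl]. *)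
pose la := fix la i := if i is i'.+1 then (if nu i'.+1 == nu i' then la i' else i'.+1) else 0%N.
have la_le i : (la i <= i)%N by elim: i => //= i IH; case: ifP => // _; exact: leq_trans IH _.
have la_nu i : nu (la i) = nu i by elim: i => //= i IH; case: eqP => // ->.
have la_mono i : (la i <= la i.+1)%N by rewrite /=; case: ifP => // _; apply: leq_trans (la_le i) _.
have la_new i : (0 < la i)%N -> nu (la i) != nu (la i).-1.
  elim: i => //= i IH; case: ifPn => // h; exact: IH.
have color i : (i <= m)%N -> (0 < la i)%N -> ((ev e (nu i))^-1 * xs (la i))%g \in Bl.
  move=> im lpos; have lm : (la i <= m)%N := leq_trans (la_le i) im.
  have := la_new i lpos; rewrite -(la_nu i); move: lpos lm; case: (la i) => // j _ jm /= ne.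
  have [E|[s [E win]]] := nuS j jm; first by rewrite E eqxx in ne.
  have [t tL dt] := xsnear j.+1 jm; have [v [rv pz]] := alA t tL.
  have [rj _] := nuP j.+1 jm.
  have := piece_middle rv rj pz (s := linv s) => /(_ _) h1.
  apply: (colors (s := linv s)); rewrite (actM gact) (act_isoV gact) invgK.
  have -> : act (ev e (nu j.+1)) (leg q (k (linv s)) (l / 2)) = leg q (ev e (nu j.+1) * k (linv s))%g (l / 2).
    by rewrite /translate (actM gact).
  have sl := side_lip (ev e (nu j.+1)) (linv s) dt; rewrite ler_norml in sl.
  move: win sl => /andP[w1 w2] /andP[l1 l2].
  have := h1 ltac:(apply/andP; split; [move: w1 l1|move: w2 l2]; lrc).
  have := dist_tri (act (xs j.+1) o) (al t) (leg q (ev e (nu j.+1) * k (linv s))%g (l / 2)).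
  by rewrite (metric_sym _ (al t)); move: dt; lrc.
(* Before the first change no leg has been crossed and there is no colour. These times are dropped,
   and the letter [s0] below is chosen so that its branch contains neither [v0] nor the first vertex
   that is kept. *)
have ex : exists i, (i <= m)%N && (nu i != v0).
  have [i im Ei] := visit [::] isT isT; have [j jm Ej] := visit [:: base_letter] isT isT.
  have [v00|v00] := eqVneq v0 [::]; last by exists i; rewrite im Ei eq_sym.
  by exists j; rewrite jm Ej v00.
case: (ex_minnP ex) => i0 /andP[i0m ni0] min0.
have before i : (i < i0)%N -> nu i = v0.
  move=> ii0; apply/eqP; apply: contraT => h; have im := ltnW (leq_trans ii0 i0m).
  by have := min0 i; rewrite im h => /(_ isT); rewrite leqNgt ii0.
have i0pos : (0 < i0)%N by case: i0 ni0 {i0m min0 before} => //; rewrite nu0 eqxx.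
have la_pos i : (i0 <= i)%N -> (0 < la i)%N.
  have la0 : la i0 = i0.
    case: i0 i0pos ni0 before {i0m min0} => // j _ nj before /=.
    by rewrite (before j (ltnSn j)) (negPf nj).
  elim: i => [|i IH]; first by rewrite leqn0 => /eqP E; move: i0pos; rewrite E.
  rewrite leq_eqVlt => /orP[/eqP <-|h]; first by rewrite la0.
  by apply: leq_trans (la_mono i); apply: IH.
have [s0 [ns1 ns2]] := free_letter v0 (nu i0).
have chain i j : (i <= j)%N -> (j <= m)%N -> P ((xs i)^-1 * xs j)%g.
  elim: j => [|j IH]; first by rewrite leqn0 => /eqP-> _; rewrite mulVg; exact: HP.1.
  rewrite leq_eqVlt => /orP[/eqP-> _|ij jm]; first by rewrite mulVg; exact: HP.1.
  by have := HP.2 _ _ (IH ij (ltnW jm)) (xsP j jm).1; rewrite mulgA mulgK.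
exists (m - i0)%N, (fun j => nu (i0 + j)%N), (fun j => ((ev e (nu (i0 + j)%N))^-1 * xs (la (i0 + j)%N))%g), s0.
split; last 1 first.
- move=> v rv sv szv; have [i im Ei] := visit v rv (leqW szv).
  have ii : (i0 <= i)%N.
    rewrite leqNgt; apply/negP => /before E; move: ns1; rewrite -E Ei sv //.
  by exists (i - i0)%N; [rewrite leq_sub2r|rewrite subnKC].
- split => [j jT|j jT].
    have jm : (i0 + j <= m)%N by move: jT i0m; clear; lia.
    split; first by have [] := nuP _ jm.
    by apply: color => //; apply: la_pos; rewrite leq_addr.
  have jm : (i0 + j < m)%N by move: jT i0m; clear; lia.
  rewrite addnS; split.
    by have [->|[s [-> _]]] := nuS _ jm; [left|right; exists s].
  rewrite /prec !mulVKg; apply: chain; first exact: la_mono.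
  by apply: leq_trans (la_le _) _.
- by rewrite addn0.
Qed.
End TreeOfLegs.

Lemma central_binomial_ge (k : nat) : (4 ^ k <= (k.*2).+1 * 'C(k.*2, k))%N.
Proof.
elim: k => [|k IH] //.
have E : (k.+1 * 'C(k.+1.*2, k.+1) = 2 * (k.*2).+1 * 'C(k.*2, k))%N.
  have e1 := mul_bin_diag (k.*2).+2 k; have e2 := mul_bin_down (k.*2).+1 k.
  move: e1 e2; rewrite doubleS /= => <-; rewrite -addnn subSn ?leq_addr // addnK => e2.
  by nia.
rewrite -(leq_pmul2l (ltn0Sn k)) mulnCA E expnS doubleS.
by move: IH; move: ('C(_, _)) (4 ^ k)%N => c p IH; nia.
Qed.

(** * Return probabilities and reachable elements *)

Section Spectral.
Context {R : realType} {G : groupType}.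
Implicit Types (f g : G -> R).

(** The gap is applied to [f ^+ 2]. In the inequality between means that bounds the difference of
    two squares, the weight [e / 4] leaves half of the left-hand side after absorption. *)
Lemma nonamenable_dirichlet (T : seq G) : ~ amenable R G -> generates [set` T] ->
  exists2 e : R, 0 < e & forall f, fin_supp f ->
    exists2 s, s \in T & e * gsum (fun x => f x ^+ 2) <= gsum (fun x => (f x - f (x * s)%g) ^+ 2).
Proof.
move=> na gT; have [e e0 He] := nonamenable_gap na gT.
exists (e ^+ 2 / 4); first by rewrite divr_gt0 // exprn_gt0.
move=> f ff.
have f2 : fin_supp (fun x => f x ^+ 2) by apply: (fin_supp_map (h := fun y => y ^+ 2)) => //; rewrite expr0n.
have [|s sT h] := He _ f2; first by move=> x; exact: sqr_ge0.
exists s => //.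
have fs := fin_supp_shift s ff.
have fd : fin_supp (fun x => (f x - f (x * s)%g) ^+ 2).
  by apply: (fin_supp_op (h := fun a b => (a - b) ^+ 2)) => //; rewrite subrr expr0n.
have f2s := fin_supp_shift s f2.
have key : gsum (fun x => `|f x ^+ 2 - f (x * s)%g ^+ 2|) <=
    gsum (fun x => 2 / e * (f x - f (x * s)%g) ^+ 2 + e / 4 * (f x ^+ 2 + f (x * s)%g ^+ 2)).
  apply: gsum_le.
  - by apply: (fin_supp_op (h := fun a b => `|a ^+ 2 - b ^+ 2|)) => //; rewrite subrr normr0.
  - apply: (fin_supp_op (h := fun a b => 2 / e * (a - b) ^+ 2 + e / 4 * (a ^+ 2 + b ^+ 2))) => //.
    by rewrite subrr expr0n /= addr0 !mulr0 addr0.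
  move=> x; move: (f x) (f (x * s)%g) => a b.
  have hsq (u : R) : 0 <= u * u by rewrite -expr2 sqr_ge0.
  (* A completed square; [u = 1] and [u = -1] give the two signs of the absolute value. *)
  have E (u : R) : 2 / e * (a - b) ^+ 2 + e / 8 * (a + b) ^+ 2 + u * (a ^+ 2 - b ^+ 2) =
    2 / e * (a - b + u * e / 4 * (a + b)) ^+ 2 + e / 8 * (1 - u ^+ 2) * (a + b) ^+ 2.
    by field; rewrite gt_eqF.
  have h1 : 0 <= 2 / e * (a - b + 1 * e / 4 * (a + b)) ^+ 2.
    by rewrite mulr_ge0 ?sqr_ge0 // divr_ge0 // ltW.
  have h2 : 0 <= 2 / e * (a - b + -1 * e / 4 * (a + b)) ^+ 2.
    by rewrite mulr_ge0 ?sqr_ge0 // divr_ge0 // ltW.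
  have h3 : e / 8 * (a + b) ^+ 2 <= e / 4 * (a ^+ 2 + b ^+ 2).
    have : 0 <= e * (a - b) ^+ 2 by rewrite mulr_ge0 ?sqr_ge0 // ltW.
    by clear; lra.
  have E1 := E 1; have E2 := E (-1).
  rewrite expr1n subrr mulr0 mul0r addr0 in E1; rewrite sqrrN expr1n subrr mulr0 mul0r addr0 in E2.
  rewrite -E1 mul1r in h1; rewrite -E2 mulN1r in h2.
  rewrite ler_norml; apply/andP; move: h1 h2 h3.
  move: (2 / e * (a - b) ^+ 2) (e / 8 * (a + b) ^+ 2) (e / 4 * (a ^+ 2 + b ^+ 2)) (a ^+ 2 - b ^+ 2).
  by clear => P Q S W h1 h2 h3; split; lra.
have {}h := le_trans h key; move: h.
rewrite gsumD; [|exact: (fin_supp_map (h := fun y => 2 / e * y) (mulr0 _) fd)|]; last first.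
  by apply: (fin_supp_map (h := fun y => e / 4 * y)); rewrite ?mulr0 //;
     apply: (fin_supp_op (h := +%R)); rewrite ?addr0.
rewrite !gsumZ gsumD // (gsum_shift (fun x => f x ^+ 2) s).
set u := gsum _; set v := gsum _ => h.
have {}h : e * (e * u) <= e * (2 / e * v + e / 4 * (u + u)) by rewrite ler_wpM2l // ltW.
have E : e * (2 / e * v + e / 4 * (u + u)) = 2 * v + e ^+ 2 / 2 * u by field; rewrite gt_eqF.
rewrite E in h; move: h; clear; lra.
Qed.

Variable mu : {fsfun G -> R with 0}.
Hypothesis pmu : probability_weight mu.

Definition lazy f x : R := (f x + \sum_(s <- finsupp mu) mu s * f (x * s)%g) / 2.

Lemma fin_supp_lazy f : fin_supp f -> fin_supp (lazy f).
Proof.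
move=> ff; have h : fin_supp (fun x => \sum_(s <- finsupp mu) mu s * f (x * s)%g).
  apply: (@fin_supp_sum R G _ _ (fun s x => mu s * f (x * s)%g)) => s.
  by apply: (fin_supp_map (h := fun y => mu s * y)); rewrite ?mulr0 //; exact: fin_supp_shift.
by apply: (fin_supp_op (h := fun a b => (a + b) / 2)); rewrite ?addr0 ?mul0r.
Qed.

Lemma sqr_mean_le (F : G -> R) :
  (\sum_(s <- finsupp mu) mu s * F s) ^+ 2 <= \sum_(s <- finsupp mu) mu s * F s ^+ 2.
Proof.
have [mu0 mu1] := pmu; set m := \sum_(s <- _) _ * F s.
have : 0 <= \sum_(s <- finsupp mu) mu s * (F s - m) ^+ 2.
  by apply: sumr_ge0 => s _; rewrite mulr_ge0 ?sqr_ge0.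
have -> : \sum_(s <- finsupp mu) mu s * (F s - m) ^+ 2 =
    \sum_(s <- finsupp mu) (mu s * F s ^+ 2 - 2 * m * (mu s * F s) + m ^+ 2 * mu s).
  by apply: eq_bigr => s _; ring.
rewrite !big_split /= sumrN -!mulr_sumr mu1 -/m; clear; lra.
Qed.

Lemma seq_lower_bound (T : eqType) (l : seq T) (h : T -> R) : (forall s, s \in l -> 0 < h s) ->
  exists2 c : R, 0 < c & forall s, s \in l -> c <= h s.
Proof.
elim: l => [|s l IH] hp; first by exists 1.
have [c c0 Hc] := IH (fun t tl => hp t (mem_behead (s := s :: l) tl)).
exists (Num.min c (h s)); first by rewrite lt_min c0 hp ?mem_head.
by move=> t; rewrite inE ge_min => /orP[/eqP->|/Hc ->]; rewrite ?lexx ?orbT.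
Qed.

(** Averaging over the support alone may have norm 1, for instance when the support lies in a coset
    of an amenable subgroup; the lazy term compares [f] with each of its translates. By the
    parallelogram identity the mean of [f] and its translate by [s] loses a quarter of the Dirichlet
    form of [s], and one of these losses is comparable with the norm. *)
Lemma lazy_norm_le : ~ amenable R G -> irreducible_weight mu ->
  exists r : R, [/\ 0 < r, r < 1 & forall f, fin_supp f ->
    gsum (fun x => lazy f x ^+ 2) <= r * gsum (fun x => f x ^+ 2)].
Proof.
move=> na irr; have [mu0 mu1] := pmu; have [e e0 He] := nonamenable_dirichlet na irr.
have mup s : s \in finsupp mu -> 0 < mu s.
  by rewrite mem_finsupp => h; rewrite lt_neqAle eq_sym h mu0.
have [c c0 Hc] := seq_lower_bound mup.
pose r := Num.max (1 / 2) (1 - c * e / 4).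
exists r; split.
- by rewrite lt_max divr_gt0.
- rewrite gt_max; apply/andP; split; first by lra.
  have ce : 0 < c * e by exact: mulr_gt0.
  by move: ce; clear; lra.
move=> f ff.
have fZ (a : R) (g : G -> R) : fin_supp g -> fin_supp (fun x => a * g x).
  by apply: (fin_supp_map (h := fun y => a * y)); rewrite ?mulr0.
have fX s : fin_supp (fun x => ((f x + f (x * s)%g) / 2) ^+ 2).
  apply: (fin_supp_op (h := fun a b => ((a + b) / 2) ^+ 2)) => //; first by rewrite addr0 mul0r expr0n.
  exact: fin_supp_shift.
have f2 : fin_supp (fun x => f x ^+ 2) by apply: (fin_supp_map (h := fun y => y ^+ 2)) => //; rewrite expr0n.
have fd s : fin_supp (fun x => (f x - f (x * s)%g) ^+ 2).
  apply: (fin_supp_op (h := fun a b => (a - b) ^+ 2)) => //; first by rewrite subrr expr0n.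
  exact: fin_supp_shift.
pose N := gsum (fun x => f x ^+ 2); pose E s := gsum (fun x => (f x - f (x * s)%g) ^+ 2).
have N0 : 0 <= N by apply: gsum_ge0 => x; exact: sqr_ge0.
have E0 s : 0 <= E s by apply: gsum_ge0 => x; exact: sqr_ge0.
have par s : gsum (fun x => ((f x + f (x * s)%g) / 2) ^+ 2) = N - E s / 4.
  have fs2 : fin_supp (fun x => f (x * s)%g ^+ 2) := fin_supp_shift s f2.
  transitivity (gsum (fun x => (1 / 2 * f x ^+ 2 + 1 / 2 * f (x * s)%g ^+ 2) - 1 / 4 * (f x - f (x * s)%g) ^+ 2)).
    by apply: eq_gsum => x; field.
  rewrite gsumB ?gsumD ?gsumZ; try exact: fZ; last first.
    apply: (fin_supp_op (h := fun a b => 1 / 2 * a ^+ 2 + 1 / 2 * b ^+ 2)) => //; last exact: fin_supp_shift.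
    by rewrite expr0n /= mulr0 addr0.
  by rewrite (gsum_shift (fun x => f x ^+ 2) s) -/N -/(E s); clear; lra.
have jen : gsum (fun x => lazy f x ^+ 2) <= \sum_(s <- finsupp mu) mu s * (N - E s / 4).
  rewrite -(eq_bigr _ (fun s _ => congr1 (fun u => mu s * u) (par s))).
  under eq_bigr do rewrite -gsumZ.
  rewrite -gsum_sum; last by move=> s; exact: fZ.
  apply: gsum_le.
  - by apply: (fin_supp_map (h := fun y => y ^+ 2)); rewrite ?expr0n //; exact: fin_supp_lazy.
  - by apply: fin_supp_sum => s; exact: fZ.
  move=> x; rewrite /lazy.
  have -> : (f x + \sum_(s <- finsupp mu) mu s * f (x * s)%g) / 2 =
      \sum_(s <- finsupp mu) mu s * ((f x + f (x * s)%g) / 2).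
    transitivity (\sum_(s <- finsupp mu) (mu s * f x / 2 + mu s * f (x * s)%g / 2)).
      by rewrite big_split /= -!mulr_suml mu1 mul1r mulrDl.
    by apply: eq_bigr => s _; field.
  exact: sqr_mean_le.
apply: le_trans jen _.
have [s sT hs] := He f ff; rewrite -/N -/(E s) in hs.
have -> : \sum_(s <- finsupp mu) mu s * (N - E s / 4) = N - (\sum_(s <- finsupp mu) mu s * E s) / 4.
  transitivity (\sum_(s <- finsupp mu) (mu s * N - mu s * E s / 4)).
    by apply: eq_bigr => t _; field.
  by rewrite big_split /= sumrN -!mulr_suml mu1 mul1r.
have h1 : c * e * N <= \sum_(s <- finsupp mu) mu s * E s.
  rewrite (big_fsetD1 s) //=; apply: le_trans (_ : mu s * E s <= _); last first.
    by rewrite lerDl; apply: sumr_ge0 => t _; rewrite mulr_ge0.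
  by rewrite -mulrA; apply: ler_pM => //; [exact: ltW|rewrite mulr_ge0 // ltW|exact: Hc].
apply: le_trans (_ : (1 - c * e / 4) * N <= _); first by move: h1; clear; lra.
by rewrite ler_wpM2r // le_max lexx orbT.
Qed.

Lemma conv_pow_ge0 n (g : G) : 0 <= conv_pow mu n g.
Proof.
elim: n g => [|n IH] g /=; first by rewrite ler0n.
by apply: sumr_ge0 => h _; rewrite mulr_ge0 ?pmu.1.
Qed.

Lemma conv_pow_step n (x z : G) :
  conv_pow mu n.+1 (x^-1 * z)%g = \sum_(s <- finsupp mu) mu s * conv_pow mu n ((x * s)^-1 * z)%g.
Proof. by apply: eq_bigr => s _; rewrite invgM mulgA. Qed.

(** In the binomial expansion of the lazy walk at time [2k], the [k]-step walk has weight
    [C(2k, k) / 4^k], at least [1 / (2k + 1)]. The values of the lazy walk are bounded by its l2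
    norm, and taking [rho] between [r] and 1 absorbs the factor [2k + 1]. *)
Lemma conv_pow_exp : ~ amenable R G -> irreducible_weight mu ->
  exists C rho : R, [/\ 0 < C, 0 < rho, rho < 1 &
    forall n (g : G), conv_pow mu n g <= C * rho ^+ n].
Proof.
move=> na irr; have [r [r0 r1 Hr]] := lazy_norm_le na irr.
pose a n := iter n lazy (fun x => (x == 1%g)%:R).
have fa n : fin_supp (a n).
  elim: n => [|n IH] /=; first by exists [fset 1%g]%fset => x; rewrite inE => /negPf ->.
  exact: fin_supp_lazy.
have a2 n : gsum (fun x => a n x ^+ 2) <= r ^+ n.
  elim: n => [|n IH]; last first.
    by apply: le_trans (Hr _ (fa n)) _; rewrite exprS ler_wpM2l // ltW.
  rewrite expr0 (@gsumE _ _ [fset 1%g]%fset); first by rewrite big_seq_fset1 /= eqxx expr1n.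
  by move=> x; rewrite inE => /negPf /= ->; rewrite expr0n.
have abin n k x : 'C(n, k)%:R / 2 ^+ n * conv_pow mu k (x^-1)%g <= a n x.
  elim: n k x => [|n IH] k x.
    case: k => [|k] /=; last by rewrite bin0n mul0r mul0r ler0n.
    by rewrite bin0 expr0 divr1 mul1r invg_eq1.
  have E : a n.+1 x = (a n x + \sum_(s <- finsupp mu) mu s * a n (x * s)%g) / 2 by [].
  rewrite E; case: k => [|k].
    apply: le_trans (_ : a n x / 2 <= _); last first.
      rewrite ler_wpM2r // lerDl; apply: sumr_ge0 => s _; rewrite mulr_ge0 ?pmu.1 //.
      by apply: le_trans (IH 0%N _); rewrite mulr_ge0 ?conv_pow_ge0 ?divr_ge0 ?ler0n ?exprn_ge0.
    have -> : 'C(n.+1, 0)%:R / 2 ^+ n.+1 * conv_pow mu 0 (x^-1)%g =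
        'C(n, 0)%:R / 2 ^+ n * conv_pow mu 0 (x^-1)%g / 2.
      by rewrite !bin0 exprS invfM; ring.
    by rewrite ler_wpM2r.
  rewrite binS natrD.
  have h1 := IH k.+1 x.
  have h2 : 'C(n, k)%:R / 2 ^+ n * conv_pow mu k.+1 (x^-1)%g <=
      \sum_(s <- finsupp mu) mu s * a n (x * s)%g.
    have := conv_pow_step k x 1; rewrite mulg1 => ->; rewrite mulr_sumr.
    apply: ler_sum => s _; rewrite mulrCA ler_wpM2l ?pmu.1 //.
    by rewrite mulg1; exact: IH.
  have -> : ('C(n, k.+1)%:R + 'C(n, k)%:R) / 2 ^+ n.+1 * conv_pow mu k.+1 (x^-1)%g =
     ('C(n, k.+1)%:R / 2 ^+ n * conv_pow mu k.+1 (x^-1)%g +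
      'C(n, k)%:R / 2 ^+ n * conv_pow mu k.+1 (x^-1)%g) / 2.
    by rewrite exprS invfM; ring.
  by rewrite ler_wpM2r // lerD.
have bound k x : conv_pow mu k (x^-1)%g <= (k.*2).+1%:R * r ^+ k.
  have h := abin k.*2 k x; have c0 := conv_pow_ge0 k (x^-1)%g.
  set p := conv_pow mu k _ in h c0 *.
  have h1 : 'C(k.*2, k)%:R / 2 ^+ k.*2 * p <= r ^+ k.
    have n0 : 0 <= 'C(k.*2, k)%:R / 2 ^+ k.*2 * p.
      by rewrite mulr_ge0 ?divr_ge0 ?ler0n ?exprn_ge0.
    rewrite -(@ler_pXn2r _ 2) ?nnegrE ?exprn_ge0 ?(ltW r0) // -exprM muln2.
    apply: le_trans (a2 k.*2); apply: le_trans (_ : a k.*2 x ^+ 2 <= _); last first.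
      apply: (gsum_ge_term (f := fun x => a k.*2 x ^+ 2)) => [|y]; last exact: sqr_ge0.
      by apply: (fin_supp_map (h := fun y => y ^+ 2)); rewrite ?expr0n.
    by rewrite ler_pXn2r ?nnegrE // (le_trans n0).
  have h4 : (2 ^+ k.*2 : R) <= (k.*2).+1%:R * 'C(k.*2, k)%:R.
    have -> : (2 ^+ k.*2 : R) = (4 ^ k)%:R.
      by rewrite -mul2n exprM natrX; congr (_ ^+ _); rewrite expr2; lra.
    by rewrite -natrM ler_nat; exact: central_binomial_ge.
  have p2 : 0 < (2 ^+ k.*2 : R) by rewrite exprn_gt0.
  have h5 : p <= (k.*2).+1%:R * ('C(k.*2, k)%:R / 2 ^+ k.*2 * p).
    have h6 : 1 <= (k.*2).+1%:R * 'C(k.*2, k)%:R / 2 ^+ k.*2 :> R.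
      by rewrite ler_pdivlMr // mul1r.
    by rewrite !mulrA ler_peMl.
  by apply: le_trans h5 _; rewrite ler_wpM2l ?ler0n.
pose rho := (1 + r) / 2; pose h := rho / r - 1.
have rr : r < rho by rewrite /rho; lra.
have h0 : 0 < h by rewrite subr_gt0 ltr_pdivlMr // mul1r.
have bern m : 1 + m%:R * h <= (1 + h) ^+ m.
  elim: m => [|m IH]; first by rewrite mul0r addr0 expr0.
  rewrite exprS; apply: le_trans (_ : (1 + h) * (1 + m%:R * h) <= _).
    rewrite -natr1; have : 0 <= m%:R * h * h by rewrite !mulr_ge0 // ltW.
    by clear; lra.
  by rewrite ler_wpM2l //; move: h0; clear; lra.
exists (1 + 2 / h), rho; split; [|by rewrite /rho; lra|by rewrite /rho; lra|].
  by have : 0 < 2 / h by [exact: divr_gt0]; lra.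
move=> k g; have := bound k g^-1%g; rewrite invgK => hb; apply: le_trans hb _.
have -> : rho = r * (1 + h) by rewrite /h addrC subrK mulrC divfK // gt_eqF.
rewrite exprMn mulrCA [_ * r ^+ k]mulrC ler_wpM2l ?exprn_ge0 ?(ltW r0) //.
apply: le_trans (_ : (1 + 2 / h) * (1 + k%:R * h) <= _); last first.
  by rewrite ler_wpM2l // addr_ge0 // divr_ge0 // ltW.
have -> : (1 + 2 / h) * (1 + k%:R * h) = 1 + 2 * k%:R + 2 / h + k%:R * h.
  by field; rewrite gt_eqF.
rewrite -addnn -natr1 natrD.
have : 0 <= k%:R * h by rewrite mulr_ge0 // ltW.
have : 0 <= 2 / h by rewrite divr_ge0 // ltW.
by clear; lra.
Qed.
End Spectral.

Section Reachable.
Context {R : realType} {G : groupType}.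
Variable mu : {fsfun G -> R with 0}.
Hypothesis pmu : probability_weight mu.
Implicit Types x y z : G.

Lemma conv_powD n m x y : conv_pow mu n x * conv_pow mu m y <= conv_pow mu (n + m) (x * y)%g.
Proof.
elim: n x => [|n IH] x.
  rewrite /=; have [->|_] := eqVneq x 1%g; first by rewrite mul1r mul1g.
  by rewrite mul0r; exact: conv_pow_ge0.
rewrite addSn /= mulr_suml; apply: ler_sum => h _.
by rewrite -mulrA ler_wpM2l ?pmu.1 // mulgA; exact: IH.
Qed.

Lemma conv_pow1 x : mu x <= conv_pow mu 1 x.
Proof.
have [xs|xs] := boolP (x \in finsupp mu).
  rewrite /= (big_fsetD1 x) //= mulVg eqxx mulr1 lerDl.
  by apply: sumr_ge0 => h _; rewrite mulr_ge0 ?pmu.1.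
by rewrite fsfun_dflt //; exact: conv_pow_ge0.
Qed.

Definition reachable : set G := [set x | exists n, 0 < conv_pow mu n x].

Lemma reachable_monoid : monoid_closed reachable.
Proof.
split; first by exists 0%N; rewrite /= eqxx.
move=> x y [n hn] [m hm]; exists (n + m)%N.
by apply: lt_le_trans (conv_powD n m x y); exact: mulr_gt0.
Qed.

Lemma reachable_step x : 0 < mu x -> reachable x.
Proof. by move=> h; exists 1%N; exact: lt_le_trans (conv_pow1 x). Qed.

Lemma reachable_generates : irreducible_weight mu -> generates reachable.
Proof.
move=> irr; apply/seteqP; split => // g _ H [sH HR].
move: irr => /seteqP[_ /(_ g I)]; apply; split => // s; rewrite /= mem_finsupp => hs.
by apply: HR; apply: reachable_step; rewrite lt_neqAle eq_sym hs pmu.1.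
Qed.
End Reachable.

Section Reparam.
Context {R : realType} {X : metricType R}.
Implicit Types (q : R -> X) (x : X).

Lemma nearest_shift q a b x t : nearest (fun t => q (a + t)) 0 (b - a) x t <-> nearest q a b x (a + t).
Proof.
split=> -[h1 h2]; split.
- by move: h1; clear; lra.
- by move=> s hs; have := h2 (s - a); rewrite subrKC; apply; move: hs; clear; lra.
- by move: h1; clear; lra.
- by move=> s hs; apply: h2; move: hs; clear; lra.
Qed.

Lemma cgeod_shift D q a b : cgeod D q a b -> cgeod D (fun t => q (a + t)) 0 (b - a).
Proof.
move=> [ab gq C]; split; first by rewrite subr_ge0.
  move=> s t hs ht; rewrite gq; [|by move: hs; clear; lra|by move: ht; clear; lra].
  by congr `|_|; ring.
move=> x y s t /nearest_shift ns /nearest_shift nt h.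
by have := C _ _ _ _ ns nt h; rewrite (_ : a + s - (a + t) = s - t) //; ring.
Qed.

Lemma nearest_rev q l x t : nearest (fun t => q (l - t)) 0 l x t <-> nearest q 0 l x (l - t).
Proof.
split=> -[h1 h2]; split.
- by move: h1; clear; lra.
- by move=> s hs; have := h2 (l - s); rewrite subKr; apply; move: hs; clear; lra.
- by move: h1; clear; lra.
- by move=> s hs; apply: h2; move: hs; clear; lra.
Qed.

Lemma cgeod_rev D q l : cgeod D q 0 l -> cgeod D (fun t => q (l - t)) 0 l.
Proof.
move=> [ab gq C]; split => //.
  move=> s t hs ht; rewrite gq; [|by move: hs; clear; lra|by move: ht; clear; lra].
  by rewrite distrC; congr `|_|; ring.
move=> x y s t /nearest_rev ns /nearest_rev nt h.
by have := C _ _ _ _ ns nt h; rewrite distrC (_ : l - t - (l - s) = s - t) //; ring.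
Qed.
End Reparam.

(** * Reachability of every element *)

Section Full.
Context {R : realType} {G : groupType} {X : metricType R}.
Variables (act : G -> X -> X) (o : X) (mu : {fsfun G -> R with 0}) (S : {fset G}) (eps : R).
Hypothesis na : ~ amenable R G.
Hypothesis propX : proper_space X.
Hypothesis geoX : geodesic_space X.
Hypothesis gact : geometric_action act.
Hypothesis pmu : probability_weight mu.
Hypothesis irr : irreducible_weight mu.
Hypothesis aconst : action_constant act o mu S eps.

Ltac lrc := clear -na propX geoX gact pmu irr aconst; lra.

Let dense : nbhd_set eps [set act g o | g in setT] = setT.
Proof. by case: aconst. Qed.

Lemma mu_support s : 0 < mu s -> s \in finsupp mu.
Proof. by rewrite mem_finsupp; case: eqP => // ->; rewrite ltxx. Qed.

Lemma shadow_trajectory lam : (forall s, s \in finsupp mu -> mdist (act s o) o <= lam) ->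
  forall L alpha, 0 <= L -> nonexpanding L alpha -> exists m (xs : nat -> G),
  [/\ forall i, (i < m)%N -> reachable mu ((xs i)^-1 * xs i.+1)%g /\ mdist (act (xs i) o) (act (xs i.+1) o) <= lam,
     forall t, 0 <= t <= L -> exists2 i, (i <= m)%N & mdist (alpha t) (act (xs i) o) <= eps &
     forall i, (i <= m)%N -> exists2 t, 0 <= t <= L & mdist (alpha t) (act (xs i) o) <= eps].
Proof.
move=> Hlam L al L0 nal; have [_ _ _ sh] := aconst.
have [len Hlen] := nonexpanding_length L0 nal.
have cal : {within `[0, L], continuous al}.
  by apply: (@lipschitz_continuous _ _ _ _ _ 1) => // s t hs ht; rewrite mul1r; exact: nal.
have [g [s [tr near1 near2 _ _]]] := sh al 0 L len L0 cal Hlen.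
exists (size s), (nth 1%g (g :: s)); split.
- move=> i im; have mi := pathP 1%g tr i im; split; first exact: reachable_step.
  have -> : nth 1%g (g :: s) i.+1 = (nth 1%g (g :: s) i * ((nth 1%g (g :: s) i)^-1 * nth 1%g (g :: s) i.+1))%g.
    by rewrite mulVKg.
  by rewrite (actM gact) (act_iso gact) metric_sym; apply: Hlam; exact: mu_support.
- move=> t tL; have [|_ [h /= hs <-] d] := near1 (al t); first by exists t => //=; rewrite in_itv.
  exists (index h (g :: s)); first by rewrite -ltnS -[(size s).+1]/(size (g :: s)) index_mem.
  by rewrite nth_index.
move=> i im; have [|z [t /= tL <-] d] := near2 (act (nth 1%g (g :: s) i) o).
  by exists (nth 1%g (g :: s) i) => //=; apply: mem_nth.
by exists t; [rewrite in_itv in tL|rewrite metric_sym].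
Qed.

(** The ports [k] come from one end of the segment and the ports [ka] from the other end; [facing]
    is applied to [ka] and [g]. So [g] enters the labels [e] of the tree through one factor only,
    and the colours, which depend on [k], form a finite list that serves all [g]. *)
Lemma reachable_full D : 0 < D -> exists L0 : R, forall (q : R -> X) a b, L0 <= b - a -> geod a b q ->
  contracting D (q @` `[a, b]) -> reachable mu = setT.
Proof.
move=> D0; have e0 := eps_ge0 dense.
have [tau [Bp [tau0 Bp0 HB]]] := ports geoX propX gact dense na irr D0.
have [lam lam0 Hlam] := seq_bound (finsupp mu) (fun s => mdist (act s o) o).
pose B2 := 3 * Bp + 126 * D + 4 * (tau + eps).
pose sig := eps + lam.
have sig0 : 0 <= sig by rewrite addr_ge0.
have B20 : 0 <= B2 by rewrite /B2; move: Bp0 D0 tau0 e0; lrc.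
(* [B2] is the bound of [facing]; the extra [D] pays for comparing the chosen nearest points on the
   segment and on its reversal. *)
exists (2 * (Bp + (B2 + D) + 40 * D + 20 * sig)) => q1 a b big gq1 C1.
have ab : a <= b by move: big D0 Bp0 B20 sig0; lrc.
have CG1 := contracting_cgeod ab gq1 C1.
pose l := b - a; have l0 : 0 <= l by rewrite subr_ge0.
have [h0 hh0] := near_orbit dense (q1 a).
pose q := translate act (fun t => q1 (a + t)) h0^-1%g.
have CG : cgeod D q 0 l by apply: (cgeod_translate gact); exact: cgeod_shift.
have q0 : mdist (q 0) o <= eps.
  by rewrite /q /translate addr0 (act_isoV gact) invgK.
(* The same segment run backwards and brought back near [o]: its starts are the far ends of the
   legs. *)
have [w hw] := near_orbit dense (q l).
pose qr := translate act (fun t => q (l - t)) w^-1%g.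
have CGr : cgeod D qr 0 l by apply: (cgeod_translate gact); exact: cgeod_rev.
have qr0 : mdist (qr 0) o <= eps.
  by rewrite /qr /translate subr0 (act_isoV gact) invgK.
have [k [kt ks]] := HB q l l0 CG q0.
have [ka [kat kas]] := HB qr l l0 CGr qr0.
have [F HF] : exists F : seq G, forall b s,
    mdist (act b o) (translate act q (k s) (l / 2)) <= 2 * D + 9 * sig -> b \in F.
  have ch (s : letter) : {F : seq G | forall b,
      mdist (act b o) (translate act q (k s) (l / 2)) <= 2 * D + 9 * sig -> b \in F}.
    apply: cid; have [F HF] := disp_finite propX gact o (2 * D + 9 * sig + mdist (translate act q (k s) (l / 2)) o).
    exists F => c hc; apply: HF; apply: le_trans (dist_tri _ (translate act q (k s) (l / 2)) _) _.
    by rewrite lerD2r.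
  exists (flatten [seq sval (ch s) | s <- enum {: bool * bool}]) => c s hc.
  apply/flattenP; exists (sval (ch s)); last exact: (svalP (ch s)).
  by apply/mapP; exists s; rewrite ?mem_enum.
have key g : exists b c i j s, [/\ b \in F, c \in F &
    reachable mu ((ka i * w^-1 * (k s)^-1 * b)^-1 * g * (ka j * w^-1 * (k (linv s))^-1 * c))%g /\
    reachable mu ((ka i * w^-1 * (k s)^-1 * b)^-1 * g * (ka j * w^-1 * (k (linv s))^-1 * c))^-1%g].
  have [i [j [f1 f2]]] := facing geoX gact D0 CGr l0 Bp0 tau0 e0 kat qr0 kas g.
  rewrite -/B2 in f1 f2.
  pose y := ((ka i)^-1 * g * ka j)%g.
  pose ys (s : letter) := if s.2 then y else y^-1%g.
  (* An edge follows the leg of the port [s] to its far end, crosses there by [y] or its inverse,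
     and returns along the leg of the opposite port of the next vertex. *)
  pose e (s : letter) := (k s * w * ys s * w^-1 * (k (linv s))^-1)%g.
  have He s : e (linv s) = (e s)^-1%g.
    rewrite /e linvK !invgM !invgK !mulgA; congr (_ * _ * _ * _ * _)%g.
    by rewrite /ys /=; case: s.2 => //=; rewrite invgK.
  have qE t : q t = act w (qr (l - t)).
    by rewrite /qr /translate subKr (actVK gact).
  have yproj s t : 0 <= t <= l -> cp qr 0 l (act (ys s) (qr t)) <= B2.
    move=> tl; rewrite /ys; case: s.2.
      have := f1 t tl; rewrite (cp_translate gact) /translate.
      by rewrite -(actM gact) mulgA.
    have := f2 t tl; rewrite (cp_translate gact) /translate.
    by rewrite -(actM gact) /y !invgM invgK !mulgA.
  have F2 s t : 0 <= t <= l ->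
      l - (B2 + D) <= cp (translate act q (k s)) 0 l (translate act q (e s * k (linv s))%g t).
    move=> tl; rewrite (cp_translate gact) /translate -(actM gact) /e.
    have -> : ((k s)^-1 * (k s * w * ys s * w^-1 * (k (linv s))^-1 * k (linv s)) = w * (ys s * w^-1))%g.
      by rewrite mulgVK -!mulgA mulKg.
    set x := act _ _.
    have ltl : 0 <= l - t <= l by move: tl; lrc.
    have nx : nearest qr 0 l (act w^-1%g x) (l - cp q 0 l x).
      rewrite /qr; apply/(nearest_translate gact); rewrite invgK (actVK gact).
      by apply/nearest_rev; rewrite subKr; exact: cp_nearest CG x.
    have := nearest_cp CGr nx; have := yproj s _ ltl.
    have -> : act (ys s) (qr (l - t)) = act w^-1%g x.
      by rewrite /x qE -!(actM gact) !mulgA mulVg mul1g mulgVK.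
    rewrite ler_norml => h1 /andP[_ h2].
    by move: h1 h2; lrc.
  have B2D0 : 0 <= B2 + D by rewrite addr_ge0 // ltW.
  have colors b0 s : mdist (act b0 o) (translate act q (k s) (l / 2)) <= 2 * D + 9 * sig -> b0 \in F by exact: HF.
  have sh L alpha : 0 <= L -> nonexpanding L alpha -> exists m (xs : nat -> G),
    [/\ forall i, (i < m)%N -> reachable mu ((xs i)^-1 * xs i.+1)%g /\ mdist (act (xs i) o) (act (xs i.+1) o) <= sig,
     forall t, 0 <= t <= L -> exists2 i, (i <= m)%N & mdist (alpha t) (act (xs i) o) <= sig &
     forall i, (i <= m)%N -> exists2 t, 0 <= t <= L & mdist (alpha t) (act (xs i) o) <= sig].
    move=> L0 nal; have [m [xs [h1 h2 h3]]] := shadow_trajectory Hlam L0 nal.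
    exists m, xs; split.
    - by move=> u um; have [? hd] := h1 u um; split => //; apply: le_trans hd _; rewrite lerDr.
    - by move=> t tL; have [u um hd] := h2 t tL; exists u => //; apply: le_trans hd _; rewrite lerDl.
    - by move=> u um; have [t tL hd] := h3 u um; exists t => //; apply: le_trans hd _; rewrite lerDl.
  have cov := cover_walk geoX gact D0 CG He ks F2 Bp0 B2D0 sig0 big (reachable_monoid pmu) colors sh.
  have [b0 [c0 [bF cF P1 P2]]] := exists_cycle (reachable_monoid pmu) He cov (true, true).
  exists b0, c0, i, j, (true, true); split => //.
  have E : ((ka i * w^-1 * (k (true, true))^-1 * b0)^-1 * g * (ka j * w^-1 * (k (linv (true, true)))^-1 * c0) =
     b0^-1 * e (true, true) * c0)%g.
    by rewrite /e /ys /y /= !invgM !invgK !mulgA.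
  by rewrite E.
pose lets := enum {: bool * bool}.
pose Ls := [seq ((ka p.1.1 * w^-1 * (k p.2)^-1 * r.1)%g, (ka p.1.2 * w^-1 * (k (linv p.2))^-1 * r.2)%g) |
  p <- [seq (u, s) | u <- [seq (i, j) | i <- lets, j <- lets], s <- lets],
  r <- [seq (b0, c0) | b0 <- F, c0 <- F]].
apply: (monoid_double_cosets (L := Ls) (reachable_monoid pmu) (reachable_generates pmu irr)).
move=> g; have [b0 [c0 [i [j [s [bF cF P12]]]]]] := key g.
exists ((ka i * w^-1 * (k s)^-1 * b0)%g, (ka j * w^-1 * (k (linv s))^-1 * c0)%g) => //.
apply/allpairsP; exists ((i, j, s), (b0, c0)); split => //=.
  apply/allpairsP; exists ((i, j), s); split => //=; last by rewrite mem_enum.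
  by apply/allpairsP; exists (i, j); split => //=; rewrite mem_enum.
by apply/allpairsP; exists (b0, c0).
Qed.
End Full.

(** * Good points *)

Section Pieces.
Context {R : realType}.
Implicit Types (p : R * R) (ps : seq (R * R)).

Definition wf ps : Prop := (forall p, p \in ps -> p.1 <= p.2) /\ sorted (fun p q => p.2 < q.1) ps.

Lemma wf_behead p ps : wf (p :: ps) -> wf ps.
Proof.
move=> [h1 h2]; split; first by move=> q qs; apply: h1; rewrite inE qs orbT.
exact: path_sorted h2.
Qed.

Lemma wf_later p ps : wf (p :: ps) -> forall q, q \in ps -> p.2 < q.1.
Proof.
elim: ps p => [|p' ps IH] p w q //; have [h1 /= /andP[pp' _]] := w.
rewrite inE => /orP[/eqP->//|qs]; apply: lt_trans pp' _.
apply: le_lt_trans (IH p' (wf_behead w) q qs).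
by apply: h1; rewrite !inE eqxx orbT.
Qed.

Lemma wf_cons p ps : p.1 <= p.2 -> wf ps -> (forall q, q \in ps -> p.2 < q.1) -> wf (p :: ps).
Proof.
move=> pp [h1 h2] later; split; first by move=> q; rewrite inE => /orP[/eqP->|/h1].
by case: ps h1 h2 later => //= p' ps _ -> h; rewrite h ?mem_head.
Qed.

Lemma wf_filter (P : pred (R * R)) ps : wf ps -> wf [seq p <- ps | P p].
Proof.
elim: ps => //= p ps IH w; have w' := wf_behead w; case: ifP => _; last exact: IH.
apply: wf_cons; [by apply: w.1; exact: mem_head|exact: IH|].
by move=> q; rewrite mem_filter => /andP[_]; exact: wf_later.
Qed.

Lemma wf_cat ps qs m : wf ps -> wf qs -> (forall p, p \in ps -> p.2 <= m) ->
  (forall q, q \in qs -> m < q.1) -> wf (ps ++ qs).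
Proof.
move=> + wq + hq; elim: ps => //= p ps IH wp hp.
apply: wf_cons; first by apply: wp.1; exact: mem_head.
  apply: IH; [exact: wf_behead wp|by move=> q qp; apply: hp; rewrite inE qp orbT].
move=> q; rewrite mem_cat => /orP[/(wf_later wp)//|/hq h].
by apply: le_lt_trans h; apply: hp; exact: mem_head.
Qed.

Lemma wf_cross ps (t : R) (p q : R * R) : wf ps -> p \in ps -> q \in ps ->
  p.1 < t < p.2 -> q.1 < t < q.2 -> p = q.
Proof.
elim: ps => // r ps IH w; rewrite !inE => /orP[/eqP->|pp] /orP[/eqP->|qp] //.
- by move=> /andP[_ h1] /andP[h2 _]; have h3 := wf_later w qp; exfalso; move: h1 h2 h3; clear; lra.
- by move=> /andP[h2 _] /andP[_ h1]; have h3 := wf_later w pp; exfalso; move: h1 h2 h3; clear; lra.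
exact: IH (wf_behead w) pp qp.
Qed.

Lemma cross_sum_le ps (t : R) (f : R * R -> R) L : 0 <= L -> wf ps ->
  (forall p, p \in ps -> f p <= L) ->
  \sum_(p <- ps | p.1 < t < p.2) f p <= L.
Proof.
move=> L0; elim: ps => [|p ps IH] w fL; first by rewrite big_nil.
rewrite big_cons; have fL' q : q \in ps -> f q <= L by move=> h; apply: fL; rewrite inE h orbT.
case: ifP => [/andP[_ tp]|_]; last exact: IH (wf_behead w) fL'.
rewrite big_seq_cond big1 ?addr0 ?fL ?mem_head // => q /andP[/(wf_later w) h /andP[h2 _]].
by lra.
Qed.

(* The mass of [s, t] is mass t - mass s. *)
Definition mass ps t : R := \sum_(p <- ps) clamp p.1 p.2 t.

Lemma mass_ge ps s t : wf ps -> s <= t -> mass ps s <= mass ps t.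
Proof.
move=> [w _] st; rewrite /mass [leLHS]big_seq [leRHS]big_seq.
by apply: ler_sum => p /w pp; exact: clamp_homo.
Qed.

Lemma mass_const ps s t : wf ps -> s <= t -> (forall p, p \in ps -> t <= p.1) ->
  mass ps t = mass ps s.
Proof.
move=> [w _] st h; apply: eq_big_seq => p pp.
by rewrite !clamp_lo ?w ?h // (le_trans st) ?h.
Qed.

Lemma mass_le ps s t : wf ps -> s <= t -> mass ps t - mass ps s <= t - s.
Proof.
elim: ps s => [|p ps IH] s w st; first by rewrite /mass !big_nil subrr subr_ge0.
have pp := w.1 p (mem_head _ _); have w' := wf_behead w.
have -> : mass (p :: ps) t - mass (p :: ps) s =
    (clamp p.1 p.2 t - clamp p.1 p.2 s) + (mass ps t - mass ps s).
  by rewrite /mass !big_cons; ring.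
have [tp|pt] := leP t p.2.
  rewrite (mass_const w' st) ?subrr ?addr0; last first.
    by move=> q qp; apply: le_trans tp (ltW (wf_later w qp)).
  exact: clamp_incr.
have [ps'|sp] := leP p.2 s.
  by rewrite !(clamp_hi pp) ?(ltW pt) // subrr add0r; exact: IH.
rewrite -(mass_const w' (ltW sp)); last by move=> q qp; exact: ltW (wf_later w qp).
have h1 := IH _ w' (ltW pt).
have := clamp_incr pp (ltW sp); rewrite (clamp_hi pp (ltW pt)) (clamp_hi pp (lexx _)).
by move: h1; lra.
Qed.
End Pieces.

(** * Indices good in both directions *)

Section Ergodic.
Context {R : realType}.
Implicit Types (h : nat -> R) (n N s u v : nat).

Definition fbad h n j : bool := [exists u : 'I_n.+1, (j < u)%N && (h u < h j)].
Definition pbad h j : bool := [exists u : 'I_j.+1, h j.+1 < h u].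

Lemma fbadI h n j u : (j < u <= n)%N -> h u < h j -> fbad h n j.
Proof.
move=> /andP[ju un] hu; apply/existsP; have un' : (u < n.+1)%N by [].
by exists (Ordinal un'); rewrite ju.
Qed.

(** Future-bad indices are grouped into blocks that end when [h] first falls below its value at the
    start, so that increments telescope to a negative amount. A block still open at [N] is left out;
    it starts at [s]. *)
Lemma fbad_sum_le0 h n N : (N <= n)%N -> exists s, [/\ (s <= N)%N,
  \sum_(0 <= j < s | fbad h n j) (h j.+1 - h j) <= 0 &
  s = N \/ (forall v, (s <= v <= N)%N -> h s <= h v) /\
           exists2 u, (N < u <= n)%N & h u < h s].
Proof.
elim: N => [|N IH] Nn; first by exists 0%N; split; [by []|rewrite big_geq|left].
have [s [sN hs cs]] := IH (ltnW Nn).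
have step : s = N \/ s <> N by case: (eqVneq s N) => [->|/eqP]; [left|right].
have {}cs : (forall v, (s <= v <= N)%N -> h s <= h v) /\ (s = N \/
    exists2 u, (N < u <= n)%N & h u < h s).
  case: cs => [->|[c1 c2]]; last by split=> //; right.
  split; last by left.
  by move=> v /andP[v1 v2]; have -> : v = N by apply/eqP; rewrite eqn_leq v1 v2.
have [c1 c2] := cs.
have [lt|ge] := ltP (h N.+1) (h s).
  exists N.+1; split=> //; last by left.
  rewrite (@big_cat_nat _ _ _ s) //=; last exact: leqW.
  have -> : \sum_(s <= j < N.+1 | fbad h n j) (h j.+1 - h j) = h N.+1 - h s.
    rewrite -telescope_sumr; last exact: leqW.
    rewrite big_nat_cond [RHS]big_nat; apply: eq_bigl => j.
    case: (boolP (s <= j < N.+1)%N) => //= /andP[j1 j2].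
    rewrite (@fbadI _ _ _ N.+1) ?j2 //.
    by apply: lt_le_trans lt _; apply: c1; rewrite j1 -ltnS.
  by move: hs lt; lra.
have c1' v : (s <= v <= N.+1)%N -> h s <= h v.
  move=> /andP[v1]; rewrite leq_eqVlt => /orP[/eqP->//|v2].
  by apply: c1; rewrite v1 -ltnS.
have [[u /andP[u1 u2] hu]|no] := pselect (exists2 u, (N < u <= n)%N & h u < h s).
  exists s; split => //; first exact: leqW.
  right; split => //; exists u => //; rewrite u2 andbT ltn_neqAle u1 andbT.
  by apply: contraTneq hu => <-; rewrite -leNgt.
have sN' : s = N by case: c2.
exists N.+1; split=> //; last by left.
rewrite big_mkcond big_nat_recr //= -big_mkcond /= -sN'.
case: ifP => [|_]; last by rewrite addr0.
rewrite /fbad => /existsP[u /andP[u1 u2]]; case: no.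
by exists (u : nat) => //; rewrite -sN' u1 -ltnS ltn_ord.
Qed.

(** At an index that is not past-bad [h] reaches a new maximum; by induction the sum over the others
    is at most the current drop below the running maximum. *)
Lemma pbad_sum_le0 h s : \sum_(0 <= j < s | pbad h j) (h j.+1 - h j) <= 0.
Proof.
suff [u [us mu le]] : exists u, [/\ (u <= s)%N, forall v, (v <= s)%N -> h v <= h u &
    \sum_(0 <= j < s | pbad h j) (h j.+1 - h j) <= h s - h u].
  by apply: le_trans le _; rewrite subr_le0 mu.
elim: s => [|s [u [us mu le]]].
  by exists 0%N; split => // [v|]; [rewrite leqn0 => /eqP->|rewrite big_geq // subrr].
rewrite big_mkcond big_nat_recr //= -big_mkcond /=.
case: ifP => [|nb].
  rewrite /pbad => /existsP[v hv].
  have hu : h s.+1 < h u by apply: lt_le_trans hv _; apply: mu; rewrite -ltnS ltn_ord.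
  exists u; split; [exact: leqW| |by move: le; lra].
  by move=> w; rewrite leq_eqVlt ltnS => /orP[/eqP->|/mu//]; exact: ltW.
exists s.+1; split => // [v|].
  rewrite leq_eqVlt => /orP[/eqP->//|vs]; rewrite leNgt; apply/negP => hv.
  by move/negbT/negP: nb; apply; apply/existsP; exists (Ordinal vs).
by have := mu s (leqnn s); move: le; lra.
Qed.

(* [i] is neither future-bad nor past-bad for the walk [H k - kappa k].  The two
   families of bad indices carry increments of [H] of total at most
   [2 kappa s], and the remaining density [beta - 2 kappa] forces a good index. *)
Lemma balanced_index (kappa beta C : R) (M : nat) : 0 <= kappa -> 2 * kappa < beta ->
  exists N, forall (H : nat -> R) n, (N <= n)%N ->
  (forall k, 0 <= H k.+1 - H k <= 1) ->
  (forall k, (k <= n)%N -> beta * k%:R - C <= H k - H 0%N) ->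
  exists i, [/\ (M <= i < N)%N,
    forall u, (i < u <= n)%N -> kappa * (u%:R - i%:R) <= H u - H i &
    forall u, (u <= i)%N -> kappa * (i.+1%:R - u%:R) <= H i.+1 - H u].
Proof.
move=> k0 kb.
pose s0 := `|(C + M%:R) / (beta - 2 * kappa)|.
have d0 : 0 < beta - 2 * kappa by lra.
pose N := Num.bound (s0 + (`|C| + s0) / (beta - kappa)).
have s00 : 0 <= s0 by exact: normr_ge0.
have e0 : 0 < beta - kappa by move: k0 kb; clear; lra.
have q0 : 0 <= (`|C| + s0) / (beta - kappa).
  by apply: divr_ge0; [exact: addr_ge0|exact: ltW].
have NB : s0 + (`|C| + s0) / (beta - kappa) < N%:R.
  by apply: archi_boundP; rewrite addr_ge0 // q0.
exists N; move=> H n Nn H01 Hb.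
pose h k := H k - kappa * k%:R.
have [s [sN fs cs]] := fbad_sum_le0 h Nn.
have Hinc u v : (u <= v)%N -> 0 <= H v - H u <= v%:R - u%:R.
  move=> uv; rewrite -(telescope_sumr H uv) -(telescope_sumr (fun k => k%:R : R) uv).
  apply/andP; split; first by apply: sumr_ge0 => k _; case/andP: (H01 k).
  by apply: ler_sum => k _; rewrite -natr1 addrAC subrr add0r; case/andP: (H01 k).
(* If a block is open at [s], then [h u < h s] for some [u] beyond [N]. As [H] has grown by at least
   [beta * u - C] at [u] and by at most [s] at [s], this forces [s] to be large. *)
have ss : s0 < s%:R.
  case: cs => [->|[_ [u /andP[u1 u2]]]].
    apply: le_lt_trans NB; by rewrite lerDl.
  rewrite /h => hu; have h1 := Hb u u2.
  have /andP[_ h2] := Hinc 0%N s isT.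
  have h3 : N%:R < u%:R :> R by rewrite ltr_nat.
  have h4 : `|C| + s0 < (beta - kappa) * u%:R.
    rewrite mulrC -ltr_pdivrMr //; apply: lt_trans h3; apply: le_lt_trans NB.
    by rewrite lerDr.
  have := ler_norm C; have : 0 <= kappa * s%:R by rewrite mulr_ge0.
  by move: h1 h2 h4 hu; rewrite subr0; lra.
have sn := leq_trans sN Nn.
have := Hb s sn; rewrite -(telescope_sumr H (leq0n s)) => tot.
have [noti|ex] := pselect (exists2 i, (M <= i < s)%N & ~~ (fbad h n i || pbad h i)); last first.
  exfalso; move: tot; apply/negP; rewrite -ltNge.
  have b1 : \sum_(0 <= j < s) (H j.+1 - H j) <= \sum_(0 <= j < s | fbad h n j) (H j.+1 - H j)
     + \sum_(0 <= j < s | pbad h j) (H j.+1 - H j) + \sum_(0 <= j < s | (j < M)%N) (H j.+1 - H j).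
    rewrite (big_mkcond (fbad h n)) (big_mkcond (pbad h)) (big_mkcond (fun j => (j < M)%N)) /=.
    rewrite -!big_split /= !big_nat; apply: ler_sum => j js.
    have /andP[a0 _] := H01 j.
    case: (ltnP j M) => jM.
      by case: ifP; case: ifP => _ _; rewrite ?addr0 ?add0r //; move: a0; lra.
    case: ifP => f1; first by case: ifP => _; move: a0; lra.
    case: ifP => f2; first by rewrite add0r addr0.
    by case: ex; exists j; rewrite ?jM ?(andP js).2 // f1 f2.
  have b2 (P : pred nat) : \sum_(0 <= j < s | P j) (h j.+1 - h j) <= 0 ->
      \sum_(0 <= j < s | P j) (H j.+1 - H j) <= kappa * s%:R.
    move=> hP; have -> : \sum_(0 <= j < s | P j) (H j.+1 - H j) =
      \sum_(0 <= j < s | P j) (h j.+1 - h j) + \sum_(0 <= j < s | P j) kappa.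
      by rewrite -big_split; apply: eq_bigr => j _; rewrite /h -natr1 /=; ring.
    rewrite -[leRHS]add0r; apply: lerD => //.
    rewrite big_mkcond; apply: (@le_trans _ _ (\sum_(0 <= j < s) kappa)).
      by apply: ler_sum => j _; case: ifP.
    by rewrite sumr_const_nat subn0 mulr_natr.
  have b3 : \sum_(0 <= j < s | (j < M)%N) (H j.+1 - H j) <= M%:R.
    apply: (@le_trans _ _ (\sum_(0 <= j < s | (j < M)%N) 1)).
      by apply: ler_sum => j _; case/andP: (H01 j).
    suff: \sum_(0 <= j < s | (j < M)%N) 1 <= (minn s M)%:R :> R.
      by move=> h1; apply: le_trans h1 _; rewrite ler_nat geq_minr.
    rewrite big_mkcond /=; elim: (s) => [|q IH]; first by rewrite big_geq.
    rewrite big_nat_recr //=; case: ifP => qM.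
      by apply: le_trans (lerD IH (lexx 1)) _; rewrite natr1 ler_nat; move: qM; clear; lia.
    by rewrite addr0; apply: le_trans IH _; rewrite ler_nat; clear; lia.
  have b4 : C + M%:R < (beta - 2 * kappa) * s%:R.
    rewrite mulrC -ltr_pdivrMr //; apply: le_lt_trans ss; exact: ler_norm.
  have c1 := b2 _ fs; have c2 := b2 _ (pbad_sum_le0 h s).
  by move: b1 c1 c2 b3 b4; lra.
have [i /andP[Mi is'] /norP[nf np]] := noti.
exists i; split; first by rewrite Mi (leq_trans is').
  move=> u iu; have : h i <= h u.
    by rewrite leNgt; apply: contra nf => hu; exact: fbadI hu.
  by rewrite /h; lra.
move=> u ui; have : h u <= h i.+1.
  rewrite leNgt; apply: contra np => hu; apply/existsP.
  by exists (Ordinal (ui : (u < i.+1)%N)).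
by rewrite /h; lra.
Qed.
End Ergodic.

(** * Mass of near-optimal decompositions *)

Section Decompositions.
Context {R : realType} {X : metricType R}.
Hypothesis geoX : geodesic_space X.
Implicit Types (ps qs : seq (R * R)) (gamma : R -> X).

Lemma decomposition_wf D L gamma a b ps : decomposition D L gamma a b ps -> wf ps.
Proof. by move=> [h1 h2]; split => // p /h1[]. Qed.

Lemma pieces_length_mass a b ps : (forall p, p \in ps -> [/\ a <= p.1, p.1 <= p.2 & p.2 <= b]) ->
  pieces_length ps = mass ps b - mass ps a.
Proof.
move=> h; rewrite /mass -sumrB; apply: eq_big_seq => p /h[h1 h2 h3].
by rewrite clamp_hi // clamp_lo.
Qed.

Lemma pieces_length_ge0 D L gamma a b ps : decomposition D L gamma a b ps -> 0 <= pieces_length ps.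
Proof.
by move=> [h _]; rewrite /pieces_length big_seq; apply: sumr_ge0 => p /h[_ h1 _ _ _]; rewrite subr_ge0.
Qed.

Lemma pieces_length_le D L gamma a b ps : a <= b -> decomposition D L gamma a b ps ->
  pieces_length ps <= b - a.
Proof.
move=> ab dec; have w := decomposition_wf dec; case: dec => h _.
by rewrite (@pieces_length_mass a b) ?mass_le // => p /h[].
Qed.

Lemma contrP D L gamma a b : a <= b -> exists ps,
  [/\ decomposition D L gamma a b ps, contr D L gamma a b = pieces_length ps &
   forall qs, decomposition D L gamma a b qs -> pieces_length qs <= contr D L gamma a b + 1].
Proof.
move=> ab; pose E := [set pieces_length ps | ps in decomposition D L gamma a b].
have d0 : decomposition D L gamma a b [::] by split.
have supE : has_sup E.
  split; first by exists (pieces_length [::]); exists [::].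
  by exists (b - a) => _ [ps dec <-]; exact: pieces_length_le dec.
have [_ [ps dec <-] hps] := sup_adherent ltr01 supE.
have opt : near_optimal D L gamma a b ps.
  split => // qs dq; rewrite -lerBlDr; apply: le_trans (ltW hps).
  by rewrite lerD2r; apply: (sup_upper_bound supE); exists qs.
have [d1 d2] := xgetI [::] opt.
by exists (xget [::] (near_optimal D L gamma a b)).
Qed.

Lemma sorted_filter_map ps (P : pred (R * R)) (f : R * R -> R * R) : wf ps ->
  (forall p, p \in ps -> p.1 <= (f p).1 /\ (f p).2 <= p.2) ->
  sorted (fun p q : R * R => p.2 < q.1) [seq f p | p <- ps & P p].
Proof.
move=> w h; have {}h p : p \in [seq p <- ps | P p] -> p.1 <= (f p).1 /\ (f p).2 <= p.2.
  by rewrite mem_filter => /andP[_ /h].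
have {w} := wf_filter P w; move: [seq p <- ps | P p] h => qs h [_].
elim: qs h => //= p qs IH h.
have {}IH : sorted (fun p q : R * R => p.2 < q.1) qs ->
    sorted (fun p q : R * R => p.2 < q.1) [seq f p | p <- qs].
  by apply: IH => q qs'; apply: h; rewrite inE qs' orbT.
case: qs h IH => //= q qs h IH /andP[pq /IH ->]; rewrite andbT.
have [_ h1] := h p (mem_head _ _).
have [|h2 _] := h q; first by rewrite !inE eqxx orbT.
exact: le_lt_trans h1 (lt_le_trans pq h2).
Qed.

(** Cut the pieces to the window and keep those of length at least [L]. A nonempty piece that gets
    lost has an end of the window in its interior; there are at most two of them, each costing at
    most [L]. *)
Lemma contr_trim D L gamma a b ps s t : 0 < D -> 0 < L -> geod a b gamma ->
  decomposition D L gamma a b ps -> s <= t ->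
  mass ps t - mass ps s - 2 * L <= contr (10 * D) L gamma s t + 1.
Proof.
move=> D0 L0 gg dec st; have w := decomposition_wf dec; case: dec => dec _.
have [_ [_ _ opt]] := contrP (10 * D) L gamma st.
pose d (p : R * R) := clamp p.1 p.2 t - clamp p.1 p.2 s.
pose qs := [seq (clamp p.1 p.2 s, clamp p.1 p.2 t) | p <- ps & L <= d p].
have hd p : p \in ps -> [/\ 0 <= d p, p.1 <= clamp p.1 p.2 s, clamp p.1 p.2 t <= p.2 &
    0 < d p -> s <= clamp p.1 p.2 s /\ clamp p.1 p.2 t <= t].
  move=> /dec[_ pp _ _ _]; rewrite /d.
  have /andP[-> _] := clamp_in s pp; have /andP[_ ->] := clamp_in t pp.
  split=> //; first by rewrite subr_ge0 clamp_homo.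
  have /andP[h1 h2] := clamp_in s pp; have /andP[h3 h4] := clamp_in t pp.
  by have [[/andP[? ?] E1]|[? E1]|[? E1]] := clampP s pp;
    have [[/andP[? ?] E2]|[? E2]|[? E2]] := clampP t pp; rewrite E1 E2 => h; split; lra.
apply: (@le_trans _ _ (pieces_length qs)); last first.
  apply: opt; split; last first.
    by apply: sorted_filter_map => // p /hd[_ h1 h2 _].
  move=> q /mapP[p]; rewrite mem_filter => /andP[Lp pp] -> /=.
  have [h0 h1 h2 h3] := hd p pp; have [h4 h5] := h3 (lt_le_trans L0 Lp).
  have [a1 a2 a3 a4 a5] := dec p pp.
  have h6 : clamp p.1 p.2 s <= clamp p.1 p.2 t by exact: clamp_homo.
  split=> //; apply: (contracting_sub geoX D0 h1 h6 h2 _ a5).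
  exact: geodW gg.
have -> : pieces_length qs = \sum_(p <- ps | L <= d p) d p.
  by rewrite /pieces_length big_map big_filter.
have -> : mass ps t - mass ps s = \sum_(p <- ps) d p by rewrite /mass -sumrB.
rewrite (bigID (fun p => L <= d p)) /= -addrA gerDl.
pose f p := if L <= d p then 0 else d p.
have fL p : p \in ps -> f p <= L.
  by move=> pp; rewrite /f; case: (leP L (d p)) => h; exact: ltW.
have f0 p : p \in ps -> 0 <= f p.
  by move=> /hd[h _ _ _]; rewrite /f; case: ifP.
have c1 := cross_sum_le s (ltW L0) w fL; have c2 := cross_sum_le t (ltW L0) w fL.
suff : \sum_(p <- ps | ~~ (L <= d p)) d p <=
    \sum_(p <- ps | p.1 < s < p.2) f p + \sum_(p <- ps | p.1 < t < p.2) f p by move: c1 c2; lra.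
rewrite [leLHS]big_mkcond [X in _ <= X + _]big_mkcond [X in _ <= _ + X]big_mkcond -big_split /= !big_seq; apply: ler_sum => p pp.
have := f0 p pp; rewrite /f; case: ifP => Lp /= d0.
  by rewrite !if_same addr0.
case: ifP => c3; first by case: ifP => _; rewrite lerDl.
case: ifP => c4; first by rewrite add0r.
rewrite addr0 /d; have [_ h1 _ h3 _] := dec p pp.
have out u : (p.1 < u < p.2) = false -> clamp p.1 p.2 u = p.1 \/ clamp p.1 p.2 u = p.2.
  move=> /negbT; rewrite negb_and -!leNgt => /orP[h|h].
    by left; exact: clamp_lo.
  by right; exact: clamp_hi.
move: Lp; rewrite /d; have [->|->] := out s c3; have [->|->] := out t c4; rewrite ?subrr //.
  by rewrite h3.
by rewrite subr_le0.
Qed.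

(** Otherwise the part of [ps] before [s] could be replaced by a near-optimal decomposition of
    [[0, m]], with [m] just below [s], which would gain more than 1. *)
Lemma mass_lower_uncrossed D L gamma n ps beta C s : 0 <= beta <= 1 -> 0 <= C ->
  (forall m : nat, beta * m%:R - C <= contr D L gamma 0 m%:R) ->
  decomposition D L gamma 0 n%:R ps ->
  (forall qs, decomposition D L gamma 0 n%:R qs -> pieces_length qs <= pieces_length ps + 1) ->
  0 <= s <= n%:R -> (forall p, p \in ps -> ~~ (p.1 < s < p.2)) ->
  beta * s - C - 2 <= mass ps s - mass ps 0.
Proof.
move=> /andP[b0 b1] C0 hc dec opt /andP[s0 sn] uncr; have w := decomposition_wf dec.
have := s0; rewrite le_eqVlt => /orP[/eqP<-|sp].
  by rewrite mulr0 subrr; move: C0; clear; lra.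
(* [m] is strictly below [s], so that the new decomposition keeps a gap before the pieces starting
   at [s]. *)
have [m [ms sm]] : exists m : nat, m%:R < s /\ s <= m%:R + 1.
  have /andP[h1 h2] := truncn_itv s0; move: h1; rewrite le_eqVlt => /orP[/eqP h1|h1]; last first.
    by exists (Num.truncn s); split => //; rewrite natr1 ltW.
  case E : (Num.truncn s) h1 => [|m] h1; first by move: sp; rewrite -h1 ltxx.
  by exists m; split; rewrite -?h1 -?natr1 // ltrDl.
have m0 : (0 : R) <= m%:R by [].
have [As [dA cA _]] := contrP D L gamma m0.
have wA := decomposition_wf dA.
pose qs := [seq p <- ps | s <= p.1].
have dq : decomposition D L gamma 0 n%:R (As ++ qs).
  split; last first.
    apply: (proj2 (@wf_cat _ _ _ m%:R wA (wf_filter _ w) _ _)); first by move=> p /(proj1 dA)[].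
    by move=> p; rewrite mem_filter => /andP[h _]; apply: lt_le_trans h.
  move=> p; rewrite mem_cat => /orP[/(proj1 dA)[h1 h2 h3 h4 h5]|].
    by split=> //; apply: le_trans h3 _; move: ms sn; clear; lra.
  by rewrite mem_filter => /andP[_ /(proj1 dec)].
have := opt _ dq; rewrite /pieces_length big_cat /= -/(pieces_length As) -cA big_filter.
rewrite [X in _ <= X + 1](bigID (fun p : R * R => s <= p.1)) /= => le1.
have -> : mass ps s - mass ps 0 = \sum_(p <- ps | ~~ (s <= p.1)) (p.2 - p.1).
  rewrite /mass -sumrB [RHS]big_mkcond /=; apply: eq_big_seq => p pp.
  have [p0 p12 _ _ _] := proj1 dec p pp; rewrite (clamp_lo p12 p0).
  case: ifP => [|/negbFE h]; last by rewrite clamp_lo // subrr.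
  by rewrite -ltNge => h; have := uncr p pp; rewrite h /= -leNgt => h2; rewrite clamp_hi.
have := hc m; have : beta * s <= beta * m%:R + 1.
  have : beta * s <= beta * (m%:R + 1) by rewrite ler_wpM2l.
  by move: b1; clear; lra.
by move: le1; clear; lra.
Qed.

(** If a piece crosses [s], go back to its start, which no piece crosses: in between, the mass grows
    at full rate, hence at rate at least [beta]. *)
Lemma mass_lower D L gamma n ps beta C s : 0 <= beta <= 1 -> 0 <= C ->
  (forall m : nat, beta * m%:R - C <= contr D L gamma 0 m%:R) ->
  decomposition D L gamma 0 n%:R ps ->
  (forall qs, decomposition D L gamma 0 n%:R qs -> pieces_length qs <= pieces_length ps + 1) ->
  0 <= s <= n%:R -> beta * s - C - 2 <= mass ps s - mass ps 0.
Proof.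
move=> b01 C0 hc dec opt s0n; have w := decomposition_wf dec.
have unc := mass_lower_uncrossed b01 C0 hc dec opt.
have [[p pp c1]|no] := pselect (exists2 p, p \in ps & p.1 < s < p.2); last first.
  by apply: unc => // p pp; apply/negP => h; case: no; exists p.
have /andP[p1s sp2] := c1; have [p0 p12 pn _ _] := proj1 dec p pp.
have h1 : beta * p.1 - C - 2 <= mass ps p.1 - mass ps 0.
  apply: unc; first by rewrite p0 (le_trans p12).
  move=> q qp; apply/negP => c2.
  have [t [t1 t2 t3 t4]] : exists t, [/\ p.1 < t, t < p.2, q.1 < t & t < q.2].
    have /andP[q1 q2] := c2; exists ((p.1 + Num.min p.2 q.2) / 2).
    have m1 : p.1 < Num.min p.2 q.2 by rewrite lt_min q2 (lt_trans p1s).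
    have m2 : Num.min p.2 q.2 <= p.2 by rewrite ge_min lexx.
    have m3 : Num.min p.2 q.2 <= q.2 by rewrite ge_min lexx orbT.
    by move: m1 m2 m3 q1 q2; clear; split; lra.
  have E : p = q by apply: (@wf_cross _ ps t) => //; apply/andP.
  by move: c2; rewrite -E ltxx.
have h2 : s - p.1 <= mass ps s - mass ps p.1.
  rewrite /mass -sumrB (perm_big _ (perm_to_rem pp)) big_cons /=.
  rewrite (clamp_lo p12 (lexx _)) (clamp_id (t := s)) ?(ltW p1s) ?(ltW sp2) //.
  rewrite lerDl big_seq; apply: sumr_ge0 => q /mem_rem qp.
  by rewrite subr_ge0 clamp_homo ?w.1 // ltW.
have : 0 <= (1 - beta) * (s - p.1).
  by case/andP: b01 => b0 b1; apply: mulr_ge0; rewrite subr_ge0 // ltW.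
by move: h1 h2; clear; lra.
Qed.

Lemma contr_lower theta beta D L gamma : beta < theta -> 0 <= beta ->
  (theta%:E <= limn_einf (fun n : nat => (contr D L gamma 0 n%:R / n%:R)%:E))%E ->
  exists2 C, 0 <= C & forall m : nat, beta * m%:R - C <= contr D L gamma 0 m%:R.
Proof.
move=> bt b0; rewrite limn_einf_lim (cvg_lim _ (@cvg_einfs_sup _ _)) // => h.
have [_ [n0 _ <-] hn] : exists2 y, range (einfs (fun n : nat => (contr D L gamma 0 n%:R / n%:R)%:E)) y &
    (beta%:E < y)%E by apply: ereal_sup_gt; apply: lt_le_trans h; rewrite lte_fin.
exists (beta * n0%:R) => [|m]; first exact: mulr_ge0.
have c0 : 0 <= contr D L gamma 0 m%:R.
  by have [ps [dec -> _]] := contrP D L gamma (ler0n R m); exact: pieces_length_ge0 dec.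
have [mn|nm] := leqP m n0.
  by apply: le_trans c0; rewrite subr_le0 ler_wpM2l // ler_nat.
have : (beta%:E < (contr D L gamma 0 m%:R / m%:R)%:E)%E.
  apply: lt_le_trans hn _; apply: ereal_inf_lbound.
  by exists m => //; exact: ltnW.
rewrite lte_fin ltr_pdivlMr; last by rewrite ltr0n (leq_trans _ nm).
have : 0 <= beta * n0%:R by exact: mulr_ge0.
by clear; lra.
Qed.

(** [5/6 * theta] is a density below [theta] and exceeds twice the rate [theta / 3] demanded on each
    side. A window then loses 1 by rounding to integers, [2 * L] by cutting and 1 by
    near-optimality; beyond the given radius, [theta / 12] of its length covers these losses. *)
Lemma good_points_at theta D L gamma (M : nat) : 0 < D -> 0 < L -> 0 < theta <= 1 ->
  prop_contracting_ray theta D L gamma ->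
  exists2 t, M%:R <= t & good_point (theta / 4) (12 * (2 * L + 2) / theta) (10 * D) L gamma t.
Proof.
move=> D0 L0 /andP[t0 t1] [gg hlim _].
have [||C C0 hC] := contr_lower (beta := 5 / 6 * theta) _ _ hlim; [by lra|by lra|].
have b01 : 0 <= 5 / 6 * theta <= 1 by apply/andP; split; lra.
have [||N hN] := @balanced_index R (theta / 3) (5 / 6 * theta) (C + 2) M; [by lra|by lra|].
have ex n : exists ps, decomposition D L gamma 0 n%:R ps /\ (forall qs, decomposition D L gamma 0 n%:R qs ->
    pieces_length qs <= pieces_length ps + 1).
  have [ps [dec c1 c2]] := contrP D L gamma (ler0n R n).
  by exists ps; rewrite -c1.
pose A n := projT1 (cid (ex n)).
have Adec n : decomposition D L gamma 0 n%:R (A n) by rewrite /A; case: cid => ? [].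
have Aopt n := (projT2 (cid (ex n))).2.
pose good n i := (forall u, (i < u <= n)%N -> theta / 3 * (u%:R - i%:R) <= mass (A n) u%:R - mass (A n) i%:R) /\
    forall u, (u <= i)%N -> theta / 3 * (i.+1%:R - u%:R) <= mass (A n) i.+1%:R - mass (A n) u%:R.
have hg n : (N <= n)%N -> exists i, (M <= i < N)%N /\ good n i.
  move=> Nn; have w := decomposition_wf (Adec n).
  have [||i [Mi h1 h2]] := hN (fun k => mass (A n) k%:R) n Nn; last by exists i.
    move=> k; rewrite subr_ge0 mass_ge ?ler_nat //=.
    apply: le_trans (mass_le w _) _; first by rewrite ler_nat.
    by rewrite -natr1 addrAC subrr add0r.
  move=> k kn; have := mass_lower b01 C0 hC (Adec n) (Aopt n) (s := k%:R).
  by rewrite ler0n ler_nat kn => h; rewrite opprD addrA; exact: h isT.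
(* The range of [i] does not depend on [n], so one index is good for arbitrarily large [n]. *)
have [i [Mi hi]] : exists i, (M <= i)%N /\ forall m, exists2 n, (m <= n)%N & good n i.
  apply: contrapT => no.
  have {}no i : (M <= i < N)%N -> exists m, forall n, (m <= n)%N -> ~ good n i.
    move=> /andP[Mi _]; apply: contrapT => h; apply: no; exists i; split => // m.
    apply: contrapT => h2; apply: h; exists m => n mn gn; apply: h2; by exists n.
  pose m i := if pselect (exists m, forall n, (m <= n)%N -> ~ good n i) is left h then projT1 (cid h) else 0%N.
  have [i [Mi gi]] := hg (maxn N (\max_(i < N) m i)) (leq_maxl _ _).
  have iN : (i < N)%N by case/andP: Mi.
  have le1 : (m i <= maxn N (\max_(i < N) m i))%N.
    rewrite leq_max; apply/orP; right; exact: (leq_bigmax (Ordinal iN)).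
  move: le1 (no i Mi) gi; rewrite /m; case: pselect => // h.
  by case: cid => /= m0 hm0 le1 _; exact: hm0.
exists i%:R; first by rewrite ler_nat.
split=> // u u0; set r := 12 * _ / _.
have r0 : 0 < r by rewrite /r; apply: divr_gt0 => //; lra.
have hr d : r <= d -> theta / 4 * d <= theta / 3 * d - 1 - 2 * L - 1.
  rewrite /r ler_pdivrMr // => h; lra.
rewrite (gg i%:R u) ?in_itv /= ?ler0n ?u0 // => ru.
have [n] := hi (Num.truncn u).+1; set v := (Num.truncn u).+1 => vn [g1 g2].
have /andP[v1 v2] := truncn_itv u0; rewrite -/v in v2.
have w := decomposition_wf (Adec n).
have gn : geod 0 n%:R gamma.
  by move=> a b /andP[a1 a2] /andP[b1 b2]; apply: gg; rewrite in_itv /= ?a1 ?b1.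
have [iu|ui] := leP i%:R u.
  move: ru; rewrite distrC ger0_norm ?subr_ge0 // => ru.
  have tr := contr_trim D0 L0 gn (Adec n) iu.
  split; last by apply: mulr_gt0; [lra|exact: lt_le_trans r0 ru].
  suff : theta / 3 * (u - i%:R) - 1 <= mass (A n) u - mass (A n) i%:R by have := hr _ ru; lra.
  have h0 : mass (A n) (Num.truncn u)%:R <= mass (A n) u by exact: mass_ge.
  have [iv|] := ltnP i (Num.truncn u).
    have := g1 (Num.truncn u); rewrite iv (leq_trans _ vn) // => /(_ isT).
    have : theta / 3 * (u - (Num.truncn u)%:R) <= 1.
      have : theta / 3 * (u - (Num.truncn u)%:R) <= theta / 3 * 1.
        by apply: ler_wpM2l; [lra|move: v2; rewrite /v -natr1; lra].
      lra.
    by move: h0; lra.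
  move=> vi; have : 0 <= mass (A n) u - mass (A n) i%:R by rewrite subr_ge0 mass_ge.
  suff : theta / 3 * (u - i%:R) <= theta / 3 * 1 by lra.
  apply: ler_wpM2l; first lra.
  have : v%:R <= i%:R + 1 :> R by rewrite natr1 ler_nat.
  by lra.
move: ru; rewrite ger0_norm ?subr_ge0; last exact: ltW ui; move=> ru.
have tr := contr_trim D0 L0 gn (Adec n) (ltW ui).
split; last by apply: mulr_gt0; [lra|exact: lt_le_trans r0 ru].
suff : theta / 3 * (i%:R - u) - 1 <= mass (A n) i%:R - mass (A n) u by have := hr _ ru; lra.
have vi : (v <= i)%N by rewrite /v -(ltr_nat R); apply: le_lt_trans v1 ui.
have h0 : mass (A n) u <= mass (A n) v%:R by apply: mass_ge => //; exact: ltW.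
have h1 : mass (A n) i.+1%:R - mass (A n) i%:R <= 1.
  apply: le_trans (mass_le w _) _; first by rewrite ler_nat.
  by rewrite -natr1; lra.
suff h2 : theta / 3 * (i%:R - u) <= mass (A n) i.+1%:R - mass (A n) v%:R by lra.
apply: le_trans (g2 v vi); apply: ler_wpM2l; first lra.
move: v1; rewrite /v -!natr1; lra.
Qed.

End Decompositions.

(** * Green function *)

Section Green.
Context {R : realType} {G : groupType}.
Variable mu : {fsfun G -> R with 0}.
Hypothesis pmu : probability_weight mu.
Variables (C rho : R).
Hypotheses (C0 : 0 < C) (rho0 : 0 < rho) (rho1 : rho < 1).
Hypothesis mu_exp : forall n (g : G), conv_pow mu n g <= C * rho ^+ n.
Implicit Types (g h x y z : G) (n m k N M : nat).

Definition psum N h : R := \sum_(0 <= n < N) conv_pow mu n h.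
Definition gr h : R := sup (range (psum ^~ h)).

Lemma psum_homo N M h : (N <= M)%N -> psum N h <= psum M h.
Proof.
move=> NM; rewrite /psum [leRHS](big_cat_nat (n := N)) //= lerDl.
by apply: sumr_ge0 => n _; exact: conv_pow_ge0.
Qed.

Lemma psum_ge0 N h : 0 <= psum N h.
Proof. by apply: sumr_ge0 => n _; exact: conv_pow_ge0. Qed.

Lemma geometric_le (r : R) a N : 0 < r -> r < 1 -> \sum_(a <= n < N) r ^+ n <= r ^+ a / (1 - r).
Proof.
move=> r0 r1; have r1' : 0 < 1 - r by rewrite subr_gt0.
have [Na|aN] := leqP N a; first by rewrite big_geq // divr_ge0 ?exprn_ge0 ?ltW.
rewrite ler_pdivlMr // mulr_suml.
rewrite (eq_bigr (fun n => - (r ^+ n.+1 - r ^+ n))); last by move=> n _; rewrite exprS; ring.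
rewrite sumrN telescope_sumr ?(ltnW aN) // opprB gerBl exprn_ge0 //; exact: ltW.
Qed.

Lemma psum_le N h : psum N h <= C / (1 - rho).
Proof.
apply: (@le_trans _ _ (\sum_(0 <= n < N) C * rho ^+ n)); first exact: ler_sum.
rewrite -mulr_sumr ler_pM2l //.
by have := geometric_le 0 N rho0 rho1; rewrite expr0 mul1r.
Qed.

Lemma has_sup_psum h : has_sup (range (psum ^~ h)).
Proof.
split; first by exists (psum 0 h); exists 0%N.
by exists (C / (1 - rho)) => _ [N _ <-]; exact: psum_le.
Qed.

Lemma psum_gr N h : psum N h <= gr h.
Proof. by apply: (sup_upper_bound (has_sup_psum h)); exists N. Qed.

Lemma gr_le h (B : R) : (forall N, psum N h <= B) -> gr h <= B.
Proof. by move=> hB; apply: ge_sup; [exists (psum 0 h); exists 0%N|move=> _ [N _ <-]]. Qed.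

Lemma gr_ge0 h : 0 <= gr h.
Proof. by apply: le_trans (psum_gr 0 h); rewrite psum_ge0. Qed.

Lemma greenE x y : green mu x y = (gr (x^-1 * y)%g)%:E.
Proof.
apply/eqP; rewrite eq_le; apply/andP; split.
  apply: lime_le.
    by apply: is_cvg_nneseries => n _ _; rewrite lee_fin conv_pow_ge0.
  by apply: nearW => N; rewrite sumEFin lee_fin psum_gr.
have h : forall N, ((psum N (x^-1 * y)%g)%:E <= green mu x y)%E.
  move=> N; rewrite /psum -sumEFin; apply: nneseries_lim_ge => n _ _.
  by rewrite lee_fin conv_pow_ge0.
case E : (green mu x y) => [r| |]; [|exact: leey|].
  rewrite lee_fin; apply: gr_le => N; by rewrite -lee_fin -E.
by have := h 0%N; rewrite E.
Qed.

Lemma psumS N h : psum N.+1 h = (h == 1%g)%:R +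
  \sum_(s <- finsupp mu) mu s * psum N (s^-1 * h)%g.
Proof.
rewrite /psum big_nat_recl //=; congr (_ + _).
by rewrite exchange_big /=; apply: eq_bigr => s _; rewrite mulr_sumr.
Qed.

(** The probability that the walk from the identity reaches [h] in fewer than [N] steps. *)
Fixpoint hit N h : R :=
  if N is N'.+1 then
    if h == 1%g then 1 else \sum_(s <- finsupp mu) mu s * hit N' (s^-1 * h)%g
  else 0.

Lemma psum_hit N h : psum N h <= hit N h * gr 1%g.
Proof.
elim: N h => [|N IH] h; first by rewrite /psum big_geq // mul0r.
rewrite /=; case: eqVneq => [->|h1]; first by rewrite mul1r psum_gr.
rewrite psumS (negPf h1) add0r mulr_suml; apply: ler_sum => s _.
by rewrite -mulrA ler_wpM2l ?pmu.1.
Qed.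

Lemma hit_psum N M h g : hit N h * psum M g <= psum (N + M) (h * g)%g.
Proof.
elim: N h => [|N IH] h; first by rewrite mul0r psum_ge0.
rewrite /=; case: eqVneq => [->|h1].
  by rewrite mul1r mul1g psum_homo // leq_addl.
rewrite addSn psumS mulr_suml -[leLHS]add0r; apply: lerD; first exact: ler0n.
by apply: ler_sum => s _; rewrite -mulrA ler_wpM2l ?pmu.1 // mulgA.
Qed.

Lemma gr1_ge1 : 1 <= gr 1%g.
Proof. by apply: le_trans (psum_gr 1 _); rewrite /psum big_nat1 /= eqxx. Qed.

(** Up to the factor [gr 1], [gr h] is the probability of ever reaching [h]; after that passage the
    walk starts afresh. *)
Lemma gr_mul_le h g : gr h * gr g <= gr 1%g * gr (h * g)%g.
Proof.
have g1 := gr1_ge1; have g0 : 0 < gr 1%g by apply: lt_le_trans g1.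
have hg N M : psum N h * psum M g <= gr 1%g * gr (h * g)%g.
  apply: le_trans (ler_wpM2r (psum_ge0 M g) (psum_hit N h)) _.
  rewrite mulrAC mulrC ler_wpM2l ?gr_ge0 //.
  by apply: le_trans (hit_psum N M h g) (psum_gr _ _).
have hM M : gr h * psum M g <= gr 1%g * gr (h * g)%g.
  have := psum_ge0 M g; rewrite le_eqVlt => /orP[/eqP<-|p0].
    by rewrite mulr0 mulr_ge0 ?gr_ge0.
  by rewrite -ler_pdivlMr //; apply: gr_le => N; rewrite ler_pdivlMr.
have := gr_ge0 h; rewrite le_eqVlt => /orP[/eqP<-|p0].
  by rewrite mul0r mulr_ge0 ?gr_ge0.
by rewrite mulrC -ler_pdivlMr //; apply: gr_le => N; rewrite ler_pdivlMr // mulrC.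
Qed.

Lemma gr_shiftr k h s : gr h * conv_pow mu k s <= gr (h * s)%g.
Proof.
have := conv_pow_ge0 pmu k s; rewrite le_eqVlt => /orP[/eqP<-|p0].
  by rewrite mulr0 gr_ge0.
rewrite -ler_pdivlMr //; apply: gr_le => N; rewrite ler_pdivlMr //.
apply: le_trans (psum_gr (N + k) _); rewrite /psum mulr_suml.
rewrite [leRHS](big_cat_nat (n := k)) ?leq_addl //= -[leLHS]add0r; apply: lerD; first exact: psum_ge0.
rewrite -[X in _ <= \sum_(X <= _ < _) _]add0n big_addn addnK; apply: ler_sum => n _; exact: conv_powD.
Qed.

Lemma gr_shiftl k h s : conv_pow mu k s * gr h <= gr (s * h)%g.
Proof.
have := conv_pow_ge0 pmu k s; rewrite le_eqVlt => /orP[/eqP<-|p0].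
  by rewrite mul0r gr_ge0.
rewrite mulrC -ler_pdivlMr //; apply: gr_le => N; rewrite ler_pdivlMr //.
apply: le_trans (psum_gr (N + k) _); rewrite /psum mulr_suml.
rewrite [leRHS](big_cat_nat (n := k)) ?leq_addl //= -[leLHS]add0r; apply: lerD; first exact: psum_ge0.
rewrite -[X in _ <= \sum_(X <= _ < _) _]add0n big_addn addnK; apply: ler_sum => n _.
by rewrite addnC mulrC; exact: conv_powD.
Qed.

(** Each generator has a positive probability at some time; [c] is the minimum over the finite set
    [S], capped by 1. *)
Lemma harnack (S : {fset G}) : reachable mu = setT -> exists c : R, [/\ 0 < c, c <= 1 &
  forall h (u : seq G), {subset u <= S} ->
    gr h * c ^+ size u <= gr (h * \big[*%g/1%g]_(s <- u) s)%g /\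
    c ^+ size u * gr h <= gr ((\big[*%g/1%g]_(s <- u) s) * h)%g].
Proof.
move=> reach; have hs s : exists k, 0 < conv_pow mu k s by have : reachable mu s by rewrite reach.
pose k s := projT1 (cid (hs s)).
have [c c0 hc] := @seq_lower_bound R _ S (fun s => conv_pow mu (k s) s) (fun s _ => projT2 (cid (hs s))).
exists (Num.min c 1); set d := Num.min c 1.
have d0 : 0 < d by rewrite lt_min c0 ltr01.
have hd s : s \in S -> d <= conv_pow mu (k s) s.
  by move=> /hc; apply: le_trans; rewrite ge_min lexx.
split=> // [|h u]; first by rewrite ge_min lexx orbT.
elim: u h => [|s u IH] h us; first by rewrite big_nil expr0 mulr1 mul1r mulg1 mul1g.
have sS : s \in S by apply: us; exact: mem_head.
have {}us : {subset u <= S} by move=> t tu; apply: us; rewrite inE tu orbT.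
have du : 0 <= d ^+ size u by apply: exprn_ge0; exact: ltW.
rewrite big_cons /= exprS; split.
  have [h1 _] := IH (h * s)%g us; rewrite mulgA; apply: le_trans h1.
  rewrite mulrA ler_wpM2r //; apply: le_trans (gr_shiftr (k s) h s).
  by rewrite ler_wpM2l ?gr_ge0 ?hd.
have [_ h1] := IH h us; rewrite -mulgA.
apply: le_trans (gr_shiftl (k s) _ s).
rewrite -mulrA; apply: ler_pM; rewrite ?hd ?(ltW d0) //; exact: mulr_ge0 (gr_ge0 _).
Qed.
End Green.

Notation gprod u := (\big[*%g/1%g]_(s <- u) s)%g.

(** * Sums over trajectories *)

Section PathSums.
Context {R : realType} {G : groupType}.
Variable mu : {fsfun G -> R with 0}.
Hypothesis pmu : probability_weight mu.
Implicit Types (g h x y z : G) (w u a b : seq G) (n m k N M i l : nat) (phi psi : seq G -> R).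

(* The expectation of [phi] over the first [n] increments of the walk. *)
Fixpoint psm n phi : R :=
  if n is n'.+1 then \sum_(s <- finsupp mu) mu s * psm n' (fun w => phi (s :: w))
  else phi [::].

Lemma psm_le n phi psi :
  (forall w, size w = n -> {subset w <= finsupp mu} -> phi w <= psi w) -> psm n phi <= psm n psi.
Proof.
elim: n phi psi => [|n IH] phi psi h; first exact: h.
rewrite /= !big_seq; apply: ler_sum => s ss; rewrite ler_wpM2l ?pmu.1 //.
apply: IH => w sw ws; apply: h => [|t]; first by rewrite /= sw.
by rewrite inE => /orP[/eqP->|/ws].
Qed.

Lemma eq_psm n phi psi : (forall w, phi w = psi w) -> psm n phi = psm n psi.
Proof.
elim: n phi psi => [|n IH] phi psi h; first exact: h.
by apply: eq_bigr => s _; congr (_ * _); apply: IH.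
Qed.

Lemma psm_scale n (c : R) phi : psm n (fun w => c * phi w) = c * psm n phi.
Proof.
elim: n phi => [//|n IH] phi /=; rewrite mulr_sumr; apply: eq_bigr => s _.
by rewrite IH mulrCA.
Qed.

Lemma psm_sum (I : Type) (r : seq I) n (F : I -> seq G -> R) :
  psm n (fun w => \sum_(i <- r) F i w) = \sum_(i <- r) psm n (F i).
Proof.
elim: n F => [//|n IH] F /=; rewrite exchange_big /=; apply: eq_bigr => s _.
by rewrite IH mulr_sumr.
Qed.

Lemma psm_mul i m phi psi :
  psm (i + m) (fun w => phi (take i w) * psi (drop i w)) = psm i phi * psm m psi.
Proof.
elim: i phi => [|i IH] phi.
  by rewrite /= -psm_scale; apply: eq_psm => w; rewrite take0 drop0.
by rewrite /= mulr_suml; apply: eq_bigr => s _; rewrite -mulrA -IH.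
Qed.

Lemma conv_pow_psm n g : conv_pow mu n g = psm n (fun w => (gprod w == g)%:R).
Proof.
elim: n g => [|n IH] g /=; first by rewrite big_nil eq_sym.
apply: eq_bigr => s _; rewrite IH; congr (_ * _); apply: eq_psm => w.
by rewrite big_cons -(inj_eq (mulgI s)) mulVKg.
Qed.

Lemma conv_pow_psm3 i l m (g h k : G) :
  psm (i + (l + m)) (fun w => (gprod (take i w) == g)%:R *
    ((gprod (take l (drop i w)) == h)%:R * (gprod (drop l (drop i w)) == k)%:R)) =
  conv_pow mu i g * (conv_pow mu l h * conv_pow mu m k).
Proof.
rewrite (psm_mul i (l + m) (fun w => (gprod w == g)%:R)
  (fun w => (gprod (take l w) == h)%:R * (gprod (drop l w) == k)%:R)).
rewrite (psm_mul l m (fun w => (gprod w == h)%:R) (fun w => (gprod w == k)%:R)).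
by rewrite -!conv_pow_psm.
Qed.

Lemma sum_ge_term (I : eqType) (r : seq I) (F : I -> R) (i : I) :
  (forall j, 0 <= F j) -> i \in r -> F i <= \sum_(j <- r) F j.
Proof.
move=> F0 ir; rewrite (perm_big _ (perm_to_rem ir)) big_cons lerDl; exact: sumr_ge0.
Qed.

Lemma words_sum (S : seq G) M (t : R) : 0 <= t -> (size S)%:R * t <= 1 / 2 ->
  \sum_(w <- words S M) t ^+ size w <= 2.
Proof.
move=> t0 St; elim: M => [|M IH]; first by rewrite big_nil.
rewrite big_cons expr0 big_allpairs_dep /=.
under eq_bigr do (under eq_bigr do rewrite exprS; rewrite -mulr_sumr).
rewrite big_const_seq count_predT iter_addr addr0 -/(words S M) -[X in 1 + X]mulr_natl mulrA.
have : (size S)%:R * t * \sum_(w <- words S M) t ^+ size w <= 1 / 2 * 2.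
  by apply: ler_pM => //; [exact: mulr_ge0|apply: sumr_ge0 => w _; exact: exprn_ge0].
lra.
Qed.

Variables (C rho : R).
Hypotheses (C0 : 0 < C) (rho0 : 0 < rho) (rho1 : rho < 1).
Hypothesis mu_exp : forall n (g : G), conv_pow mu n g <= C * rho ^+ n.

Lemma geometric_cond k N : \sum_(l <- iota 0 N) (k <= l)%N%:R * rho ^+ l <= rho ^+ k / (1 - rho).
Proof.
have -> : \sum_(l <- iota 0 N) (k <= l)%N%:R * rho ^+ l = \sum_(k <= l < N) rho ^+ l.
  have [Nk|kN] := leqP N k.
    rewrite [RHS]big_geq // big_seq big1 // => l.
    rewrite mem_iota add0n => /andP[_ h]; have -> : (k <= l)%N = false by lia.
    by rewrite mul0r.
  rewrite -[X in iota 0 X]subn0 -/(index_iota 0 N) (big_cat_nat (n := k)) //=; last exact: ltnW.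
  rewrite big_nat big1 ?add0r => [|l /andP[_ h]]; last by rewrite leqNgt h mul0r.
  by apply: eq_big_nat => l /andP[h _]; rewrite h mul1r.
exact: geometric_le.
Qed.

Variables (S : {fset G}) (c : R).
Hypotheses (symS : symmetric_set [set` S]) (c0 : 0 < c) (c1 : c <= 1).
Hypothesis hc : forall h (u : seq G), {subset u <= S} ->
    gr mu h * c ^+ size u <= gr mu (h * gprod u)%g /\
    c ^+ size u * gr mu h <= gr mu (gprod u * h)%g.

Lemma inv_word u : {subset u <= S} -> exists v, [/\ {subset v <= S}, size v = size u & gprod v = (gprod u)^-1%g].
Proof.
elim: u => [|s u IH] us; first by exists [::]; rewrite big_nil invg1.
have [|v [vS sv pv]] := IH; first by move=> t tu; apply: us; rewrite inE tu orbT.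
exists (rcons v s^-1%g); split.
- move=> t; rewrite mem_rcons inE => /orP[/eqP->|/vS//].
  by apply: symS; apply: us; exact: mem_head.
- by rewrite size_rcons sv.
by rewrite -cats1 big_cat big_seq1 /= pv big_cons invgM.
Qed.

(** A union bound over the cut [(i, l)] and the words [a], [b]. The middle part contributes at most
    [C * rho ^+ l], the outer parts sum to Green functions, and Harnack moves these to [z] at the
    price of [c] to the lengths of the words. The sum over [l] leaves a geometric series in
    [rho ^+ K / c] for each word, with sum at most 2; hence the factor 4. *)
Lemma green_upper (K K' : nat) x y z : (0 < K)%N -> (size S)%:R * (rho ^+ K / c) <= 1 / 2 ->
  (forall w, {subset w <= finsupp mu} -> (x * gprod w)%g = y -> exists i l a b,
    [/\ (i + l <= size w)%N, {subset a <= S} /\ {subset b <= S},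
      (x * gprod (take i w))%g = (z * gprod a)%g,
      (x * gprod (take (i + l) w))%g = (z * gprod b)%g &
      (K * (size a + size b) <= l + K')%N]) ->
  gr mu (x^-1 * y)%g <= 4 * C / (rho ^+ K' * (1 - rho)) * (gr mu (x^-1 * z)%g * gr mu (z^-1 * y)%g).
Proof.
move=> K0 hK hw; apply: gr_le => // N.
(* As [K] is at least 1 and [l] is less than [N], longer words do not occur. *)
pose W := words S (N + K')%N.
pose Q a b l := (K * (size a + size b) <= l + K')%N.
pose T a b i l r := conv_pow mu i (x^-1 * (z * gprod a))%g *
  (conv_pow mu l ((gprod a)^-1 * gprod b)%g * conv_pow mu r ((z * gprod b)^-1 * y)%g).
have T0 a b i l r : 0 <= T a b i l r by rewrite /T !mulr_ge0 ?conv_pow_ge0.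
have step1 n : (n < N)%N -> conv_pow mu n (x^-1 * y)%g <=
    \sum_(a <- W) \sum_(b <- W) \sum_(l <- iota 0 N) \sum_(i <- iota 0 N) \sum_(r <- iota 0 N)
      (Q a b l && (i + (l + r) == n)%N)%:R * T a b i l r.
  move=> nN.
  pose F a b i l r w : R := (Q a b l && (i + (l + r) == n)%N)%:R *
    ((gprod (take i w) == x^-1 * (z * gprod a))%g%:R *
    ((gprod (take l (drop i w)) == (gprod a)^-1 * gprod b)%g%:R *
      (gprod (drop l (drop i w)) == (z * gprod b)^-1 * y)%g%:R)).
  have F0 a b i l r w : 0 <= F a b i l r w by rewrite /F !mulr_ge0.
  rewrite conv_pow_psm; apply: (@le_trans _ _ (psm n (fun w =>
      \sum_(a <- W) \sum_(b <- W) \sum_(l <- iota 0 N) \sum_(i <- iota 0 N) \sum_(r <- iota 0 N)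
        F a b i l r w))).
    apply: psm_le => w sw ws; case: eqVneq => [pw|_]; last first.
      by rewrite !sumr_ge0 // => *; rewrite !sumr_ge0 // => *; rewrite !sumr_ge0 // => *;
        rewrite !sumr_ge0 // => *; rewrite !sumr_ge0.
    have [|i [l [a [b [il [aS bS] pa pb Kab]]]]] := hw w ws; first by rewrite pw mulVKg.
    have il' : (i + l <= n)%N by rewrite -sw.
    have sab : (size a + size b < N + K')%N.
      apply: leq_ltn_trans (_ : l + K' < _)%N; last by lia.
      by apply: leq_trans Kab; rewrite leq_pmull.
    pose r := (n - (i + l))%N.
    have pl : gprod (take l (drop i w)) = ((gprod a)^-1 * gprod b)%g.
      apply: (mulgI (z * gprod a)%g); rewrite mulgA mulgK -pb -pa takeD big_cat /=.
      by rewrite !mulgA.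
    have pr : gprod (drop l (drop i w)) = ((z * gprod b)^-1 * y)%g.
      apply: (mulgI (z * gprod b)%g); rewrite mulVKg -pb -mulgA drop_drop addnC.
      by rewrite -big_cat cat_take_drop pw mulVKg.
    have -> : true%:R = F a b i l r w.
      rewrite /F pl pr !eqxx (_ : gprod (take i w) = x^-1 * (z * gprod a))%g; last by rewrite -pa mulKg.
      by rewrite eqxx !mulr1 /Q Kab /r /=; have -> : (i + (l + (n - (i + l))) == n)%N by lia.
    have mN j : (j <= n)%N -> j \in iota 0 N by move=> h; rewrite mem_iota; lia.
    have aW : a \in W by apply: mem_words aS; exact: leq_ltn_trans (leq_addr _ _) sab.
    have bW : b \in W by apply: mem_words bS; exact: leq_ltn_trans (leq_addl _ _) sab.
    apply: le_trans (sum_ge_term (F := fun r => F a b i l r w) _ (mN r _)) _ => //; first by rewrite /r; lia.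
    apply: le_trans (sum_ge_term (F := fun i => \sum_(r <- iota 0 N) F a b i l r w) _ (mN i _)) _.
      by move=> *; apply: sumr_ge0.
      by lia.
    apply: le_trans (sum_ge_term (F := fun l => \sum_(i <- iota 0 N) \sum_(r <- iota 0 N) F a b i l r w) _ (mN l _)) _.
      by move=> *; apply: sumr_ge0 => *; apply: sumr_ge0.
      by lia.
    apply: le_trans (sum_ge_term (F := fun b => \sum_(l <- iota 0 N) \sum_(i <- iota 0 N) \sum_(r <- iota 0 N) F a b i l r w) _ bW) _.
      by move=> *; apply: sumr_ge0 => *; apply: sumr_ge0 => *; apply: sumr_ge0.
    apply: (sum_ge_term (F := fun a => \sum_(b <- W) \sum_(l <- iota 0 N) \sum_(i <- iota 0 N) \sum_(r <- iota 0 N) F a b i l r w) _ aW).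
    by move=> *; apply: sumr_ge0 => *; apply: sumr_ge0 => *; apply: sumr_ge0 => *; apply: sumr_ge0.
  rewrite psm_sum; apply: ler_sum => a _; rewrite psm_sum; apply: ler_sum => b _.
  rewrite psm_sum; apply: ler_sum => l _; rewrite psm_sum; apply: ler_sum => i _.
  rewrite psm_sum; apply: ler_sum => r _; rewrite /F psm_scale.
  have [E|] := eqVneq (i + (l + r))%N n; last by rewrite andbF !mul0r.
  by rewrite ler_wpM2l // -{1}E conv_pow_psm3.
pose g1 a := gr mu (x^-1 * (z * gprod a))%g.
pose g2 b := gr mu ((z * gprod b)^-1 * y)%g.
have step2 : psum mu N (x^-1 * y)%g <= \sum_(a <- W) \sum_(b <- W) \sum_(l <- iota 0 N)
     (g1 a * C * g2 b) * ((K * (size a + size b) - K' <= l)%N%:R * rho ^+ l).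
  rewrite /psum.
  apply: (@le_trans _ _ (\sum_(0 <= n < N) \sum_(a <- W) \sum_(b <- W) \sum_(l <- iota 0 N) \sum_(i <- iota 0 N) \sum_(r <- iota 0 N)
      (Q a b l && (i + (l + r) == n)%N)%:R * T a b i l r)).
    by apply: ler_sum_nat => n /andP[_ nN]; exact: step1.
  rewrite exchange_big; apply: ler_sum => a _; rewrite exchange_big; apply: ler_sum => b _.
  rewrite exchange_big; apply: ler_sum => l _; rewrite exchange_big /=.
  apply: (@le_trans _ _ (\sum_(i <- iota 0 N) \sum_(r <- iota 0 N) (Q a b l)%:R * T a b i l r)).
    apply: ler_sum => i _; rewrite exchange_big; apply: ler_sum => r _ /=.
    rewrite -mulr_suml ler_wpM2r //; case: (Q a b l) => /=; last by rewrite big1.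
    apply: (@le_trans _ _ (\sum_(0 <= n < N) if (n == i + (l + r))%N then 1 else 0)).
      by apply: ler_sum => n _; rewrite eq_sym; case: ifP.
    by rewrite -big_mkcond /= big_nat1_eq; case: ifP.
  have -> : Q a b l = (K * (size a + size b) - K' <= l)%N by rewrite leq_subLR (addnC K').
  set q := (_ <= l)%N.
  have r0 : 0 <= rho ^+ l by apply: exprn_ge0; exact: ltW.
  apply: (@le_trans _ _ (q%:R * (\sum_(i <- iota 0 N) \sum_(r <- iota 0 N)
      conv_pow mu i (x^-1 * (z * gprod a))%g * (C * rho ^+ l * conv_pow mu r ((z * gprod b)^-1 * y)%g)))).
    rewrite mulr_sumr; apply: ler_sum => i _; rewrite mulr_sumr; apply: ler_sum => r _.
    apply: ler_wpM2l => //; apply: ler_wpM2l; first exact: conv_pow_ge0.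
    by apply: ler_wpM2r; [exact: conv_pow_ge0|exact: mu_exp].
  rewrite mulrCA ler_wpM2l //.
  under eq_bigr do rewrite -mulr_sumr -mulr_sumr.
  rewrite -mulr_suml -!mulrA; apply: ler_pM.
  - by apply: sumr_ge0 => i _; exact: conv_pow_ge0.
  - apply: mulr_ge0; first exact: ltW.
    by apply: mulr_ge0 => //; apply: sumr_ge0 => i _; exact: conv_pow_ge0.
  - by have := psum_gr C0 rho0 rho1 mu_exp N (x^-1 * (z * gprod a))%g; rewrite /psum /index_iota subn0.
  rewrite ler_pM2l // mulrC ler_wpM2r //.
  by have := psum_gr C0 rho0 rho1 mu_exp N ((z * gprod b)^-1 * y)%g; rewrite /psum /index_iota subn0.
set A := gr mu (x^-1 * z)%g; set B := gr mu (z^-1 * y)%g.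
have A0 : 0 <= A by exact: (gr_ge0 pmu C0 rho0 rho1 mu_exp).
have B0 : 0 <= B by exact: (gr_ge0 pmu C0 rho0 rho1 mu_exp).
have g10 a : 0 <= g1 a by exact: (gr_ge0 pmu C0 rho0 rho1 mu_exp).
have g20 a : 0 <= g2 a by exact: (gr_ge0 pmu C0 rho0 rho1 mu_exp).
have hg1 a : {subset a <= S} -> g1 a <= A / c ^+ size a.
  move=> aS; have [v [vS sv pv]] := inv_word aS.
  rewrite ler_pdivlMr ?exprn_gt0 // -sv; apply: le_trans (proj1 (hc _ vS)) _.
  by rewrite pv mulgA mulgK.
have hg2 b : {subset b <= S} -> g2 b <= B / c ^+ size b.
  move=> bS; rewrite ler_pdivlMr ?exprn_gt0 // mulrC; apply: le_trans (proj2 (hc _ bS)) _.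
  by rewrite invgM -mulgA mulVKg.
pose t := rho ^+ K / c.
have t0 : 0 <= t by rewrite divr_ge0 ?exprn_ge0 ?ltW.
have WS a : a \in W -> {subset a <= S}.
  rewrite /W; elim: (N + K')%N a => //= M IH a; rewrite inE => /orP[/eqP-> //|].
  case/allpairsP => [[s w] /= [sS /IH ww ->]] u; rewrite inE => /orP[/eqP->//|]; exact: ww.
have rho1' : 0 < 1 - rho by rewrite subr_gt0.
apply: le_trans step2 _; rewrite big_seq.
(* The sum runs over words and not over the elements that they represent; overcounting is harmless
   for an upper bound. *)
apply: (@le_trans _ _ (\sum_(a <- W) \sum_(b <- W)
    A * B * C / (rho ^+ K' * (1 - rho)) * (t ^+ size a * t ^+ size b))).
  rewrite [leRHS]big_seq; apply: ler_sum => a /WS aS; rewrite !big_seq; apply: ler_sum => b /WS bS.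
  rewrite -mulr_sumr.
  apply: (@le_trans _ _ ((A / c ^+ size a) * C * (B / c ^+ size b) *
      (rho ^+ (K * (size a + size b) - K') / (1 - rho)))).
    apply: ler_pM.
    - by rewrite !mulr_ge0 // ltW.
    - by apply: sumr_ge0 => l _; rewrite mulr_ge0 ?exprn_ge0 // ltW.
    - apply: ler_pM; rewrite ?mulr_ge0 ?(ltW C0) ?hg2 //.
      by rewrite ler_wpM2r ?hg1 ?ltW.
    exact: geometric_cond.
  have e1 : rho ^+ (K * (size a + size b) - K') <= rho ^+ K ^+ size a * rho ^+ K ^+ size b / rho ^+ K'.
    rewrite ler_pdivlMr ?exprn_gt0 // -!exprM -!exprD -mulnDr.
    by apply: ler_wiXn2l; rewrite ?(ltW rho0) ?(ltW rho1) //; lia.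
  rewrite /t !expr_div_n.
  have -> : A * B * C / (rho ^+ K' * (1 - rho)) *
     (rho ^+ K ^+ size a / c ^+ size a * (rho ^+ K ^+ size b / c ^+ size b)) =
     (A / c ^+ size a) * C * (B / c ^+ size b) *
     ((rho ^+ K ^+ size a * rho ^+ K ^+ size b / rho ^+ K') / (1 - rho)).
    by rewrite invfM; ring.
  apply: ler_wpM2l; first by do ![apply: mulr_ge0]; rewrite ?invr_ge0 ?exprn_ge0 ?(ltW c0) ?(ltW C0).
  by rewrite ler_wpM2r // invr_ge0 ltW.
under eq_bigr do (rewrite -mulr_sumr -mulr_sumr).
rewrite -mulr_sumr -mulr_suml.
have w2 := words_sum (N + K') t0 hK.
have w0 : 0 <= \sum_(w <- W) t ^+ size w by apply: sumr_ge0 => w _; exact: exprn_ge0.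
have -> : 4 * C / (rho ^+ K' * (1 - rho)) * (A * B) = A * B * C / (rho ^+ K' * (1 - rho)) * (2 * 2).
  by ring.
apply: ler_wpM2l; last exact: ler_pM.
by do ![apply: mulr_ge0]; rewrite ?invr_ge0 ?mulr_ge0 ?exprn_ge0 ?(ltW C0) ?(ltW rho0) ?(ltW rho1').
Qed.
End PathSums.

(** * Trajectories far from the ray *)

Section Progress.
Context {R : realType} {X : metricType R}.
Variables (D : R) (gamma : R -> X).
Hypothesis D0 : 0 < D.
Hypothesis gg : forall s t, 0 <= s -> 0 <= t -> mdist (gamma s) (gamma t) = `|s - t|.
Implicit Types (x y : X) (s t u a b r : R) (p : R * R) (ps : seq (R * R)).

Lemma cp_before a b t : cgeod D gamma a b -> 0 <= t <= a -> cp gamma a b (gamma t) = a.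
Proof.
move=> CG /andP[t0 ta]; have [ab _ _] := CG; have /andP[c1 c2] := cp_in CG (gamma t).
have := dq_le CG (gamma t) (t := a); rewrite lexx ab => /(_ isT).
have a0 := le_trans t0 ta; have c0 := le_trans a0 c1.
rewrite /dq !gg // (distrC t a) (distrC t (cp _ _ _ _)) !ger0_norm ?subr_ge0 ?(le_trans ta) // => h.
by apply/eqP; rewrite eq_le c1; move: h; lra.
Qed.

Lemma cp_after a b t : 0 <= a -> cgeod D gamma a b -> b <= t -> cp gamma a b (gamma t) = b.
Proof.
move=> a0 CG bt; have [ab _ _] := CG; have /andP[c1 c2] := cp_in CG (gamma t).
have b0 := le_trans a0 ab; have t0 := le_trans b0 bt.
have := dq_le CG (gamma t) (t := b); rewrite lexx ab => /(_ isT).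
have c0 := le_trans a0 c1.
rewrite /dq !gg // !ger0_norm ?subr_ge0 ?(le_trans c2) // => h.
by apply/eqP; rewrite eq_le c2; move: h; lra.
Qed.

(** The two ways in which the part far from the ray can end: close to the ray, or at an end of the
    whole trajectory, where [gamma s] is a nearest point. *)
Definition tame r x s : Prop :=
  mdist x (gamma s) <= r \/ forall t, 0 <= t -> mdist x (gamma s) <= mdist x (gamma t).

Lemma tame_before r x s a b : 0 <= s -> s <= a -> cgeod D gamma a b -> tame r x s ->
  cp gamma a b x <= a + D \/ (a < s + r /\ cp gamma a b x <= a + 2 * r).
Proof.
move=> s0 sa CG; have a0 := le_trans s0 sa; have /andP[c1 c2] := cp_in CG x.
have cs : cp gamma a b (gamma s) = a by apply: cp_before => //; rewrite s0.
have c0 := le_trans a0 c1.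
case=> [xs|nx]; last first.
  left; have := cp_contr CG (x := x) (y := gamma s) (nx _ c0).
  by rewrite cs ler_norml => /andP[_]; lra.
have [h|h] := leP (s + r) a.
  left; have := cp_contr CG (x := gamma s) (y := x).
  rewrite /dq cs gg // metric_sym => /(_ _) hh.
  have : `|a - cp gamma a b x| <= D.
    by apply: hh; rewrite distrC ger0_norm ?subr_ge0 //; move: xs h; lra.
  by rewrite ler_norml => /andP[+ _]; lra.
right; split => //; have [ab _ _] := CG.
have h1 : mdist x (gamma (cp gamma a b x)) <= mdist x (gamma a) by apply: (dq_le CG); rewrite lexx.
have h2 := dist_tri x (gamma s) (gamma a).
have h3 := dist_tri (gamma s) x (gamma (cp gamma a b x)).
move: h1 h2 h3; rewrite (metric_sym (gamma s) x) !gg // !(distrC s) !ger0_norm ?subr_ge0 ?(le_trans sa) //.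
by move: xs; lra.
Qed.

Lemma tame_after r x s a b : 0 <= a -> b <= s -> cgeod D gamma a b -> tame r x s ->
  b - D <= cp gamma a b x \/ (s - r < b /\ b - 2 * r <= cp gamma a b x).
Proof.
move=> a0 bs CG; have [ab _ _] := CG; have /andP[c1 c2] := cp_in CG x.
have b0 := le_trans a0 ab; have s0 := le_trans b0 bs.
have cs : cp gamma a b (gamma s) = b by exact: cp_after.
have c0 := le_trans a0 c1.
case=> [xs|nx]; last first.
  left; have := cp_contr CG (x := x) (y := gamma s) (nx _ c0).
  by rewrite cs ler_norml => /andP[+ _]; lra.
have [h|h] := leP b (s - r).
  left; have := cp_contr CG (x := gamma s) (y := x).
  rewrite /dq cs gg // metric_sym => /(_ _) hh.
  have : `|b - cp gamma a b x| <= D.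
    by apply: hh; rewrite ger0_norm ?subr_ge0 //; move: xs h; lra.
  by rewrite ler_norml => /andP[_]; lra.
right; split => //.
have h1 : mdist x (gamma (cp gamma a b x)) <= mdist x (gamma b) by apply: (dq_le CG); rewrite ab lexx.
have h2 := dist_tri x (gamma s) (gamma b).
have h3 := dist_tri (gamma s) x (gamma (cp gamma a b x)).
move: h1 h2 h3; rewrite (metric_sym (gamma s) x) !gg // !ger0_norm ?subr_ge0 ?(le_trans c2) //.
by move: xs; lra.
Qed.

Definition mid p x : bool := p.1 + D < cp gamma p.1 p.2 x < p.2 - D.

(** For the farther of the two pieces, the nearest point of [x] on the other one lies in the
    contraction ball. It projects to an end of the farther piece, so [x] projects within [D] of that
    end. *)
Lemma mid_unique p p' x : 0 <= p.1 -> cgeod D gamma p.1 p.2 -> cgeod D gamma p'.1 p'.2 ->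
  p.2 <= p'.1 -> mid p x -> mid p' x -> False.
Proof.
move=> p0 CG CG' pp' /andP[m1 m2] /andP[m3 m4].
have /andP[c1 c2] := cp_in CG x; have /andP[c3 c4] := cp_in CG' x.
have [h|h] := leP (dq gamma p.1 p.2 x) (dq gamma p'.1 p'.2 x).
  have := cp_contr CG' (x := x) (y := gamma (cp gamma p.1 p.2 x)) h.
  rewrite cp_before //; last by rewrite (le_trans p0) ?(le_trans c2).
  by rewrite ler_norml => /andP[_]; move: m3; lra.
have := cp_contr CG (x := x) (y := gamma (cp gamma p'.1 p'.2 x)) (ltW h).
rewrite cp_after //; last exact: le_trans c3.
by rewrite ler_norml => /andP[+ _]; move: m2; lra.
Qed.

Definition pieces_of (l : R) s u ps : Prop := wf ps /\ forall p, p \in ps ->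
  [/\ s <= p.1, p.2 <= u, l <= p.2 - p.1 & cgeod D gamma p.1 p.2].

Lemma mid_sum_le l s u ps x : 0 <= s -> pieces_of l s u ps -> \sum_(p <- ps) (mid p x)%:R <= 1 :> R.
Proof.
move=> s0; elim: ps => [|p ps IH] [w h]; first by rewrite big_nil.
have [p0 _ _ CG] := h p (mem_head _ _).
have h' q : q \in ps -> [/\ s <= q.1, q.2 <= u, l <= q.2 - q.1 & cgeod D gamma q.1 q.2].
  by move=> qs; apply: h; rewrite inE qs orbT.
rewrite big_cons; have [m|_] := boolP (mid p x); last by rewrite add0r; apply: IH; split=> //; exact: wf_behead w.
rewrite big_seq big1 ?addr0 // => q qs; case: (boolP (mid q x)) => // mq; exfalso.
have [_ _ _ CG'] := h' q qs.
exact: (mid_unique (le_trans s0 p0) CG CG' (ltW (wf_later w qs)) m mq).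
Qed.

(** Clipping by [D] at both ends makes this constant when [x] is not in the middle of [p]. *)
Definition prog p x : R := clamp 0 (p.2 - p.1 - 2 * D) (cp gamma p.1 p.2 x - p.1 - D).
Definition progress ps x : R := \sum_(p <- ps) prog p x.

(** Only a piece having [x] or [y] in its middle can contribute: as [J] is less than the clipped
    length, no piece is jumped over. There is at most one such piece for [x] and one for [y]. *)
Lemma progress_step l s u ps x y J : 0 <= s -> pieces_of l s u ps -> 0 <= J -> 2 * D + J < l ->
  (forall p, p \in ps -> `|cp gamma p.1 p.2 x - cp gamma p.1 p.2 y| <= J) ->
  progress ps x - progress ps y <= 2 * J.
Proof.
move=> s0 pcs J0 lJ hJ; rewrite /progress -sumrB.
have mx := mid_sum_le x s0 pcs; have my := mid_sum_le y s0 pcs.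
apply: (@le_trans _ _ (\sum_(p <- ps) J * ((mid p x)%:R + (mid p y)%:R))); last first.
  rewrite -mulr_sumr big_split /= mulrC; apply: ler_wpM2r => //.
  by move: mx my; lra.
rewrite !big_seq; apply: ler_sum => p pp.
have [_ _ lp _] := (proj2 pcs) p pp; have := hJ p pp; rewrite ler_norml => /andP[j1 j2].
have len0 : 0 <= p.2 - p.1 - 2 * D by move: lp lJ J0; lra.
have jj : prog p x - prog p y <= J.
  apply: le_trans (ler_norm _) _; apply: le_trans (clamp_lip _ _ len0) _.
  by rewrite ler_norml; apply/andP; split; lra.
rewrite /mid; case: (boolP (_ < _ < _)) => m1.
  by apply: le_trans jj _; rewrite ler_peMr // lerDl.
case: (boolP (_ < _ < _)) => m2; first by rewrite add0r mulr1.
rewrite addr0 mulr0; have := jj; rewrite /prog.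
move: m1 m2; rewrite !negb_and -!leNgt.
set cx := cp _ _ _ x; set cy := cp _ _ _ y.
have lo z : z <= p.1 + D -> clamp 0 (p.2 - p.1 - 2 * D) (z - p.1 - D) = 0.
  by move=> h; rewrite clamp_lo //; move: h; lra.
have hi z : p.2 - D <= z -> clamp 0 (p.2 - p.1 - 2 * D) (z - p.1 - D) = p.2 - p.1 - 2 * D.
  by move=> h; rewrite clamp_hi //; move: h; lra.
case/orP => h1; [rewrite (lo _ h1)|rewrite (hi _ h1)]; case/orP => h2;
  rewrite ?(lo _ h2) ?(hi _ h2) => _; move: h1 h2 lp lJ j1 j2; rewrite /cx /cy; clear; lra.
Qed.

(** By [tame_before], only pieces starting before [s + r] show progress, and not beyond [s + 3 * r].
    So the total is at most the mass of that window. *)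
Lemma progress_before l s u ps x r : 0 <= s -> 2 * D < l -> 0 <= r -> pieces_of l s u ps -> tame r x s ->
  progress ps x <= 3 * r.
Proof.
move=> s0 lD r0 [w h] tx.
have s3 : s <= s + 3 * r by rewrite lerDl mulr_ge0.
have := mass_le w s3; rewrite addrAC subrr add0r; apply: le_trans.
rewrite /mass -sumrB /progress !big_seq; apply: ler_sum => p pp.
have [sp pu lp CG] := h p pp; have [p12 _ _] := CG; rewrite (clamp_lo p12 sp).
have /andP[k1 k2] := clamp_in (s + 3 * r) p12.
have len0 : 0 <= p.2 - p.1 - 2 * D by move: lp lD; lra.
have /andP[c1 c2] := cp_in CG x; rewrite /prog.
have [hc|[h1 h2]] := tame_before s0 sp CG tx.
  by rewrite clamp_lo ?subr_ge0 //; move: hc; lra.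
have h3 : cp gamma p.1 p.2 x <= clamp p.1 p.2 (s + 3 * r).
  by have [[_ ->]|[hh ->]|[_ ->]] := clampP (s + 3 * r) p12; move: h1 h2 c2 c1 k1 r0; lra.
have [[_ ->]|[_ ->]|[hh ->]] := clampP (cp gamma p.1 p.2 x - p.1 - D) len0; move: h3 (D0) k1; lra.
Qed.

Lemma progress_after l s u ps x r : 0 <= s -> 2 * D < l -> 0 <= r -> pieces_of l s u ps -> tame r x u ->
  \sum_(p <- ps) (p.2 - p.1 - 2 * D) - progress ps x <= 3 * r.
Proof.
move=> s0 lD r0 [w h] tx.
have s3 : u - 3 * r <= u by rewrite gerBl mulr_ge0.
have := mass_le w s3; rewrite (_ : u - (u - 3 * r) = 3 * r); last ring; apply: le_trans.
rewrite /mass -!sumrB /progress !big_seq; apply: ler_sum => p pp.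
have [sp pu lp CG] := h p pp; have [p12 _ _] := CG; rewrite (clamp_hi p12 pu).
have /andP[k1 k2] := clamp_in (u - 3 * r) p12.
have len0 : 0 <= p.2 - p.1 - 2 * D by move: lp lD; lra.
have /andP[c1 c2] := cp_in CG x; rewrite /prog.
have [hc|[h1 h2]] := tame_after (le_trans s0 sp) pu CG tx.
  by rewrite clamp_hi ?subrr ?subr_ge0 //; move: hc; lra.
have h3 : clamp p.1 p.2 (u - 3 * r) <= cp gamma p.1 p.2 x.
  by have [[_ ->]|[_ ->]|[hh ->]] := clampP (u - 3 * r) p12; move: h1 h2 c2 c1 k2 r0; lra.
have [[_ ->]|[hh ->]|[hh ->]] := clampP (cp gamma p.1 p.2 x - p.1 - D) len0; move: h3 (D0) k2; lra.
Qed.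

Lemma path_dist (P : nat -> X) lambda n i j : (forall i, (i < n)%N -> mdist (P i) (P i.+1) <= lambda) ->
  (i + j <= n)%N -> mdist (P i) (P (i + j)%N) <= j%:R * lambda.
Proof.
move=> st; elim: j => [|j IH] ij; first by rewrite addn0 mdistxx mul0r.
have h1 := IH (ltnW (leq_trans _ ij)); apply: le_trans (dist_tri _ (P (i + j)%N) _) _.
rewrite -natr1 mulrDl mul1r addnS; apply: lerD; first by apply: h1; rewrite addnS.
by apply: st; rewrite -addnS.
Qed.

(** A block of [B] steps covers at most the distance [r] kept from the ray, hence less than the
    distance to any piece, and moves each projection by at most [D] by contraction. Progress is thus
    at most [2 * D] per block. *)
Lemma progress_bound l s u ps (P : nat -> X) n r lambda (B : nat) :
  0 <= s -> 0 < lambda -> 4 * D + 4 * lambda <= l -> (0 < B)%N -> B%:R * lambda <= r ->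
  pieces_of l s u ps -> tame r (P 0%N) s -> tame r (P n) u ->
  (forall i, (i < n)%N -> mdist (P i) (P i.+1) <= lambda) ->
  (forall i t, (0 < i < n)%N -> 0 <= t -> r < mdist (P i) (gamma t)) ->
  pieces_length ps <= 2 * (6 * r + 2 * D * (n %/ B).+1%:R + 4 * (D + 4 * lambda)).
Proof.
move=> s0 l0 lL B0 Br pcs t0 tn st out.
have r0 : 0 <= r by apply: le_trans Br; rewrite mulr_ge0 // ltW.
have lD : 2 * D < l by move: (D0) l0 lL; lra.
have h0 := progress_before s0 lD r0 pcs t0.
have hn := progress_after s0 lD r0 pcs tn.
(* Pieces have length at least [4 * D], so that clipping leaves at least half of each. *)
have half : pieces_length ps <= 2 * \sum_(p <- ps) (p.2 - p.1 - 2 * D).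
  rewrite mulr_sumr /pieces_length !big_seq; apply: ler_sum => p /(proj2 pcs)[_ _ lp _].
  by move: lp lL l0; lra.
have step i : (i < n)%N -> progress ps (P i.+1) - progress ps (P i) <= 2 * (D + 4 * lambda).
  move=> iN; apply: (progress_step s0 pcs); [by move: (D0) l0; lra|by move: lL l0 (D0); lra|].
  move=> p /(proj2 pcs)[_ _ _ CG]; have := st i iN; rewrite metric_sym => ll.
  by have [|] := cp_lip CG (P i.+1) (P i); move: ll (D0) l0; lra.
have block i j : (0 < i)%N -> (i + j < n)%N -> (j <= B)%N ->
    progress ps (P (i + j)%N) - progress ps (P i) <= 2 * D.
  move=> i0 ij jB; apply: (progress_step s0 pcs); [exact: ltW|by move: lL l0 (D0); lra|].
  move=> p /(proj2 pcs)[sp _ _ CG]; rewrite distrC; apply: (cp_contr CG).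
  have /andP[c1 _] := cp_in CG (P i).
  have hi : (0 < i < n)%N by rewrite i0; apply: leq_ltn_trans ij; exact: leq_addr.
  apply: le_trans (ltW (out i _ hi (le_trans s0 (le_trans sp c1)))).
  apply: le_trans (path_dist st (ltnW ij)) (le_trans _ Br).
  by rewrite ler_pM2r // ler_nat.
have blocks k i : (0 < i < n)%N -> (i <= 1 + k * B)%N -> progress ps (P i) - progress ps (P 1%N) <= 2 * D * k%:R.
  elim: k i => [|k IH] i /andP[i0 iN] ik.
    have -> : i = 1%N by move: i0 ik; clear; lia.
    by rewrite subrr mulr0.
  rewrite -(natr1 k) mulrDr mulr1; have [le1|gt1] := leqP i (1 + k * B).
    by have := IH i; rewrite i0 iN => /(_ isT le1); move: (D0); lra.
  pose d := minn B i.-1; have dB : (d <= B)%N by exact: geq_minl.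
  have := block (i - d)%N d; rewrite subnK; last by rewrite /d; clear; lia.
  have k1 : (0 < i - d)%N by move: i0 gt1; rewrite /d; clear; lia.
  move=> /(_ k1 iN dB); have := IH (i - d)%N; rewrite k1 (leq_ltn_trans (leq_subr _ _) iN).
  have k2 : (i - d <= 1 + k * B)%N by move: ik gt1; rewrite mulSn /d; move: (k * B)%N; clear; lia.
  by move=> /(_ isT k2); lra.
have N0 : (0 : R) <= (n %/ B)%:R by [].
have DN : 0 <= D * (n %/ B)%:R by rewrite mulr_ge0 // ltW.
(* The first and the last step are bounded separately, as the end positions may be close to the
   ray. *)
have tot : progress ps (P n) - progress ps (P 0%N) <= 2 * D * (n %/ B).+1%:R + 4 * (D + 4 * lambda).
  case: n st tn out hn step block blocks N0 DN => [|[|n]] st tn out hn step block blocks N0 DN.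
  - by rewrite subrr -(natr1 (_ %/ _)); move: DN (D0) l0; lra.
  - by have := step 0%N isT; rewrite -(natr1 (_ %/ _)); move: DN (D0) l0; lra.
  have e0 := step 0%N isT; have e1 := step n.+1 (ltnSn _).
  have := blocks (n.+2 %/ B).+1 n.+1; rewrite ltnSn => /(_ isT) e2.
  have : progress ps (P n.+1) - progress ps (P 1%N) <= 2 * D * (n.+2 %/ B).+1%:R.
    by apply: e2; have := ltn_ceil n.+2 B0; move: (_ * B)%N; clear; lia.
  by move=> e3; clear -D0 gg e0 e1 e3; lra.
by clear -D0 gg h0 hn half tot; lra.
Qed.
End Progress.

(** * Cutting a trajectory near the ray *)

Lemma last_first (Q1 Q2 : nat -> Prop) (n : nat) : exists i j, [/\ (i <= j <= n)%N,
  Q1 i \/ i = 0%N, Q2 j \/ j = n & forall m, (i < m < j)%N -> ~ Q1 m /\ ~ Q2 m].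
Proof.
pose P1 i := (i <= n)%N && `[< Q1 i \/ i = 0%N >].
have ex1 : exists i, P1 i by exists 0%N; apply/andP; split => //; apply/asboolP; right.
have ub1 i : P1 i -> (i <= n)%N by case/andP.
case: (ex_maxnP ex1 ub1) => i /andP[ni /asboolP hi] max.
pose P2 j := (i <= j <= n)%N && `[< Q2 j \/ j = n >].
have ex2 : exists j, P2 j by exists n; apply/andP; split; [rewrite ni leqnn|apply/asboolP; right].
case: (ex_minnP ex2) => j /andP[/andP[ij jn] /asboolP hj] min.
exists i, j; split => //; first by rewrite ij.
move=> m /andP[im mj]; split=> Qm.
  have : P1 m by apply/andP; split; [exact: leq_trans (ltnW mj) jn|apply/asboolP; left].
  by move/max; rewrite leqNgt im.
have : P2 m by apply/andP; split; [rewrite (ltnW im) (leq_trans (ltnW mj) jn)|apply/asboolP; left].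
by move/min; rewrite leqNgt mj.
Qed.

Section Split.
Context {R : realType} {X : metricType R}.
Implicit Types (x y z p : X) (s t u : R).

Lemma ray_nearest_ex (gamma : R -> X) p :
  (forall s t, 0 <= s -> 0 <= t -> mdist (gamma s) (gamma t) = `|s - t|) ->
  exists2 s, 0 <= s & forall t, 0 <= t -> mdist p (gamma s) <= mdist p (gamma t).
Proof.
move=> gg; pose M := 2 * mdist p (gamma 0).
have M0 : 0 <= M by rewrite mulr_ge0 // mdist_ge0.
have gM : geod 0 M gamma by move=> s t /andP[s0 _] /andP[t0 _]; exact: gg.
have [s [/andP[s0 sM] hs]] := nearest_ex p M0 gM.
exists s => // t t0; have [tM|Mt] := leP t M; first by apply: hs; rewrite t0.
apply: le_trans (hs 0 _) _; first by rewrite lexx.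
have := dist_tri (gamma 0) p (gamma t).
rewrite gg // sub0r normrN ger0_norm // (metric_sym (gamma 0)); move: Mt; rewrite /M; lra.
Qed.

Lemma ray_proj (gamma : R -> X) p s : 0 <= s ->
  proj (ray_set gamma) p (gamma s) <-> (forall t, 0 <= t -> mdist p (gamma s) <= mdist p (gamma t)).
Proof.
move=> s0; have rs t : 0 <= t -> ray_set gamma (gamma t).
  by move=> t0; exists t => //=; rewrite in_itv /= t0.
split=> [[_ E] t t0|h]; first by rewrite E; apply: setdist_le; exact: rs.
split; first exact: rs.
apply/eqP; rewrite eq_le; apply/andP; split; last by apply: setdist_le; exact: rs.
apply: lb_le_inf; first by exists (mdist p (gamma s)); exists (gamma s) => //; exact: rs.
by move=> _ [_ [t /= + <-] <-]; rewrite in_itv /= andbT; exact: h.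
Qed.

(** The ratio involves the diameter of the whole set of nearest points. Taking [s] within 1 of the
    one farthest from [t] bounds this diameter. *)
Lemma within_ratio_nearest (gamma : R -> X) k t e z p :
  (forall s t, 0 <= s -> 0 <= t -> mdist (gamma s) (gamma t) = `|s - t|) ->
  0 <= t -> 0 <= k -> mdist z (gamma t) <= e -> within_ratio k gamma z p ->
  exists s, [/\ 0 <= s, forall t, 0 <= t -> mdist p (gamma s) <= mdist p (gamma t) &
    mdist p z <= (2 * k + 1) * `|t - s| + (2 * k * (1 + e) + e)].
Proof.
move=> gg t0 k0 ze wr; have [s0 s00 hs0] := ray_nearest_ex p gg.
pose E := [set `|t - s| | s in [set s | 0 <= s /\ proj (ray_set gamma) p (gamma s)]].
have supE : has_sup E.
  split; first by exists `|t - s0|; exists s0 => //; split => //; apply/ray_proj.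
  exists (mdist p (gamma t) + mdist p (gamma t)) => _ [s [s1 /(ray_proj gamma p s1) ps] <-].
  rewrite -gg //; apply: le_trans (dist_tri _ p _) _; rewrite (metric_sym _ p) lerD2l.
  exact: ps.
have [_ [s [s1 ps] <-] hs] := sup_adherent ltr01 supE.
have near := (ray_proj gamma p s1).1 ps.
exists s; split => //.
have far s' : 0 <= s' -> proj (ray_set gamma) p (gamma s') -> `|t - s'| <= `|t - s| + 1.
  move=> s2 ps'; have : `|t - s'| <= sup E by apply: (sup_upper_bound supE); exists s'.
  by move: hs; lra.
have e0 : 0 <= e by apply: le_trans ze; exact: mdist_ge0.
pose w := `|t - s| + 1 + e.
have ball q : (proj (ray_set gamma) p `|` [set z]) q -> mdist q (gamma t) <= w.
  case=> [pq|->]; last by apply: le_trans ze _; rewrite /w lerDr addr_ge0.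
  have [[s' /= + E'] _] := pq; rewrite in_itv /= andbT => s2.
  by rewrite -E' gg // distrC; have := far s' s2; rewrite E' => /(_ pq); rewrite /w; move: e0; lra.
have diam : (diameter (proj (ray_set gamma) p `|` [set z]) <= (2 * w)%:E)%E.
  apply/diameter_le => a b /ball ha /ball hb.
  by have := dist_tri a (gamma t) b; rewrite (metric_sym (gamma t) b); move: ha hb; lra.
have dp : mdist p (gamma s) <= k * (2 * w).
  have [_ ->] := ps; rewrite -lee_fin; apply: le_trans wr _.
  by rewrite EFinM lee_wpmul2l // lee_fin.
have := dist_tri p (gamma s) z; have := dist_tri (gamma s) (gamma t) z.
rewrite gg // (distrC s) (metric_sym (gamma t)); move: dp ze; rewrite /w; lra.
Qed.

(** A good point gives each window longer than [rg] a proportion [theta / 4] of contracting pieces,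
    whose total length is limited by [progress_bound]. *)
Lemma window_le theta rg E L (gamma : R -> X) lambda r (B : nat) t s u (P : nat -> X) n :
  (forall s t, 0 <= s -> 0 <= t -> mdist (gamma s) (gamma t) = `|s - t|) ->
  0 < E -> 0 < theta -> 0 <= rg -> 0 < lambda -> 4 * E + 4 * lambda <= L -> (0 < B)%N -> B%:R * lambda <= r ->
  good_point (theta / 4) rg E L gamma t -> 0 <= s -> s <= t -> t <= u ->
  tame gamma r (P 0%N) s -> tame gamma r (P n) u ->
  (forall i, (i < n)%N -> mdist (P i) (P i.+1) <= lambda) ->
  (forall i t, (0 < i < n)%N -> 0 <= t -> r < mdist (P i) (gamma t)) ->
  let W := rg + 4 / theta * (2 * (6 * r + 2 * E * (n %/ B).+1%:R + 4 * (E + 4 * lambda))) in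
  t - s <= W /\ u - t <= W.
Proof.
move=> gg E0 th0 rg0 l0 lL B0 Br gp s0 st tu ts tn stp out W; have [t0 good] := gp.
have r0 : 0 <= r by apply: le_trans Br; rewrite mulr_ge0 // ltW.
have u0 := le_trans t0 tu.
have WI0 : 0 <= 4 / theta * (2 * (6 * r + 2 * E * (n %/ B).+1%:R + 4 * (E + 4 * lambda))).
  rewrite mulr_ge0 ?divr_ge0 ?(ltW th0) // mulr_ge0 // !addr_ge0 ?mulr_ge0 ?addr_ge0 ?mulr_ge0 ?(ltW E0) ?(ltW l0) //.
have win a b : s <= a -> a <= b -> b <= u -> prop_contracting (theta / 4) E L gamma a b -> b - a <= W.
  move=> sa ab bu [h _]; have a0 := le_trans s0 sa.
  have [ps [dec c _]] := contrP E L gamma ab; move: h; rewrite c => h.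
  have pcs : pieces_of E gamma L s u ps.
    split; first exact: decomposition_wf dec.
    move=> p /(proj1 dec)[h1 h2 h3 h4 h5]; split => //; [exact: le_trans h1|exact: le_trans bu|].
    apply: contracting_cgeod => // v w /andP[v1 _] /andP[w1 _]; apply: gg.
      by apply: le_trans v1; exact: le_trans h1.
    by apply: le_trans w1; exact: le_trans h1.
  have h2 := progress_bound E0 gg s0 l0 lL B0 Br pcs ts tn stp out.
  apply: (@le_trans _ _ (4 / theta * (2 * (6 * r + 2 * E * (n %/ B).+1%:R + 4 * (E + 4 * lambda))))).
    rewrite -ler_pdivrMl ?divr_gt0 // invf_div; exact: le_trans h h2.
  by rewrite /W lerDr.
split.
  have [h|h] := leP rg (t - s); last by rewrite /W; move: h WI0; lra.
  apply: win => //; have := good s s0; rewrite gg // ger0_norm ?subr_ge0 // => /(_ h).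
  by rewrite min_r // max_l.
have [h|h] := leP rg (u - t); last by rewrite /W; move: h WI0; lra.
apply: win => //; have := good u u0; rewrite gg // distrC ger0_norm ?subr_ge0 // => /(_ h).
by rewrite min_l // max_r.
Qed.

Lemma split_path theta rg E L lambda k e (B : nat) : 0 < E -> 0 < theta -> 0 <= rg -> 0 < lambda ->
  4 * E + 4 * lambda <= L -> (0 < B)%N -> 0 <= k -> exists b : R,
  forall (gamma : R -> X) t z (P : nat -> X) n,
  (forall s t, 0 <= s -> 0 <= t -> mdist (gamma s) (gamma t) = `|s - t|) ->
  good_point (theta / 4) rg E L gamma t -> mdist z (gamma t) <= e ->
  antipodal k gamma t z (P 0%N) (P n) ->
  (forall i, (i < n)%N -> mdist (P i) (P i.+1) <= lambda) ->
  exists i l, (i + l <= n)%N /\ mdist (P i) z + mdist (P (i + l)%N) z <=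
    (2 * k + 1) * (32 * E / theta) * (l %/ B)%:R + b.
Proof.
move=> E0 th0 rg0 l0 lL B0 k0; pose r := B%:R * lambda.
have r0 : 0 <= r by rewrite mulr_ge0 // ltW.
pose W0 := rg + 4 / theta * (2 * (6 * r + 2 * E + 4 * (E + 4 * lambda))).
exists ((2 * k + 1) * (2 * W0) + 2 * (2 * k * (1 + `|e|) + `|e| + r)).
move=> gamma t z P n gg gp ze anti st; have [t0 _] := gp.
have {}ze : mdist z (gamma t) <= `|e| by apply: le_trans ze (ler_norm e).
have Bw m : rg + 4 / theta * (2 * (6 * r + 2 * E * (m %/ B).+1%:R + 4 * (E + 4 * lambda))) =
    W0 + 16 * E / theta * (m %/ B)%:R by rewrite /W0 -(natr1 (m %/ B)); ring.
have A0 : 0 <= 2 * k * (1 + `|e|) + `|e| by rewrite addr_ge0 // mulr_ge0 ?mulr_ge0 // addr_ge0.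
(* The other labelling of the sides is treated by reversing the trajectory. *)
wlog : P anti st / proj (ray_set gamma) (P 0%N) `<=` gamma @` `[0, t] /\
    proj (ray_set gamma) (P n) `<=` gamma @` `[t, +oo[.
  move=> H; have [[[h1 h2]|[h1 h2]] w1 w2] := anti; first exact: (H P anti st (conj h1 h2)).
  have [|i iN|//|i [l [il hil]]] := H (fun m => P (n - m)%N).
  - by rewrite subn0 subnn; split => //; left.
  - rewrite metric_sym; have -> : (n - i = (n - i.+1).+1)%N by move: iN; clear; lia.
    by apply: st; move: iN; clear; lia.
  - by rewrite subn0 subnn.
  exists (n - (i + l))%N, l; split; first by move: il; clear; lia.
  have -> : (n - (i + l) + l = n - i)%N by move: il; clear; lia.
  by rewrite addrC.
move=> [h1 h2]; have [_ w1 w2] := anti.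
have [sx [sx0 nx bx]] := within_ratio_nearest gg t0 k0 ze w1.
have [uy [uy0 ny by_]] := within_ratio_nearest gg t0 k0 ze w2.
have inj a b : 0 <= a -> 0 <= b -> gamma a = gamma b -> a = b.
  by move=> a0 b0 E'; have := gg a b a0 b0; rewrite E' mdistxx => /esym/eqP; rewrite normr_eq0 subr_eq0 => /eqP.
have sxt : sx <= t.
  have [|s /=] := h1 (gamma sx); first by apply/ray_proj.
  by rewrite in_itv /= => /andP[s0 s1] E'; rewrite -(inj s sx s0 sx0 E').
have tuy : t <= uy.
  have [|s /=] := h2 (gamma uy); first by apply/ray_proj.
  rewrite in_itv /= andbT => s0 E'; rewrite -(inj s uy _ uy0 E') //; exact: le_trans s0.
pose Q1 i := exists s, [/\ 0 <= s, s <= t & mdist (P i) (gamma s) <= r].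
pose Q2 i := exists2 s, t <= s & mdist (P i) (gamma s) <= r.
have [i [j [/andP[ij jn] hi hj mid]]] := last_first Q1 Q2 n.
have k21 : 1 <= 2 * k + 1 by rewrite lerDr mulr_ge0.
have near p s : 0 <= s -> mdist p (gamma s) <= r -> mdist p z <= (2 * k + 1) * `|t - s| + (2 * k * (1 + `|e|) + `|e| + r).
  move=> s0 ps; have := dist_tri p (gamma s) z; have := dist_tri (gamma s) (gamma t) z.
  rewrite gg // (distrC s) (metric_sym (gamma t)).
  have : `|t - s| <= (2 * k + 1) * `|t - s| by rewrite ler_peMl.
  have : 0 <= 2 * k * (1 + `|e|) by rewrite mulr_ge0 ?mulr_ge0 ?addr_ge0.
  by move: ps ze; lra.
(* Without an index near the side of the start, the cut is at index 0 and the nearest parameter [sx]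
   of the start is used; both cases are tame. *)
have [s [s0 st' tames ds]] : exists s, [/\ 0 <= s, s <= t, tame gamma r (P i) s &
    mdist (P i) z <= (2 * k + 1) * `|t - s| + (2 * k * (1 + `|e|) + `|e| + r)].
  case: hi => [[s [s0 s1 s2]]|->]; first by exists s; split => //; [left|exact: near].
  by exists sx; split => //; [right|move: bx r0; lra].
have [u [tu tameu du]] : exists u, [/\ t <= u, tame gamma r (P j) u &
    mdist (P j) z <= (2 * k + 1) * `|t - u| + (2 * k * (1 + `|e|) + `|e| + r)].
  case: hj => [[u u0 u1]|->]; first by exists u; split => //; [left|apply: near => //; exact: le_trans u0].
  by exists uy; split => //; [right|move: by_ r0; lra].
exists i, (j - i)%N; rewrite subnKC //; split => //.
have [||||] := @window_le theta rg E L gamma lambda r B t s u (fun m => P (i + m)%N) (j - i)%N gg E0 th0 rg0 l0 lL B0 (lexx _) gp s0 st' tu.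
- by rewrite addn0.
- by rewrite subnKC.
- by move=> m mj; rewrite addnS; apply: st; move: ij jn mj; clear; lia.
- move=> m v mj v0; have [|n1 n2] := mid (i + m)%N; first by move: mj; clear; lia.
  rewrite ltNge; apply/negP => h; have [vt|tv] := leP v t; first by apply: n1; exists v.
  by apply: n2; exists v => //; exact: ltW.
rewrite Bw => b1 b2; move: ds du; rewrite (distrC t u) (ger0_norm (x := t - s)) ?subr_ge0 // (ger0_norm (x := u - t)) ?subr_ge0 // => ds du.
have k210 : 0 <= 2 * k + 1 by apply: le_trans (ler01) k21.
have c1 := ler_wpM2l k210 b1; have c2 := ler_wpM2l k210 b2.
have -> : (2 * k + 1) * (32 * E / theta) * ((j - i) %/ B)%:R = 2 * ((2 * k + 1) * (16 * E / theta * ((j - i) %/ B)%:R)).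
  by ring.
by clear -R c1 c2 ds du; lra.
Qed.
End Split.

(** * The two inequalities for the Green function *)

Lemma exprn_small (R : realType) (rho e : R) : 0 < rho -> rho < 1 -> 0 < e ->
  exists2 K : nat, (0 < K)%N & rho ^+ K <= e.
Proof.
move=> r0 r1 e0; have r1' : 0 < 1 - rho by rewrite subr_gt0.
pose K := (Num.bound (e^-1 / (1 - rho))).+1.
have KB : e^-1 / (1 - rho) < K%:R.
  apply: lt_trans (archi_boundP _) _; last by rewrite ltr_nat.
  by rewrite divr_ge0 ?invr_ge0 ?ltW.
exists K => //; have := geometric_le 0 K r0 r1.
have : K%:R * rho ^+ K <= \sum_(0 <= n < K) rho ^+ n.
  rewrite mulr_natl -[X in _ *+ X]subn0 -sumr_const_nat; apply: ler_sum_nat => n /andP[_ nK].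
  by apply: ler_wiXn2l; rewrite ?ltW // ltnW.
move=> h1 /(le_trans h1); rewrite expr0 => h2.
have K0 : 0 < K%:R :> R by rewrite ltr0n.
rewrite -(ler_pM2l K0); apply: le_trans h2 _.
by rewrite -ler_pdivrMr // mul1r mulrC; exact: ltW.
Qed.

Section Words.
Context {R : realType} {G : groupType} {X : metricType R}.
Variables (act : G -> X -> X) (o : X) (mu : {fsfun G -> R with 0}) (S : {fset G}) (eps : R).
Hypotheses (symS : symmetric_set [set` S]) (genS : generates [set` S]).
Hypothesis aconst : action_constant act o mu S eps.

Lemma word_ex (g : G) : exists2 u : seq G, {subset u <= S} & gprod u = g.
Proof.
suff : [set g : G | exists2 u : seq G, {subset u <= S} & gprod u = g] g by [].
move: genS => /seteqP[_ /(_ g I)]; apply; split.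
  split; first by exists [::]; rewrite ?big_nil.
  move=> x y [u uS pu] [v vS pv]; have [w [wS _ pw]] := inv_word symS vS.
  exists (u ++ w); last by rewrite big_cat /= pu pw pv.
  by move=> t; rewrite mem_cat => /orP[/uS|/wS].
by move=> s sS; exists [:: s]; rewrite ?big_seq1 // => t; rewrite inE => /eqP->.
Qed.

Lemma short_word (g h : G) : exists u : seq G, [/\ {subset u <= S}, (g * gprod u)%g = h &
  (size u)%:R <= eps * mdist (act g o) (act h o) + eps + 1].
Proof.
have [_ _ wd _] := aconst; have [_ le] := wd g h.
pose W : set R := [set (size w)%:R | w in [set w : seq G |
    {subset w <= S} /\ (\big[*%g/1%g]_(s <- w) s = g^-1 * h)%g]].
have hW : has_inf W.
  split; first by have [u uS pu] := word_ex (g^-1 * h)%g; exists (size u)%:R; exists u.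
  by exists 0 => _ [w _ <-].
have [_ [u [uS pu] <-] lt] := inf_adherent ltr01 hW.
exists u; split => //; first by rewrite pu mulVKg.
by apply: le_trans (ltW lt) _; rewrite lerD2r.
Qed.
End Words.

Section Ancona.
Context {R : realType} {G : groupType} {X : metricType R}.
Variables (act : G -> X -> X) (o : X) (mu : {fsfun G -> R with 0}) (S : {fset G}) (eps : R).
Hypotheses (na : ~ amenable R G) (gact : geometric_action act).
Hypotheses (pmu : probability_weight mu) (irr : irreducible_weight mu).
Hypotheses (symS : symmetric_set [set` S]) (genS : generates [set` S]).
Hypothesis muS : {subset finsupp mu <= S}.
Hypothesis aconst : action_constant act o mu S eps.
Hypothesis reach : reachable mu = setT.
Variable lambda : R.
Hypotheses (lambda0 : 0 < lambda) (lambdaS : forall s : G, s \in S -> mdist o (act s o) <= lambda).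

Lemma ancona (theta rg E L k : R) : 0 < E -> 0 < theta -> 0 <= rg ->
  4 * E + 4 * lambda <= L -> 0 < k ->
  exists2 C : R, 0 < C & forall (gamma : R -> X) (t : R) (x y z : G),
  (forall s t, 0 <= s -> 0 <= t -> mdist (gamma s) (gamma t) = `|s - t|) ->
  good_point (theta / 4) rg E L gamma t -> mdist (act z o) (gamma t) <= eps ->
  antipodal k gamma t (act z o) (act x o) (act y o) ->
  (C^-1%:E * (green mu x z * green mu z y) <= green mu x y /\
   green mu x y <= C%:E * (green mu x z * green mu z y))%E.
Proof.
move=> E0 th0 rg0 lL k0.
have [C1 [rho [C10 rho0 rho1 mu_exp]]] := conv_pow_exp pmu na irr.
have [c [c0 c1 hc]] := harnack pmu C10 rho0 rho1 mu_exp S reach.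
have g1 := gr1_ge1 C10 rho0 rho1 mu_exp.
have g10 : 0 < gr mu 1%g by apply: lt_le_trans g1.
have S0 : 0 <= (#|` S|%:R : R) by [].
have [K K0 hK] : exists2 K : nat, (0 < K)%N & #|` S|%:R * (rho ^+ K / c) <= 1 / 2.
  have [|K K0 hK] := @exprn_small _ rho (c / 2 / (#|` S|%:R + 1)) rho0 rho1.
    by rewrite divr_gt0 ?divr_gt0 // ltr_wpDl.
  exists K => //; apply: (@le_trans _ _ ((#|` S|%:R + 1) * (rho ^+ K / c))).
    by rewrite ler_wpM2r ?lerDl // divr_ge0 ?exprn_ge0 // ltW.
  move: hK; rewrite ler_pdivlMr ?ltr_wpDl // mulrA ler_pdivrMr // => h.
  by move: h; rewrite mulrC; lra.
pose a := (2 * k + 1) * (32 * E / theta).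
have [e1 _ _ _] := aconst; have eps0 : 0 < eps by apply: lt_trans e1.
have a0 : 0 <= a.
  apply: mulr_ge0; first by rewrite addr_ge0 // mulr_ge0 // ltW.
  by apply: divr_ge0; [apply: mulr_ge0 => //; exact: ltW|exact: ltW].
(* [l] steps allow about [a * (l / B)] of distance to [z]; this choice of [B] makes [K] times the
   lengths of the corresponding words at most [l + K']. *)
pose B := (Num.bound (K%:R * eps * a)).+1.
have aB : K%:R * eps * a <= B%:R.
  apply: ltW; apply: lt_trans (archi_boundP _) _; last by rewrite ltr_nat.
  by rewrite mulr_ge0 // mulr_ge0 // ltW.
have [b hb] := @split_path R X theta rg E L lambda k eps B E0 th0 rg0 lambda0 lL isT (ltW k0).
pose K' := Num.bound `|K%:R * (eps * b + 2 * eps + 2)|.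
have bK' : K%:R * (eps * b + 2 * eps + 2) <= K'%:R.
  by apply: le_trans (ler_norm _) _; apply: ltW; apply: archi_boundP.
pose Cu := 4 * C1 / (rho ^+ K' * (1 - rho)).
have Cu0 : 0 < Cu by rewrite divr_gt0 ?mulr_gt0 ?exprn_gt0 ?subr_gt0.
exists (Cu + gr mu 1%g); first exact: addr_gt0.
move=> gamma t x y z gg gp ze anti.
have gge h : 0 <= gr mu h by exact: (gr_ge0 pmu C10 rho0 rho1 mu_exp).
rewrite !(greenE pmu C10 rho0 rho1 mu_exp) -!EFinM !lee_fin.
have GG0 : 0 <= gr mu (x^-1 * z)%g * gr mu (z^-1 * y)%g by exact: mulr_ge0.
split.
  rewrite -ler_pdivlMl ?invr_gt0 ?addr_gt0 // invrK.
  have := gr_mul_le pmu C10 rho0 rho1 mu_exp (x^-1 * z)%g (z^-1 * y)%g.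
  rewrite mulgA mulgK => h; apply: le_trans h _.
  by rewrite ler_wpM2r // lerDr ltW.
apply: (@le_trans _ _ (Cu * (gr mu (x^-1 * z)%g * gr mu (z^-1 * y)%g))); last first.
  by rewrite ler_wpM2r // lerDl ltW.
apply: (green_upper pmu C10 rho0 rho1 mu_exp symS c0 c1 hc K0 hK).
move=> w wS wy.
pose g i := (x * gprod (take i w))%g.
have [||i [l [il hil]]] := hb gamma t (act z o) (fun i => act (g i) o) (size w) gg gp ze.
- by rewrite /g take0 big_nil mulg1 take_size wy.
- move=> i iw; rewrite /g (take_nth 1%g iw) -cats1 big_cat big_seq1 /= mulgA.
  rewrite (actM gact (x * gprod (take i w))%g) (act_iso gact); apply: lambdaS; apply: muS; apply: wS; exact: mem_nth.
have [u [uS pu su]] := short_word symS genS aconst z (g i).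
have [v [vS pv sv]] := short_word symS genS aconst z (g (i + l)%N).
exists i, l, u, v; split => //.
have KR : K%:R * ((size u)%:R + (size v)%:R) <= l%:R + K'%:R :> R.
  apply: (@le_trans _ _ (K%:R * (eps * (a * (l %/ B)%:R + b) + 2 * eps + 2))).
    apply: ler_wpM2l => //; apply: le_trans (lerD su sv) _.
    move: hil; rewrite -/a (metric_sym (act (g i) o)) (metric_sym (act (g (i + l)%N) o)) => hil.
    have := ler_wpM2l (ltW eps0) hil; lra.
  have h1 : K%:R * eps * a * (l %/ B)%:R <= B%:R * (l %/ B)%:R by exact: ler_wpM2r.
  have h2 : B%:R * (l %/ B)%:R <= l%:R :> R by rewrite -natrM ler_nat mulnC leq_trunc_div.
  have -> : K%:R * (eps * (a * (l %/ B)%:R + b) + 2 * eps + 2) =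
    K%:R * eps * a * (l %/ B)%:R + K%:R * (eps * b + 2 * eps + 2) by ring.
  by apply: lerD bK'; exact: le_trans h1 h2.
by rewrite -(ler_nat R) natrM !natrD.
Qed.
End Ancona.

Lemma long_piece (R : realType) (X : metricType R) (theta D L : R) (gamma : R -> X) :
  prop_contracting_ray theta D L gamma -> exists a b,
  [/\ L <= b - a, geod a b gamma & contracting D (gamma @` `[a, b])].
Proof.
move=> [gg hlim th0].
have [||C C0 hC] := @contr_lower _ _ theta (theta / 2) D L gamma _ _ hlim; [lra|lra|].
pose m := (Num.bound (C / (theta / 2))).
have hm : C < theta / 2 * m%:R.
  by rewrite mulrC -ltr_pdivrMr ?divr_gt0 // archi_boundP // divr_ge0 // divr_ge0 // ltW.
have [[|p ps] [dec c _]] := contrP D L gamma (ler0n R m).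
  by have := hC m; rewrite c /pieces_length big_nil; move: hm; lra.
have [h1 h2 h3 h4 h5] := proj1 dec p (mem_head _ _).
exists p.1, p.2; split => // s t /andP[s1 _] /andP[t1 _].
by apply: gg; rewrite in_itv /= andbT; apply: le_trans h1 _.
Qed.

Theorem theorem1p15 (R : realType) (G : groupType) (X : metricType R)
    (act : G -> X -> X) (o : X) (mu : {fsfun G -> R with 0})
    (S : {fset G}) (eps : R) :
  ~ amenable R G ->
  proper_space X -> geodesic_space X -> geometric_action act ->
  probability_weight mu -> irreducible_weight mu ->
  symmetric_set [set` S] -> generates [set` S] -> {subset finsupp mu <= S} ->
  action_constant act o mu S eps ->
  forall D : R, 0 < D ->
  exists L0 : R, forall L : R, L0 <= L ->
  forall theta : R, 0 < theta -> theta <= 1 ->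
  exists (r : R) (C : R -> R),
    [/\ 0 < r, forall k, 0 < k -> 0 < C k &
    forall gamma : R -> X, prop_contracting_ray theta D L gamma ->
    exists t : nat -> R,
      [/\ forall n, good_point (theta / 4) r (10 * D) L gamma (t n),
          forall M : R, exists n, M < t n &
          forall (n : nat) (zn : G), mdist (act zn o) (gamma (t n)) <= eps ->
          forall (k : R) (x y : G), 0 < k ->
            antipodal k gamma (t n) (act zn o) (act x o) (act y o) ->
            ((C k)^-1%:E * (green mu x zn * green mu zn y) <= green mu x y /\
             green mu x y <= (C k)%:E * (green mu x zn * green mu zn y))%E]].
Proof.
move=> na propX geoX gact pmu irr symS genS muS aconst D D0.
have [L1 full] := reachable_full na propX geoX gact pmu irr aconst D0.
have [lam lam0 hlam] := @seq_bound R G S (fun s => mdist o (act s o)).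
have lam1 : 0 < lam + 1 by rewrite ltr_wpDl.
have D10 : 0 < 10 * D by rewrite mulr_gt0.
exists (Num.max L1 (4 * (10 * D) + 4 * (lam + 1))) => L; rewrite ge_max => /andP[L1L lL] theta th0 th1.
have L0 : 0 < L by apply: lt_le_trans lL; rewrite addr_gt0 // mulr_gt0.
(* If some element is unreachable there is no such ray: it would contain a contracting piece of
   length [L], which makes everything reachable. Any constants do. *)
have [reach|nreach] := pselect (reachable mu = setT); last first.
  exists 1, (fun _ => 1); split => // gamma ray; exfalso; apply: nreach.
  have [a [b [ab gab cab]]] := long_piece ray.
  exact: (full gamma a b (le_trans L1L ab)).
pose r := 12 * (2 * L + 2) / theta.
have r0 : 0 < r by rewrite divr_gt0 // mulr_gt0 // addr_gt0 // mulr_gt0.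
have hS s : s \in S -> mdist o (act s o) <= lam + 1 by move=> /hlam h; apply: le_trans h _; rewrite lerDl.
have anc := ancona na gact pmu irr symS genS muS aconst reach lam1 hS D10 th0 (ltW r0) lL.
(* The value 1 is a default for [k] not positive. *)
pose C k := if pselect (0 < k) is left k0 then s2val (cid2 (anc k k0)) else 1.
exists r, C; split => //.
  by move=> k k0; rewrite /C; case: pselect => // k0'; case: cid2.
move=> gamma ray; have th01 : 0 < theta <= 1 by rewrite th0.
pose t n := s2val (cid2 (good_points_at geoX n D0 L0 th01 ray)).
exists t; split.
- by move=> n; rewrite /t; case: cid2.
- move=> M; exists (Num.bound `|M|); apply: (@lt_le_trans _ _ (Num.bound `|M|)%:R).
    by apply: le_lt_trans (ler_norm M) (archi_boundP _).
  by rewrite /t; case: cid2.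
move=> n zn hz k x y k0 anti; rewrite /C; case: pselect => // k0'; case: cid2 => C' /= _ hC.
apply: (hC gamma (t n) x y zn) => //; last by rewrite /t; case: cid2.
by have [gg _ _] := ray; move=> u v u0 v0; apply: gg; rewrite in_itv /= andbT.
Qed.
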